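(* Let $k\geq 0$, $n\geq 1$ be integers, let $U\subset\mathbb{C}$ be a bounded planar domain, and let the boundary $\Gamma$ of $U$ be of class $\mathcal{C}^{k+n+1}$. Then, for $0<\alpha<1$, the Cauchy-Nørlund transform $\mathcal{B}_n$ is a continuous linear map from $\mathcal{C}^{k+n-1,\alpha}(\Gamma)$ to $\mathcal{A}^{k,\alpha}_{\rm sym}(U^n)$.
   Context: The Cauchy-Nørlund transform $\mathcal{B}_n$ maps a continuous function $\phi$ on $\Gamma=\partial U$ (positively oriented as the boundary of $U$) to the holomorphic function on the $n$-fold Cartesian product $U^n\subset\mathbb{C}^n$ given by $$\mathcal{B}_n\phi(z_1,\dots,z_n)=\frac{1}{2\pi i}\int_\Gamma\frac{\phi(t)}{\prod_{j=1}^n(t-z_j)}\,dt.$$ For an integer $m\ge0$ and $0<\alpha<1$, $\mathcal{C}^{m,\alpha}(\Gamma)$ is the Banach space of functions on the curve $\Gamma$ that are $m$ times continuously differentiable with respect to arc length and whose $m$-th derivative is Hölder continuous of order $\alpha$, with norm $\|\phi\|_{\mathcal{C}^{m,\alpha}(\Gamma)}=\sum_{j=0}^m\|\phi^{(j)}\|_\infty+|\phi^{(m)}|_\alpha$, where derivatives are with respect to arc length and $|\psi|_\alpha=\sup_{s\ne s'}\frac{|\psi(s)-\psi(s')|}{|s-s'|^\alpha}$. A function $f\in\mathcal{O}(U^n)$ is symmetric if $f(z)=f(z_{\sigma(1)},\dots,z_{\sigma(n)})$ for every $z\in U^n$ and every permutation $\sigma\in S_n$; $\mathcal{O}_{\rm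 sym}(U^n)$ is the space of symmetric holomorphic functions on $U^n$. The space $\mathcal{A}^{k,\alpha}_{\rm sym}(U^n)=\mathcal{C}^{k,\alpha}(U^n)\cap\mathcal{O}_{\rm sym}(U^n)$ consists of those $\Phi\in\mathcal{O}_{\rm sym}(U^n)$ with finite norm $$\|\Phi\|_{\mathcal{C}^{k,\alpha}(U^n)}=\sum_{|\gamma|\le k}\|\partial^\gamma\Phi\|_\infty+\sum_{|\gamma|=k}|\partial^\gamma\Phi|_\alpha,$$ where $\gamma$ ranges over multi-indices in $\mathbb{N}^n$, $\partial^\gamma=(\partial/\partial z_1)^{\gamma_1}\cdots(\partial/\partial z_n)^{\gamma_n}$, $\|\cdot\|_\infty$ is the supremum norm on $U^n$, and $|\Psi|_\alpha=\sup_{z\ne w}\frac{|\Psi(z)-\Psi(w)|}{|z-w|^\alpha}$; it carries this norm. *)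

(* Defs.v *)
From HB Require Import structures.
From mathcomp Require Import all_boot all_order all_algebra all_fingroup.
From mathcomp Require Import complex.
From mathcomp Require Import all_classical all_reals all_analysis.

Set Implicit Arguments.
Unset Strict Implicit.
Unset Printing Implicit Defensive.

Import Order.TTheory GRing.Theory Num.Theory.
Import numFieldNormedType.Exports.

Local Open Scope ring_scope.
Local Open Scope classical_set_scope.
Local Open Scope complex_scope.

(* The cast makes the topology and the norm of the numFieldType R[i] available;
   with it, [differentiable] over Cplx R is complex differentiability. *)
Notation Cplx R := (R[i] : numFieldType).

Section Defs.
Context {R : realType}.
Local Notation C := (Cplx R).
Local Notation Re := (@complex.Re R).
Local Notation Im := (@complex.Im R).

(* The modulus as an element of R (the library norm `|z| lives in R[i]). *)
Definition modulus (z : R[i]) : R := ComplexField.Normc.normc z.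

Definition bounded_domain (U : set C) : Prop :=
  [/\ open U, connected U, U !=set0 & bounded_set U].

Definition frontier (U : set C) : set C := closure U `\` U°.

Definition Cm_real (m : nat) (f : R -> R) : Prop :=
  (forall j s, (j < m)%N -> derivable (f^`(j)) s 1) /\ continuous (f^`(m)).

Definition Cm (m : nat) (f : R -> R[i]) : Prop :=
  Cm_real m (Re \o f) /\ Cm_real m (Im \o f).

Definition cderive1n (m : nat) (f : R -> R[i]) (s : R) : R[i] :=
  (Re \o f)^`(m) s +i* (Im \o f)^`(m) s.

Definition Cintegral (a b : R) (f : R -> R[i]) : R[i] :=
  (\int[lebesgue_measure]_(s in `[a, b]) Re (f s))
  +i* (\int[lebesgue_measure]_(s in `[a, b]) Im (f s)).

(* A finite family of closed curves, the i-th one being given by a map on the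
   whole real line, meant to be periodic of period length_of i. *)
Record curves := Curves {
  ncomp : nat;
  length_of : 'I_ncomp -> R;
  path_of : 'I_ncomp -> R -> R[i] }.

(* The boundary of U is of class C^m: it is a finite disjoint union of Jordan
   curves of class C^m, with U on exactly one side of each.  G is an arc length
   parametrization of it with the positive orientation: U lies on the left,
   i.e. 'i * tangent is the inward normal. *)
Record positive_Cm_boundary (m : nat) (U : set C) (G : curves) : Prop := {
  length_gt0 : forall i : 'I_(ncomp G), 0 < length_of i;
  path_periodic : forall (i : 'I_(ncomp G)) s,
    path_of i (s + length_of i) = path_of i s;
  path_simple : forall (i j : 'I_(ncomp G)) s t,
    0 <= s < length_of i -> 0 <= t < length_of j ->
    path_of i s = path_of j t -> i = j /\ s = t;
  path_Cm : forall i : 'I_(ncomp G), Cm m (path_of i);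
  path_unit_speed : forall (i : 'I_(ncomp G)) s,
    modulus (cderive1n 1 (path_of i) s) = 1;
  path_frontier : frontier U =
    [set t | exists (i : 'I_(ncomp G)) s, t = path_of i s];
  path_positive : forall (i : 'I_(ncomp G)) s,
    \forall e \near 0^'+,
      U (path_of i s + e%:C * ('i%C * cderive1n 1 (path_of i) s)) /\
      ~ closure U (path_of i s - e%:C * ('i%C * cderive1n 1 (path_of i) s)) }.

Definition contour_integral (G : curves) (f : R[i] -> R[i]) : R[i] :=
  \sum_(i < ncomp G)
    Cintegral 0 (length_of i)
      (fun s => f (path_of i s) * cderive1n 1 (path_of i) s).

Definition cauchy_norlund (G : curves) (n : nat) (phi : R[i] -> R[i])
    (z : 'rV[C]_n) : R[i] :=
  (2 * (pi : R)%:C * 'i%C)^-1 *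
  contour_integral G (fun t => phi t / \prod_(j < n) (t - z 0 j)).

(* Functions on the curve are represented by functions on R[i]; only their
   values on the curve matter below. *)
Definition curve_deriv (G : curves) (j : nat) (phi : R[i] -> R[i])
    (i : 'I_(ncomp G)) : R -> R[i] :=
  cderive1n j (phi \o path_of i).

Definition curve_sup_norm (G : curves) (psi : 'I_(ncomp G) -> R -> R[i]) :
    \bar R :=
  ereal_sup [set x | exists i s, x = (modulus (psi i s))%:E].

(* s and s' are arc length parameters on the same component. *)
Definition curve_holder_seminorm (alpha : R) (G : curves)
    (psi : 'I_(ncomp G) -> R -> R[i]) : \bar R :=
  ereal_sup [set x | exists i s s', s != s' /\
    x = (modulus (psi i s - psi i s') / `|s - s'| `^ alpha)%:E].

Definition curve_norm (m : nat) (alpha : R) (G : curves) (phi : R[i] -> R[i]) :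
    \bar R :=
  (\sum_(j < m.+1) curve_sup_norm (@curve_deriv G j phi)
   + curve_holder_seminorm alpha (@curve_deriv G m phi))%E.

Definition curve_space (m : nat) (alpha : R) (G : curves) :
    set (R[i] -> R[i]) :=
  [set phi : R[i] -> R[i] |
    (forall i : 'I_(ncomp G), Cm m (phi \o path_of i)) /\
    (curve_norm m alpha G phi < +oo)%E].

Definition power_domain (n : nat) (U : set C) : set 'rV[C]_n :=
  [set z | forall j, U (z 0 j)].

Definition partial (n : nat) (j : 'I_n) (F : 'rV[C]_n -> C) : 'rV[C]_n -> C :=
  fun z => 'D_(delta_mx 0 j) F z.

(* partial_1^(gamma_1) ( ... (partial_n^(gamma_n) F)) *)
Definition mpartial (n : nat) (gamma : 'I_n -> nat) (F : 'rV[C]_n -> C) :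
    'rV[C]_n -> C :=
  foldr (fun j => iter (gamma j) (partial j)) F (enum 'I_n).

Definition holomorphic_on (n : nat) (D : set 'rV[C]_n) (F : 'rV[C]_n -> C) :
    Prop :=
  forall z, D z -> differentiable F z.

Definition symmetric_on (n : nat) (D : set 'rV[C]_n) (F : 'rV[C]_n -> C) :
    Prop :=
  forall z (sigma : 'S_n), D z -> F z = F (col_perm sigma z).

Definition euclidean_norm (n : nat) (z : 'rV[C]_n) : R :=
  Num.sqrt (\sum_(j < n) modulus (z 0 j) ^+ 2).

Definition sup_norm (n : nat) (D : set 'rV[C]_n) (F : 'rV[C]_n -> C) : \bar R :=
  ereal_sup [set x | exists2 z, D z & x = (modulus (F z))%:E].

Definition holder_seminorm (alpha : R) (n : nat) (D : set 'rV[C]_n)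
    (F : 'rV[C]_n -> C) : \bar R :=
  ereal_sup [set x | exists z w, [/\ D z, D w, z != w &
    x = (modulus (F z - F w) / euclidean_norm (z - w) `^ alpha)%:E]].

(* Multi-indices of length at most k have all their entries at most k, hence
   the finite type {ffun 'I_n -> 'I_k.+1}. *)
Definition holder_norm (k : nat) (alpha : R) (n : nat) (D : set 'rV[C]_n)
    (F : 'rV[C]_n -> C) : \bar R :=
  (\sum_(g : {ffun 'I_n -> 'I_k.+1} | (\sum_(j < n) g j <= k)%N)
     sup_norm D (mpartial (fun j => g j : nat) F)
   + \sum_(g : {ffun 'I_n -> 'I_k.+1} | (\sum_(j < n) g j == k)%N)
     holder_seminorm alpha D (mpartial (fun j => g j : nat) F))%E.

Definition sym_holder_space (k : nat) (alpha : R) (n : nat) (U : set C) :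
    set ('rV[C]_n -> C) :=
  [set F | [/\ holomorphic_on (power_domain U) F,
               symmetric_on (power_domain U) F &
               (holder_norm k alpha (power_domain U) F < +oo)%E]].

End Defs.

Arguments curves : clear implicits.

(* Main.v *)
Require Import Defs.
From HB Require Import structures.
From mathcomp Require Import all_boot all_order all_algebra all_fingroup.
From mathcomp Require Import complex.
From mathcomp Require Import all_classical all_reals all_analysis.
From mathcomp Require Import ring lra.
Set Implicit Arguments.
Unset Strict Implicit.
Unset Printing Implicit Defensive.
Import Order.TTheory GRing.Theory Num.Theory.
Import numFieldNormedType.Exports.
Local Open Scope ring_scope.
Local Open Scope classical_set_scope.
Local Open Scope complex_scope.

(** Differentiating under the integral, a partial derivative of the transform is a multiple of
    a contour integral

      [\oint phi t / \prod_j (t - z_j) ^+ (e_j + 1)],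

    so everything comes down to Cauchy integrals with at most [N + 1] poles, counted with
    multiplicity, where [N = k + n] and [phi] is of class C^(N - 1, alpha).  With at most [N]
    poles the integral is bounded uniformly in the poles (pole_bound).  With [N + 1] poles, one
    of them at [w] of order at least two, it is at most a multiple of [d ^ (alpha - 1)], where
    [d] is the distance from [w] to the curve (pole_growth).  The first estimate bounds the
    derivatives of order at most [k].  The second one bounds the derivative, in one of the
    variables, of those of order [k], which makes them Hoelder continuous (hardy_littlewood).
    The constants depend only on the norm of [phi], and the transform is linear, which gives
    continuity.

    Both estimates are proved by induction on the number of poles other than [w].

    If [w] is the only pole, integrating by parts along the curve lowers its order to two
    (cauchy_pole_bound), and each step replaces the density [u] by its complex derivative
    [u' * conjc tan], the tangent having modulus one.  A double pole has integral zero over a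
    closed curve, so [u] may be replaced by [u - u s0] with [s0] the nearest point, and the
    integrand is then at most a multiple of [(`|s - s0| + d) ^ (alpha - 2)] (double_pole_bound).

    A further simple pole [z] is removed in one of two ways (pole_bound_step, pole_growth_step).
    If [z] is far from [w], partial fractions do it.  Otherwise consider the integral as a
    function of [w] and multiply it by [(z - w) ^ l], with [l] the order of the pole at [w].  The
    product vanishes at [w = z], and its derivative is a multiple of [(z - w) ^ (l - 1)] times a
    Cauchy integral without the pole [z] (shifted_pole_cdiff).  The induction hypothesis bounds
    the derivative, and integration along a path in [U] from [z] to [w] bounds the product.

    These paths are where the smoothness of the boundary is used.  The Lipschitz tangent and
    compactness make chords and arcs comparable (chord_arc), so that cones in the normal
    direction miss the curve, and the orientation puts the exterior ones outside [U]
    (exterior_cone).  Hence pushing a point of [U] along the normal moves it away from the curve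
    at a definite rate (interior_cone).

    All functions of a complex variable below are integrals of rational functions, so they have
    first order expansions with a quadratic remainder (uniform_deriv); these are stable under
    products and contour integration, uniformly in parameters.  Integrals are bounded through
    primitives and the mean value inequality. *)

Arguments modulus : simpl never.

(** * The modulus of a complex number *)

Section Modulus.
Context {R : realType}.
Implicit Types (x y z : R[i]) (a b : R).

Lemma modulusE z : modulus z = Num.sqrt (complex.Re z ^+ 2 + complex.Im z ^+ 2).
Proof. by case: z. Qed.

Lemma normcE z : `|z| = (modulus z)%:C.
Proof. by case: z. Qed.

Lemma modulus_ge0 z : 0 <= modulus z.
Proof. by rewrite modulusE sqrtr_ge0. Qed.

Lemma modulus0 : modulus (0 : R[i]) = 0.
Proof. exact: ComplexField.Normc.normc0. Qed.

Lemma modulus1 : modulus (1 : R[i]) = 1.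
Proof. exact: ComplexField.Normc.normc1. Qed.

Lemma modulusM x y : modulus (x * y) = modulus x * modulus y.
Proof. exact: ComplexField.Normc.normcM. Qed.

Lemma modulusV x : modulus x^-1 = (modulus x)^-1.
Proof. exact: ComplexField.Normc.normcV. Qed.

Lemma modulusX x n : modulus (x ^+ n) = modulus x ^+ n.
Proof. by elim: n => [|n IH]; rewrite ?modulus1// !exprS modulusM IH. Qed.

Lemma modulusD x y : modulus (x + y) <= modulus x + modulus y.
Proof. exact: le_normcD. Qed.

Lemma modulusN x : modulus (- x) = modulus x.
Proof. exact: normcN. Qed.

Lemma modulusB x y : modulus (x - y) <= modulus x + modulus y.
Proof. by rewrite -(modulusN y) modulusD. Qed.

Lemma modulusC x y : modulus (x - y) = modulus (y - x).
Proof. by rewrite -modulusN opprB. Qed.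

Lemma modulus_eq0 z : (modulus z == 0) = (z == 0).
Proof.
apply/eqP/eqP => [|->]; first exact: ComplexField.Normc.eq0_normc.
exact: modulus0.
Qed.

Lemma modulus_gt0 z : (0 < modulus z) = (z != 0).
Proof. by rewrite lt0r modulus_eq0 modulus_ge0 andbT. Qed.

Lemma modulus_real a : modulus (a%:C) = `|a|.
Proof. by rewrite modulusE /= expr0n addr0 sqrtr_sqr. Qed.

Lemma modulus_i : modulus ('i : R[i]) = 1.
Proof. by rewrite modulusE /= expr0n add0r expr1n sqrtr1. Qed.

Lemma modulus_conj z : modulus (conjc z) = modulus z.
Proof. by case: z => a b; rewrite !modulusE /= sqrrN. Qed.

Lemma modulus_nat n : modulus (n%:R : R[i]) = n%:R.
Proof. by rewrite -(rmorph_nat (real_complex R)) modulus_real normr_nat. Qed.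

Lemma normr_Re_le z : `|complex.Re z| <= modulus z.
Proof. by rewrite modulusE -sqrtr_sqr ler_wsqrtr// lerDl sqr_ge0. Qed.

Lemma normr_Im_le z : `|complex.Im z| <= modulus z.
Proof. by rewrite modulusE -sqrtr_sqr ler_wsqrtr// lerDr sqr_ge0. Qed.

Lemma cRe_le_modulus z : complex.Re z <= modulus z.
Proof. exact: le_trans (ler_norm _) (normr_Re_le z). Qed.

Lemma mulc_conj z : z * (conjc z) = (modulus z ^+ 2)%:C.
Proof.
case: z => a b; rewrite modulusE sqr_sqrtr ?addr_ge0 ?sqr_ge0//=.
by apply/eqP; rewrite eq_complex /=; apply/andP; split; apply/eqP; ring.
Qed.

Lemma modulus_sub_ge x y : modulus x - modulus y <= modulus (x - y).
Proof. by rewrite lerBlDr (le_trans _ (modulusD _ _))// subrK. Qed.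

Lemma modulus_trans z x y : modulus (x - y) <= modulus (x - z) + modulus (z - y).
Proof. by rewrite (le_trans _ (modulusD _ _))// addrA subrK. Qed.

Lemma modulus_sum (I : Type) (r : seq I) (P : pred I) (F : I -> R[i]) :
  modulus (\sum_(i <- r | P i) F i) <= \sum_(i <- r | P i) modulus (F i).
Proof.
elim/big_ind2: _ => //; first by rewrite modulus0.
by move=> x1 x2 y1 y2 h1 h2; rewrite (le_trans (modulusD _ _))// lerD.
Qed.

Lemma cReM x y : complex.Re (x * y) = complex.Re x * complex.Re y - complex.Im x *
  complex.Im y.
Proof. by case: x; case: y. Qed.

Lemma cImM x y : complex.Im (x * y) = complex.Re x * complex.Im y + complex.Im x *
  complex.Re y.
Proof. by case: x; case: y. Qed.

Lemma cReZ a z : complex.Re (a%:C * z) = a * complex.Re z.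
Proof. by rewrite cReM mul0r subr0. Qed.

Lemma cReD x y : complex.Re (x + y) = complex.Re x + complex.Re y.
Proof. by case: x; case: y. Qed.

Lemma cImD x y : complex.Im (x + y) = complex.Im x + complex.Im y.
Proof. by case: x; case: y. Qed.

Lemma cReN x : complex.Re (- x) = - complex.Re x.
Proof. by case: x. Qed.

Lemma cImN x : complex.Im (- x) = - complex.Im x.
Proof. by case: x. Qed.

Lemma cRe_conj x : complex.Re (conjc x) = complex.Re x.
Proof. by case: x. Qed.

Lemma cIm_conj x : complex.Im (conjc x) = - complex.Im x.
Proof. by case: x. Qed.

End Modulus.

(** * Complex functions of a real variable *)

Section Derivative.
Context {R : realType}.
Implicit Types (f g : R -> R[i]) (l m : R[i]) (s t a b : R).
Local Notation Re := (@complex.Re R).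
Local Notation Im := (@complex.Im R).

(** The derivative of a complex function of a real variable is taken componentwise:
    over [R], the complex numbers do not carry the structure of a normed module. *)
Definition cderiv_at f s l :=
  is_derive s 1 (Re \o f) (Re l) /\ is_derive s 1 (Im \o f) (Im l).

Definition cderiv f f' := forall s, cderiv_at f s (f' s).

Definition ccont f := continuous (Re \o f) /\ continuous (Im \o f).

Lemma is_derive_eqr (f : R -> R) s d e : is_derive s 1 f d -> d = e ->
  is_derive s 1 f e.
Proof. by move=> h <-. Qed.

Lemma rderivD (f g : R -> R) s d e : is_derive s 1 f d -> is_derive s 1 g e ->
  is_derive s 1 (fun x => f x + g x) (d + e).
Proof. exact: is_deriveD. Qed.

Lemma rderivB (f g : R -> R) s d e : is_derive s 1 f d -> is_derive s 1 g e ->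
  is_derive s 1 (fun x => f x - g x) (d - e).
Proof. exact: is_deriveB. Qed.

Lemma rderivM (f g : R -> R) s d e : is_derive s 1 f d -> is_derive s 1 g e ->
  is_derive s 1 (fun x => f x * g x) (d * g s + f s * e).
Proof.
move=> hf hg; have := is_deriveM hf hg.
by rewrite /GRing.scale /= addrC [g s * d]mulrC.
Qed.

Lemma cderiv_at_eq f s l m : cderiv_at f s l -> l = m -> cderiv_at f s m.
Proof. by move=> h <-. Qed.

Lemma eq_cderiv_at f g s l : f =1 g -> cderiv_at f s l -> cderiv_at g s l.
Proof. by move=> /funext ->. Qed.

Lemma cderiv_at_cst l s : cderiv_at (fun=> l) s 0.
Proof. by split; exact: is_derive_cst. Qed.

Lemma cderiv_atD f g s l m :
  cderiv_at f s l -> cderiv_at g s m -> cderiv_at (fun x => f x + g x) s (l + m).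
Proof.
move=> [f1 f2] [g1 g2]; split.
  rewrite (_ : _ \o _ = (Re \o f) + (Re \o g)) ?cReD; first exact: is_deriveD.
  by apply/funext => x /=; rewrite cReD.
rewrite (_ : _ \o _ = (Im \o f) + (Im \o g)) ?cImD; first exact: is_deriveD.
by apply/funext => x /=; rewrite cImD.
Qed.

Lemma cderiv_atM f g s l m :
  cderiv_at f s l -> cderiv_at g s m ->
  cderiv_at (fun x => f x * g x) s (l * g s + f s * m).
Proof.
move=> [f1 f2] [g1 g2]; split.
  rewrite (_ : _ \o _ = fun x => (Re \o f) x * (Re \o g) x - (Im \o f) x * (Im \o g)
    x); last first.
    by apply/funext => x /=; rewrite cReM.
  apply: (is_derive_eqr (rderivB (rderivM f1 g1) (rderivM f2 g2))).
  by rewrite cReD !cReM /=; ring.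
rewrite (_ : _ \o _ = fun x => (Re \o f) x * (Im \o g) x + (Im \o f) x * (Re \o g)
  x); last first.
  by apply/funext => x /=; rewrite cImM.
apply: (is_derive_eqr (rderivD (rderivM f1 g2) (rderivM f2 g1))).
by rewrite cImD !cImM /=; ring.
Qed.

Lemma cderiv_at_real (f : R -> R) s d :
  is_derive s 1 f d -> cderiv_at (fun x => (f x)%:C) s d%:C.
Proof. by move=> h; split => //=; exact: is_derive_cst. Qed.

Lemma cderiv_at_id s : cderiv_at (fun x => x%:C) s 1.
Proof. by apply: (@cderiv_at_real id s 1); exact: is_derive_id. Qed.

Lemma cderiv_atZ (c : R[i]) f s l :
  cderiv_at f s l -> cderiv_at (fun x => c * f x) s (c * l).
Proof.
move=> h; apply: cderiv_at_eq; first exact: cderiv_atM (cderiv_at_cst c s) h.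
by rewrite mul0r add0r.
Qed.

Lemma cderiv_atN f s l : cderiv_at f s l -> cderiv_at (fun x => - f x) s (- l).
Proof.
move=> h; apply: (eq_cderiv_at (f := fun x => -1 * f x)); first by move=> x;
  rewrite mulN1r.
by apply: (cderiv_at_eq (cderiv_atZ (-1) h)); rewrite mulN1r.
Qed.

Lemma cderiv_atB f g s l m :
  cderiv_at f s l -> cderiv_at g s m -> cderiv_at (fun x => f x - g x) s (l - m).
Proof. by move=> hf hg; apply: cderiv_atD => //; exact: cderiv_atN. Qed.

Lemma cderiv_at_conj f s l : cderiv_at f s l -> cderiv_at (fun x =>
  conjc (f x)) s (conjc l).
Proof.
move=> [f1 f2]; split.
  rewrite cRe_conj (_ : _ \o _ = Re \o f)//; by apply/funext => x /=; rewrite cRe_conj.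
rewrite cIm_conj (_ : _ \o _ = - (Im \o f)); first exact: is_deriveN.
by apply/funext => x /=; rewrite cIm_conj.
Qed.

(** From the real case, as the inverse of [f] is its conjugate divided by the real
    function [f * conjc f]. *)
Lemma cderiv_atV f s l : f s != 0 -> cderiv_at f s l ->
  cderiv_at (fun x => (f x)^-1) s (- l / f s ^+ 2).
Proof.
move=> fs0 h.
have hc := cderiv_at_conj h.
have [n1 _] := cderiv_atM h hc.
have nE x : Re (f x * conjc (f x)) = modulus (f x) ^+ 2 by rewrite mulc_conj.
have n0 : Re (f s * conjc (f s)) != 0 by rewrite nE expf_neq0// modulus_eq0.
have hV := cderiv_at_real (is_deriveV n0 n1).
apply: (eq_cderiv_at (f := fun x => conjc (f x) * ((Re (f x * conjc (f x)))^-1)%:C)).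
  move=> x /=; have [->|fx0] := eqVneq (f x) 0; first by rewrite conjc0 invr0 mul0r.
  rewrite nE rmorphV ?unitfE ?expf_neq0 ?modulus_eq0//= -mulc_conj.
  by rewrite invfM mulrCA mulfV ?mulr1// conjc_eq0.
apply: (cderiv_at_eq (cderiv_atM hc hV)).
have fc0 : conjc (f s) != 0 by rewrite conjc_eq0.
have E1 : ((Re (f s * conjc (f s)))^-1)%:C = (f s * conjc (f s))^-1.
  by rewrite nE rmorphV ?unitfE ?expf_neq0 ?modulus_eq0//= -mulc_conj.
have E2 : (Re (l * conjc (f s) + f s * (conjc l)))%:C = l * conjc (f s) + f s *
  (conjc l).
  apply/eqP; rewrite eq_complex /= eqxx /= cImD !cImM cRe_conj !cIm_conj cRe_conj.
  by apply/eqP; ring.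
rewrite [X in _ + _ * X](_ : _ = - ((f s * conjc (f s))^-1) ^+ 2 * (l * conjc (f s) +
  f s * (conjc l))); last first.
  by rewrite -E2 -E1 -rmorphXn /= -rmorphN /= -rmorphM /= /GRing.scale /= exprVn.
rewrite /= E1; field; exact/andP.
Qed.

Lemma cderiv_atXn f s l n : cderiv_at f s l ->
  cderiv_at (fun x => f x ^+ n) s (n%:R * f s ^+ n.-1 * l).
Proof.
move=> h; elim: n => [|n IH].
  by rewrite !mul0r; apply: (eq_cderiv_at (f := fun=> 1)) => //; exact: cderiv_at_cst.
apply: (eq_cderiv_at (f := fun x => f x * f x ^+ n)); first by move=> x; rewrite exprS.
apply: (cderiv_at_eq (cderiv_atM h IH)).
case: n {IH} => [|n] /=; first by rewrite expr0; ring.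
by rewrite exprS -[in RHS]natr1; ring.
Qed.

Lemma cderiv_at_cont f s l : cderiv_at f s l ->
  {for s, continuous (Re \o f)} /\ {for s, continuous (Im \o f)}.
Proof.
move=> [[h1 _] [h2 _]].
split; apply: differentiable_continuous; apply/derivable1_diffP; [exact: h1|exact: h2].
Qed.

Lemma cderiv_cont f f' : cderiv f f' -> ccont f.
Proof. by move=> h; split => s; have [] := cderiv_at_cont (h s). Qed.

(** Multiplying by the unit number that makes the increment real reduces the bound to
    the monotonicity of a real function.  The comparison function [b] does the work of
    the integral of a bound that is not constant. *)
Lemma mean_value f f' (b b' : R -> R) x y : x <= y ->
  (forall s, x <= s <= y -> cderiv_at f s (f' s)) ->
  (forall s, x <= s <= y -> is_derive s 1 b (b' s)) ->
  (forall s, x <= s <= y -> modulus (f' s) <= b' s) ->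
  modulus (f y - f x) <= b y - b x.
Proof.
move=> xy df db le.
pose d := f y - f x.
pose c := (conjc d) / (modulus d)%:C.
have c1 : modulus c <= 1.
  rewrite modulusM modulusV modulus_conj modulus_real ger0_norm ?modulus_ge0//.
  by have [->|d0] := eqVneq (modulus d) 0; rewrite ?mul0r// mulfV.
have cd : Re (c * d) = modulus d.
  rewrite /c mulrAC -[_ * d]mulrC mulc_conj.
  have [->|d0] := eqVneq d 0; first by rewrite modulus0 expr0n mul0r.
  have md0 : (modulus d)%:C != 0 :> R[i].
    by apply/eqP => /complexI/eqP; rewrite modulus_eq0; exact/negP.
  by rewrite expr2 (rmorphM (real_complex R)) mulfK.
pose g := fun s => Re (c * f s).
have dg s : x <= s <= y -> is_derive s 1 g (Re (c * f' s)).
  by move=> xsy; have [] := cderiv_atZ c (df s xsy).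
have dbg s : x <= s <= y -> is_derive s 1 (fun s => b s - g s) (b' s - Re (c * f' s)).
  by move=> xsy; apply: rderivB; [exact: db|exact: dg].
have [||s] := @MVT_segment R (fun s => b s - g s) (fun s =>
  b' s - Re (c * f' s)) x y xy.
- move=> s; rewrite in_itv/= => /andP[/ltW xs /ltW sy].
  by apply: dbg; rewrite xs.
- apply: derivable_within_continuous => s; rewrite in_itv/= => xsy.
  by have [] := dbg s xsy.
rewrite in_itv/= => xsy E.
have : 0 <= (b y - g y) - (b x - g x).
  rewrite E mulr_ge0 ?subr_ge0// (le_trans (cRe_le_modulus _))//.
  rewrite modulusM (le_trans _ (le s xsy))//.
  by rewrite -[leRHS]mul1r ler_wpM2r// modulus_ge0.
rewrite /= -cd mulrBr cReD cReN -/(g y) -/(g x) => h; lra.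
Qed.

Lemma mean_value_cst f f' B x y : x <= y ->
  (forall s, x <= s <= y -> cderiv_at f s (f' s)) ->
  (forall s, x <= s <= y -> modulus (f' s) <= B) ->
  modulus (f y - f x) <= B * (y - x).
Proof.
move=> xy df le; rewrite mulrBr.
apply: (@mean_value f f' (fun s => B * s) (fun=> B) x y) => // s _.
apply: (is_derive_eqr (is_deriveZ B (is_derive_id s 1))).
by rewrite /GRing.scale /= mulr1.
Qed.

End Derivative.

(** * Antiderivatives and integrals *)

Section Antiderivative.
Context {R : realType}.
Implicit Types (f F : R -> R[i]) (a b s : R).
Local Notation Re := (@complex.Re R).
Local Notation Im := (@complex.Im R).

Lemma Rintegral_FTC (f F : R -> R) a b : a < b -> continuous f ->
  (forall s, a <= s <= b -> is_derive s 1 F (f s)) ->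
  \int[lebesgue_measure]_(s in `[a, b]) f s = F b - F a.
Proof.
move=> ab cf dF; rewrite /Rintegral.
rewrite (@continuous_FTC2 R f F a b ab)//=.
- exact: continuous_subspaceT.
- have dF' s : s \in `[a, b]%R -> {for s, continuous F}.
    rewrite in_itv/= => /dF [h _].
    by apply: differentiable_continuous; apply/derivable1_diffP.
  split.
  + move=> s; rewrite in_itv/= => /andP[/ltW as_ /ltW sb].
    by have [] := dF s; rewrite ?as_ ?sb.
  + apply: cvg_at_right_filter; apply: dF'; by rewrite in_itv/= lexx ltW.
  + apply: cvg_at_left_filter; apply: dF'; by rewrite in_itv/= lexx ltW.
- move=> s; rewrite in_itv/= => /andP[/ltW as_ /ltW sb].
  by rewrite derive1E; have [] := dF s; rewrite ?as_ ?sb.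
Qed.

Lemma Cintegral_FTC f F a b : a < b -> ccont f ->
  (forall s, a <= s <= b -> cderiv_at F s (f s)) -> Cintegral a b f = F b - F a.
Proof.
move=> ab [cR cI] dF; rewrite /Cintegral.
have -> := @Rintegral_FTC (Re \o f) (Re \o F) a b ab cR (fun s h => (dF s h).1).
have -> := @Rintegral_FTC (Im \o f) (Im \o F) a b ab cI (fun s h => (dF s h).2).
by apply/eqP; rewrite eq_complex /= !cReD !cImD !cReN !cImN !eqxx.
Qed.

Lemma antiderivative_real (f : R -> R) a : continuous f ->
  exists F : R -> R, forall s, a < s -> is_derive s 1 F (f s).
Proof.
move=> cf; exists (fun x => \int[lebesgue_measure]_(t in `[a, x]) f t) => s as_.
have := @continuous_FTC1_closed R f a s (s + 1).
rewrite ltrDl ltr01 => /(_ isT) [].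
- apply: continuous_compact_integrable; first exact: segment_compact.
  exact: continuous_subspaceT.
- exact: as_.
- exact: cf.
- by move=> h1 h2; apply: DeriveDef; [exact: h1|rewrite -derive1E; exact: h2].
Qed.

(** The primitive is an integral from [a], hence the restriction to one side of [a].
    It turns the statements about integrals below into statements about derivatives. *)
Lemma antiderivative f a : ccont f ->
  exists F, forall s, a < s -> cderiv_at F s (f s).
Proof.
move=> [cR cI].
have [F1 dF1] := antiderivative_real a cR.
have [F2 dF2] := antiderivative_real a cI.
by exists (fun s => F1 s +i* F2 s) => s as_; split; [exact: dF1|exact: dF2].
Qed.

End Antiderivative.

Section Continuity.
Context {R : realType}.
Implicit Types (f g F : R -> R[i]) (a b s : R).
Local Notation Re := (@complex.Re R).
Local Notation Im := (@complex.Im R).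

Lemma ccont_cst (c : R[i]) : ccont (fun=> c).
Proof. by split => s; apply: cvg_cst. Qed.

Lemma ccontD f g : ccont f -> ccont g -> ccont (fun s => f s + g s).
Proof.
move=> [f1 f2] [g1 g2]; split.
  rewrite (_ : _ \o _ = (Re \o f) \+ (Re \o g)); last by apply/funext => s /=;
    rewrite cReD.
  by move=> s; exact: (cvgD (f1 s) (g1 s)).
rewrite (_ : _ \o _ = (Im \o f) \+ (Im \o g)); last by apply/funext => s /=;
  rewrite cImD.
by move=> s; exact: (cvgD (f2 s) (g2 s)).
Qed.

Lemma ccontM f g : ccont f -> ccont g -> ccont (fun s => f s * g s).
Proof.
move=> [f1 f2] [g1 g2]; split.
  rewrite (_ : _ \o _ = fun x => (Re \o f) x * (Re \o g) x - (Im \o f) x * (Im \o g)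
    x); last first.
    by apply/funext => x /=; rewrite cReM.
  by move=> s; exact: (cvgB (cvgM (f1 s) (g1 s)) (cvgM (f2 s) (g2 s))).
rewrite (_ : _ \o _ = fun x => (Re \o f) x * (Im \o g) x + (Im \o f) x * (Re \o g)
  x); last first.
  by apply/funext => x /=; rewrite cImM.
by move=> s; exact: (cvgD (cvgM (f1 s) (g2 s)) (cvgM (f2 s) (g1 s))).
Qed.

Lemma ccontN f : ccont f -> ccont (fun s => - f s).
Proof.
move=> h; rewrite (_ : (fun s => - f s) = fun s => -1 * f s).
  exact: ccontM (ccont_cst _) h.
by apply/funext => s; rewrite mulN1r.
Qed.

Lemma ccontB f g : ccont f -> ccont g -> ccont (fun s => f s - g s).
Proof. by move=> hf hg; apply: ccontD => //; exact: ccontN. Qed.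

Lemma ccontX f n : ccont f -> ccont (fun s => f s ^+ n).
Proof.
move=> h; elim: n => [|n IH]; first exact: ccont_cst.
rewrite (_ : (fun s => _) = fun s => f s * f s ^+ n); first exact: ccontM.
by apply/funext => s; rewrite exprS.
Qed.

Lemma continuous_modulus f : ccont f -> continuous (fun s => modulus (f s)).
Proof.
move=> [f1 f2] s; rewrite (_ : (fun s => _) =
  Num.sqrt \o (fun s => (Re \o f) s * (Re \o f) s + (Im \o f) s * (Im \o f) s));
    last first.
  by apply/funext => x /=; rewrite modulusE !expr2.
apply: continuous_comp; last exact: sqrt_continuous.
exact: (cvgD (cvgM (f1 s) (f1 s)) (cvgM (f2 s) (f2 s))).
Qed.

Lemma ccontV f : ccont f -> (forall s, f s != 0) -> ccont (fun s => (f s)^-1).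
Proof.
move=> h f0.
have cn : continuous (fun s => modulus (f s) ^+ 2).
  by move=> s; have c := @continuous_modulus _ h s; exact: (cvgM c c).
have n0 s : modulus (f s) ^+ 2 != 0 by rewrite expf_neq0// modulus_eq0.
have cV : continuous (fun s => (modulus (f s) ^+ 2)^-1).
  by move=> s; exact: (cvgV (n0 s) (cn s)).
have E s : (f s)^-1 = conjc (f s) * ((modulus (f s) ^+ 2)^-1)%:C.
  rewrite rmorphV ?unitfE//= -mulc_conj invfM mulrCA mulfV ?mulr1//.
  by rewrite conjc_eq0.
rewrite (_ : (fun s => _) = fun s => conjc (f s) * ((modulus (f s) ^+ 2)^-1)%:C);
  last exact/funext.
apply: ccontM; case: h => h1 h2.
  split; first by rewrite (_ : _ \o _ = Re \o f)//; apply/funext => s /=;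
    rewrite cRe_conj.
  rewrite (_ : _ \o _ = fun s => - (Im \o f) s); last by apply/funext => s /=;
    rewrite cIm_conj.
  by move=> s; exact: (cvgN (h2 s)).
by split => //= s; exact: cvg_cst.
Qed.

Lemma ccont_bounded f a b : a <= b -> ccont f ->
  exists M, forall s, a <= s <= b -> modulus (f s) <= M.
Proof.
move=> ab cf; have [|c _ h] := @EVT_max R (fun s => modulus (f s)) a b ab.
  by apply: continuous_subspaceT; exact: continuous_modulus.
by exists (modulus (f c)) => s sab; apply: h; rewrite in_itv.
Qed.

Lemma Cintegral_bound_cst f B a b : a < b -> ccont f ->
  (forall s, a <= s <= b -> modulus (f s) <= B) ->
  modulus (Cintegral a b f) <= B * (b - a).
Proof.
move=> ab cf le.
have [F dF] := antiderivative (a - 1) cf.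
have dF' s : a <= s <= b -> cderiv_at F s (f s).
  by move=> /andP[as_ _]; apply: dF; lra.
rewrite (Cintegral_FTC ab cf dF').
exact: (mean_value_cst (ltW ab) dF' le).
Qed.

Lemma CintegralD f g a b : a < b -> ccont f -> ccont g ->
  Cintegral a b (fun s => f s + g s) = Cintegral a b f + Cintegral a b g.
Proof.
move=> ab cf cg.
have [F dF] := antiderivative (a - 1) cf.
have [H dH] := antiderivative (a - 1) cg.
have dF' s : a <= s <= b -> cderiv_at F s (f s).
  by move=> /andP[as_ _]; apply: dF; lra.
have dH' s : a <= s <= b -> cderiv_at H s (g s).
  by move=> /andP[as_ _]; apply: dH; lra.
rewrite (Cintegral_FTC ab cf dF') (Cintegral_FTC ab cg dH').
rewrite (@Cintegral_FTC R _ (fun s => F s + H s) a b ab (ccontD cf cg)); last first.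
  by move=> s h; apply: cderiv_atD; [exact: dF'|exact: dH'].
by ring.
Qed.

Lemma CintegralZ (c : R[i]) f a b : a < b -> ccont f ->
  Cintegral a b (fun s => c * f s) = c * Cintegral a b f.
Proof.
move=> ab cf.
have [F dF] := antiderivative (a - 1) cf.
have dF' s : a <= s <= b -> cderiv_at F s (f s).
  by move=> /andP[as_ _]; apply: dF; lra.
rewrite (Cintegral_FTC ab cf dF').
rewrite (@Cintegral_FTC R _ (fun s => c * F s) a b ab (ccontM (ccont_cst c) cf));
  last first.
  by move=> s h; apply: cderiv_atZ; exact: dF'.
by ring.
Qed.

Lemma cderiv_at_shift f l s a : cderiv_at f (s + a) l ->
  cderiv_at (fun x => f (x + a)) s l.
Proof.
have h : is_derive s 1 (fun x : R => x + a) 1.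
  by apply: (is_derive_eqr (rderivD (is_derive_id s 1) (is_derive_cst a s 1)));
    rewrite addr0.
move=> [h1 h2]; split.
  by have := @is_derive1_comp R (Re \o f) (fun x => x + a) s _ _ h1 h; rewrite mulr1.
by have := @is_derive1_comp R (Im \o f) (fun x => x + a) s _ _ h2 h; rewrite mulr1.
Qed.

(** The increment of a primitive over a period has derivative zero. *)
Lemma Cintegral_period f L a : 0 < L -> (forall s, f (s + L) = f s) -> ccont f ->
  Cintegral 0 L f = Cintegral a (a + L) f.
Proof.
move=> L0 per cf.
have [F dF] := antiderivative (Num.min 0 a - 1) cf.
have dF' s : Num.min 0 a <= s -> cderiv_at F s (f s) by move=> h; apply: dF; lra.
have m0 : Num.min 0 a <= 0 by rewrite ge_min lexx.
have ma : Num.min 0 a <= a by rewrite ge_min lexx orbT.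
rewrite (@Cintegral_FTC R f F 0 L L0 cf); last by move=> s h; apply: dF'; lra.
rewrite (@Cintegral_FTC R f F a (a + L) _ cf); [|by lra|by move=> s h; apply: dF'; lra].
pose H s := F (s + L) - F s.
have dH s : Num.min 0 a <= s -> cderiv_at H s 0.
  move=> h; rewrite -(subrr (f s)); apply: cderiv_atB; last exact: dF'.
  by apply: cderiv_at_shift; rewrite -per; apply: dF'; lra.
suff E x y : Num.min 0 a <= x <= y -> H x = H y.
  have [a0|/ltW a0] := leP 0 a.
    by have := E 0 a; rewrite /H add0r a0 m0 => ->.
  by have := E a 0; rewrite /H add0r a0 ma => ->.
move=> /andP[mx xy]; apply/esym/eqP; rewrite -subr_eq0 -modulus_eq0.
have := @mean_value_cst R H (fun=> 0) 0 x y xy; rewrite mul0r => h.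
rewrite eq_le modulus_ge0 andbT; apply: h => s hs; last by rewrite modulus0.
by apply: dH; lra.
Qed.

End Continuity.

(** * First order expansions with a quadratic remainder *)

Section UniformDerivative.
Context {R : realType}.

(** A first order expansion at 0 with a quadratic remainder, uniform in a
    parameter.  Being quadratic, it is stable under products without any
    appeal to limits, and it passes under integrals. *)
Definition uniform_deriv (S : Type) (P : S -> Prop) (f : S -> R[i] -> R[i]) (l : S ->
  R[i]) :=
  exists C r : R, [/\ 0 <= C, 0 < r & forall s, P s -> [/\
    modulus (f s 0) <= C, modulus (l s) <= C &
    forall h, modulus h <= r ->
      modulus (f s h - f s 0 - h * l s) <= C * modulus h ^+ 2]].

Lemma uniform_deriv_cst S (P : S -> Prop) (c : S -> R[i]) C : 0 <= C ->
  (forall s, P s -> modulus (c s) <= C) -> uniform_deriv P (fun s _ => c s) (fun=> 0).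
Proof.
move=> C0 h; exists C, 1; split => // s Ps; split; first exact: h.
  by rewrite modulus0.
by move=> x _; rewrite subrr mulr0 subr0 modulus0 mulr_ge0// sqr_ge0.
Qed.

Lemma uniform_derivM S (P : S -> Prop) f g l m :
  uniform_deriv P f l -> uniform_deriv P g m ->
  uniform_deriv P (fun s h => f s h * g s h) (fun s => l s * g s 0 + f s 0 * m s).
Proof.
move=> [C [r [C0 r0 hf]]] [D [q [D0 q0 hg]]].
pose t := Num.min r (Num.min q 1).
have t0 : 0 < t by rewrite !lt_min r0 q0 ltr01.
exists (6 * C * D), t; split => //; first by rewrite !mulr_ge0.
move=> s Ps; have [f0 ls hf'] := hf s Ps; have [g0 ms hg'] := hg s Ps.
have CD : modulus (f s 0) * modulus (g s 0) <= C * D by rewrite ler_pM// modulus_ge0.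
have CD1 : modulus (l s) * modulus (g s 0) <= C * D by rewrite ler_pM// modulus_ge0.
have CD2 : modulus (f s 0) * modulus (m s) <= C * D by rewrite ler_pM// modulus_ge0.
have CD3 : modulus (l s) * modulus (m s) <= C * D by rewrite ler_pM// modulus_ge0.
have CDp : 0 <= C * D by rewrite mulr_ge0.
split.
- rewrite modulusM; lra.
- rewrite (le_trans (modulusD _ _))// !modulusM; lra.
move=> h; rewrite !le_min => /and3P[hr hq h1].
have {}hf' := hf' h hr; have {}hg' := hg' h hq.
set a := modulus h in hr hq h1 hf' hg' *.
have a0 : 0 <= a := modulus_ge0 _.
set ef := f s h - f s 0 - h * l s in hf'.
set eg := g s h - g s 0 - h * m s in hg'.
have -> : f s h * g s h - f s 0 * g s 0 - h * (l s * g s 0 + f s 0 * m s) =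
  ef * (g s 0 + h * m s + eg) + f s 0 * eg + h * (l s * (h * m s + eg)).
  by rewrite /ef /eg; ring.
have h2 : a ^+ 2 <= a by rewrite expr2 ler_piMr.
have egD : modulus eg <= D * a by rewrite (le_trans hg')// ler_wpM2l.
have egD1 : modulus eg <= D by rewrite (le_trans egD)// ler_piMr.
have A1 : modulus (g s 0 + h * m s + eg) <= 3 * D.
  rewrite (le_trans (modulusD _ _))// (le_trans (lerD (modulusD _ _) (lexx _)))//
    modulusM.
  have : a * modulus (m s) <= D by rewrite (le_trans _ ms)// ler_piMl// modulus_ge0.
  by rewrite -/a; lra.
have A2 : modulus (h * m s + eg) <= 2 * D * a.
  rewrite (le_trans (modulusD _ _))// modulusM -/a.
  have : a * modulus (m s) <= D * a by rewrite mulrC ler_wpM2r.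
  by lra.
rewrite (le_trans (modulusD _ _))// (le_trans (lerD (modulusD _ _) (lexx _)))//
  !modulusM -/a.
have B1 : modulus ef * modulus (g s 0 + h * m s + eg) <= (C * a ^+ 2) * (3 * D).
  by rewrite ler_pM// modulus_ge0.
have B2 : modulus (f s 0) * modulus eg <= C * (D * a ^+ 2) by rewrite ler_pM//
  modulus_ge0.
have B3 : a * (modulus (l s) * modulus (h * m s + eg)) <= a * (C * (2 * D * a)).
  by rewrite ler_wpM2l// ler_pM// modulus_ge0.
by rewrite (le_trans (lerD (lerD B1 B2) B3))// expr2; nra.
Qed.
End UniformDerivative.

Section UniformDerivative.
Context {R : realType}.

Lemma uniform_derivX S (P : S -> Prop) f (l : S -> R[i]) n :
  uniform_deriv P f l ->
  uniform_deriv P (fun s h => f s h ^+ n) (fun s => n%:R * f s 0 ^+ n.-1 * l s).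
Proof.
move=> hf; elim: n => [|n IH].
  have -> : (fun s => 0%:R * f s 0 ^+ 0.-1 * l s) = fun=> 0.
    by apply/funext => s; rewrite !mul0r.
  rewrite (_ : (fun s h => f s h ^+ 0) = fun s h => (fun=> 1) s); last first.
    by apply/funext => s; apply/funext => h; rewrite expr0.
  by apply: (uniform_deriv_cst (C := 1)) => // s _; rewrite modulus1.
have -> : (fun s h => f s h ^+ n.+1) = fun s h => f s h * f s h ^+ n.
  by apply/funext => s; apply/funext => h; rewrite exprS.
have -> : (fun s => n.+1%:R * f s 0 ^+ n.+1.-1 * l s) =
    fun s => l s * f s 0 ^+ n + f s 0 * (n%:R * f s 0 ^+ n.-1 * l s).
  apply/funext => s; case: n {IH} => [|n]; first by rewrite /= !expr0; ring.
  by rewrite /= -[in LHS]natr1 exprS; ring.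
exact: (uniform_derivM hf IH).
Qed.

Lemma uniform_derivV S (P : S -> Prop) (a b : S -> R[i]) d : 0 < d ->
  (forall s, P s -> d <= modulus (a s) /\ modulus (b s) <= 1) ->
  uniform_deriv P (fun s h => (a s - h * b s)^-1) (fun s => b s / a s ^+ 2).
Proof.
move=> d0 hd.
pose C := d^-1 + d^-1 ^+ 2 + 2 * d^-1 ^+ 3.
have dV : 0 < d^-1 by rewrite invr_gt0.
have dX2 : 0 < d^-1 ^+ 2 by rewrite exprn_gt0.
have dX3 : 0 < d^-1 ^+ 3 by rewrite exprn_gt0.
exists C, (d / 2); split; rewrite /C; [lra|lra|].
move=> s /hd [da b1].
have a0 : a s != 0 by rewrite -modulus_gt0 (lt_le_trans d0).
have aV : modulus (a s)^-1 <= d^-1.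
  by rewrite modulusV lef_pV2// posrE modulus_gt0.
split.
- rewrite mul0r subr0; lra.
- have : modulus (b s / a s ^+ 2) <= d^-1 ^+ 2.
    rewrite modulusM -exprVn modulusX -[leRHS]mul1r ler_pM// ?exprn_ge0 ?modulus_ge0//.
    by rewrite lerXn2r// nnegrE ?modulus_ge0// ltW.
  lra.
move=> h hd2; rewrite mul0r subr0.
have hb : modulus (h * b s) <= modulus h by rewrite modulusM ler_piMr// modulus_ge0.
have ahb : d / 2 <= modulus (a s - h * b s).
  by have := modulus_sub_ge (a s) (h * b s); lra.
have ah0 : a s - h * b s != 0 by rewrite -modulus_gt0 (lt_le_trans _ ahb)// divr_gt0.
have -> : (a s - h * b s)^-1 - (a s)^-1 - h * (b s / a s ^+ 2) =
    (h * b s) ^+ 2 * (a s)^-1 ^+ 2 * (a s - h * b s)^-1.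
  by field; rewrite ah0 a0.
rewrite modulusM (modulusM (_ ^+ 2) (_ ^+ 2)) !modulusX.
have h1 : modulus (a s - h * b s)^-1 <= 2 * d^-1.
  rewrite modulusV (_ : 2 * d^-1 = (d / 2)^-1); last by rewrite invf_div.
  by rewrite lef_pV2// posrE ?divr_gt0// modulus_gt0.
have h2 : modulus (h * b s) ^+ 2 <= modulus h ^+ 2 by rewrite lerXn2r// nnegrE
  modulus_ge0.
have h3 : modulus (a s)^-1 ^+ 2 <= d^-1 ^+ 2.
  by rewrite lerXn2r// nnegrE ?modulus_ge0// ltW.
have h4 : modulus (h * b s) ^+ 2 * modulus (a s)^-1 ^+ 2 * modulus (a s - h * b s)^-1 <=
    modulus h ^+ 2 * d^-1 ^+ 2 * (2 * d^-1).
  by rewrite !ler_pM// ?mulr_ge0// ?exprn_ge0// ?modulus_ge0.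
rewrite (le_trans h4)// (_ : _ * _ * _ = 2 * d^-1 ^+ 3 * modulus h ^+ 2); last by ring.
by rewrite ler_wpM2r ?sqr_ge0//; lra.
Qed.

(** Every complex differentiable function below has a quadratic remainder: it is built
    from rational functions by integration. *)
Definition cdiff (F : R[i] -> R[i]) (z l : R[i]) :=
  uniform_deriv (fun _ : unit => True) (fun _ h => F (z + h)) (fun=> l).

Lemma cdiff_eq F z l m : cdiff F z l -> l = m -> cdiff F z m.
Proof. by move=> h <-. Qed.

Lemma cdiffM F G z l m : cdiff F z l -> cdiff G z m ->
  cdiff (fun x => F x * G x) z (l * G z + F z * m).
Proof. by move=> hF hG; have := uniform_derivM hF hG; rewrite addr0. Qed.

Lemma cdiffX F z l n : cdiff F z l ->
  cdiff (fun x => F x ^+ n) z (n%:R * F z ^+ n.-1 * l).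
Proof. by move=> hF; have := uniform_derivX n hF; rewrite addr0. Qed.

Lemma cdiff_cstB (a z : R[i]) : cdiff (fun x => a - x) z (-1).
Proof.
exists (modulus (a - z) + 1), 1; split => //.
  by rewrite addr_ge0// modulus_ge0.
move=> _ _; have a0 := modulus_ge0 (a - z); split.
- by rewrite addr0; lra.
- by rewrite modulusN modulus1; lra.
move=> h _; rewrite (_ : _ - _ = 0); last by ring.
by rewrite modulus0 mulr_ge0// ?sqr_ge0// addr_ge0.
Qed.

Lemma is_derive_quadratic (f : R -> R) s d C r : 0 < r ->
  (forall h, `|h| <= r -> `|f (s + h) - f s - h * d| <= C * h ^+ 2) ->
  is_derive s 1 f d.
Proof.
move=> r0 hf.
have cv : (fun h : R => h^-1 *: ((f \o shift s) (h *: (1 : R)) - f s)) @ 0^' --> d.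
  apply/cvgrPdist_le => e e0; near=> h.
  have h0 : h != 0 by near: h; exact: nbhs_dnbhs_neq.
  have hr : `|h| <= r.
    by near: h; exact: dnbhs0_le.
  have hC : `|h| <= e / (`|C| + 1).
    by near: h; apply: dnbhs0_le; rewrite divr_gt0// ltr_wpDl.
  have C1 : 0 < `|C| + 1 by rewrite ltr_wpDl.
  rewrite /= /GRing.scale /= mulr1 [h + s]addrC.
  have -> : d - h^-1 * (f (s + h) - f s) = - (h^-1 * (f (s + h) - f s - h * d)).
    by field.
  rewrite normrN normrM normfV ler_pdivrMl ?normr_gt0//.
  rewrite (le_trans (hf h hr))//.
  have -> : C * h ^+ 2 = `|h| * (C * `|h|).
    by rewrite -[in LHS]real_normK ?num_real//; ring.
  rewrite ler_wpM2l// (le_trans (ler_wpM2r (normr_ge0 _) (ler_norm C)))//.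
  rewrite (le_trans _ (_ : (`|C| + 1) * (e / (`|C| + 1)) <= e))//; last first.
    by rewrite mulrCA mulfV ?mulr1// gt_eqF.
  by rewrite ler_pM// lerDl.
split; first by apply/cvg_ex; exists d.
exact: cvg_lim cv.
Unshelve. all: by end_near. Qed.

Lemma cdiff_line F (z v l : R[i]) (u : R) : cdiff F (z + u%:C * v) l ->
  cderiv_at (fun x : R => F (z + x%:C * v)) u (l * v).
Proof.
move=> [C [r [C0 r0 /(_ tt I) [_ _ hF]]]].
pose q := r / (modulus v + 1).
have v1 : 0 < modulus v + 1 by rewrite ltr_wpDl// modulus_ge0.
have q0 : 0 < q by rewrite divr_gt0.
have key (h : R) : `|h| <= q ->
  modulus (F (z + (u + h)%:C * v) - F (z + u%:C * v) - h%:C * (l * v)) <=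
  (C * modulus v ^+ 2) * h ^+ 2.
  move=> hq.
  have := hF (h%:C * v); rewrite modulusM modulus_real addr0.
  rewrite (_ : z + u%:C * v + h%:C * v = z + (u + h)%:C * v);
    last by rewrite rmorphD /=; ring.
  rewrite (_ : h%:C * v * l = h%:C * (l * v)); last by ring.
  rewrite exprMn real_normK ?num_real// (_ : C * (h ^+ 2 * _) = C * modulus v ^+ 2 *
    h ^+ 2); last by ring.
  apply; rewrite (le_trans (ler_wpM2r (modulus_ge0 _) hq))//.
  by rewrite /q mulrAC ler_pdivrMr// ler_wpM2l ?(ltW r0)// lerDl.
split; apply: (is_derive_quadratic (C := C * modulus v ^+ 2) q0) => h hq.
  rewrite (le_trans _ (key h hq))// (le_trans _ (normr_Re_le _))//=.
  by rewrite !cReD !cReN (cReM h%:C) /= mul0r subr0.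
rewrite (le_trans _ (key h hq))// (le_trans _ (normr_Im_le _))//=.
by rewrite !cImD !cImN (cImM h%:C) /= mul0r addr0.
Qed.

(** The real variable runs along the line through [z] in the direction [v], so that a
    bound on the derivative that depends on the position can be used. *)
Lemma mean_value_line F F' (p p' : R -> R) (z v : R[i]) T : 0 <= T ->
  (forall u, 0 <= u <= T -> cdiff F (z + u%:C * v) (F' (z + u%:C * v))) ->
  (forall u, 0 <= u <= T -> is_derive u 1 p (p' u)) ->
  (forall u, 0 <= u <= T -> modulus (F' (z + u%:C * v)) * modulus v <= p' u) ->
  modulus (F (z + T%:C * v) - F z) <= p T - p 0.
Proof.
move=> T0 dF dp le.
have := @mean_value R (fun u => F (z + u%:C * v)) (fun u =>
  F' (z + u%:C * v) * v) p p' 0 T T0.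
rewrite mul0r addr0; apply => // u hu.
  by apply: cdiff_line; exact: dF.
by rewrite modulusM; exact: le.
Qed.

Lemma mean_value_segment F F' B (z w : R[i]) :
  (forall u, 0 <= u <= 1 -> cdiff F (z + u%:C * (w - z)) (F' (z + u%:C * (w - z)))) ->
  (forall u, 0 <= u <= 1 -> modulus (F' (z + u%:C * (w - z))) <= B) ->
  modulus (F w - F z) <= B * modulus (w - z).
Proof.
move=> dF le.
have := @mean_value_line F F' (fun u => B * modulus (w - z) * u) (fun=> B * modulus
  (w - z)) z (w - z) 1 ler01 dF.
rewrite mul1r (addrC z) subrK mulr1 mulr0 subr0; apply => u hu.
  by apply: (is_derive_eqr (is_deriveZ _ (is_derive_id u 1)));
    rewrite /GRing.scale /= mulr1.
by rewrite ler_wpM2r ?modulus_ge0//; exact: le.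
Qed.

End UniformDerivative.

Section Smoothness.
Context {R : realType}.
Implicit Types (f : R -> R[i]).

Lemma derivable_is_derive (f : R -> R) s : derivable f s 1 -> is_derive s 1 f (f^`() s).
Proof. by move=> h; apply: DeriveDef; [exact: h|rewrite derive1E]. Qed.

Lemma cderive1n0 f : cderive1n 0 f = f.
Proof. by apply/funext => s; rewrite /cderive1n /=; case: (f s). Qed.

Lemma Cm_cderiv m f j : Cm m f -> (j < m)%N ->
  cderiv (cderive1n j f) (cderive1n j.+1 f).
Proof.
move=> [[h1 _] [h2 _]] jm s.
by split; apply: derivable_is_derive; [exact: h1|exact: h2].
Qed.

Lemma Cm_ccont m f j : Cm m f -> (j <= m)%N -> ccont (cderive1n j f).
Proof.
rewrite leq_eqVlt => h /predU1P[->|jm]; first by case: h => -[_ h1] [_ h2].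
exact: cderiv_cont (Cm_cderiv h jm).
Qed.

Lemma cderiv_cderive1n f f' : cderiv f f' -> cderive1n 1 f = f'.
Proof.
move=> h; apply/funext => s; have [h1 h2] := h s.
rewrite /cderive1n /derive1n /= !derive1E.
have -> : 'D_1 (complex.Re (R:=R) \o f) s = complex.Re (f' s) by case: h1.
have -> : 'D_1 (complex.Im (R:=R) \o f) s = complex.Im (f' s) by case: h2.
by case: (f' s).
Qed.

Lemma period_reduction (L s : R) : 0 < L -> exists k : int, 0 <= s - k%:~R * L < L.
Proof.
move=> L0; exists (Num.floor (s / L)).
have := floor_itv (s / L); rewrite intrD => /andP[h1 h2].
rewrite subr_ge0 -ler_pdivlMr// h1/= ltrBlDr.
by rewrite -[X in X + _]mul1r -mulrDl addrC -ltr_pdivrMr.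
Qed.

Lemma periodic_int (T : Type) (f : R -> T) (L : R) : (forall s, f (s + L) = f s) ->
  forall (k : int) s, f (s + k%:~R * L) = f s.
Proof.
move=> per; have pn n s : f (s + n%:R * L) = f s.
  elim: n s => [|n IH] s; first by rewrite mul0r addr0.
  by rewrite -natr1 mulrDl mul1r addrA per IH.
case=> n s; first exact: pn.
rewrite NegzE mulrNz mulNr -[in RHS](subrK (n.+1%:R * L) s).
by rewrite pn.
Qed.

End Smoothness.

(** * Contour integrals and Cauchy kernels *)

Section Curves.
Context {R : realType} (m : nat) (U : set (Cplx R)) (G : curves R).
Hypothesis m2 : (2 <= m)%N.
Hypothesis HG : positive_Cm_boundary m U G.
Implicit Types (f g : R[i] -> R[i]) (i : 'I_(ncomp G)).

Definition on_curve (t : R[i]) := exists i s, t = path_of (c := G) i s.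

Definition curve_cont f := forall i, ccont (fun s => f (path_of (c := G) i s)).

Definition total_length : R := \sum_i length_of (c := G) i.

Definition tangent i : R -> R[i] := cderive1n 1 (path_of i).

Lemma tangentP i : cderiv (path_of i) (tangent i).
Proof.
by have := Cm_cderiv (path_Cm HG i) (ltnW m2); rewrite cderive1n0.
Qed.

Lemma path_cont i : ccont (path_of i).
Proof. exact: cderiv_cont (tangentP i). Qed.

Lemma tangent_cont i : ccont (tangent i).
Proof. exact: Cm_ccont (path_Cm HG i) (ltnW m2). Qed.

Lemma tangent1 i s : modulus (tangent i s) = 1.
Proof. exact: (path_unit_speed HG). Qed.

Lemma length_ge0 i : 0 <= length_of i.
Proof. exact: ltW (length_gt0 HG i). Qed.

Lemma total_length_ge0 : 0 <= total_length.
Proof. by apply: sumr_ge0 => i _; exact: length_ge0. Qed.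

Lemma path_reduce i s : exists2 s0, 0 <= s0 < length_of i & path_of i s = path_of i s0.
Proof.
have [k hk] := period_reduction s (length_gt0 HG i).
exists (s - k%:~R * length_of i) => //.
rewrite -[s in LHS](subrK (k%:~R * length_of i)).
exact: (periodic_int (path_periodic HG i)).
Qed.

Lemma tangent_periodic i s : tangent i (s + length_of i) = tangent i s.
Proof.
have h : cderiv (path_of i) (fun s => tangent i (s + length_of i)).
  move=> x; apply: (eq_cderiv_at (f := fun x => path_of i (x + length_of i))).
    by move=> y; exact: (path_periodic HG).
  exact: cderiv_at_shift (tangentP i _).
have := cderiv_cderive1n h; rewrite /tangent.
by move=> /(congr1 (fun F : R -> R[i] => F s)) /= <-.
Qed.

Lemma curve_cont_bounded f : curve_cont f -> exists2 M, 0 <= M & forall t,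
  on_curve t -> modulus (f t) <= M.
Proof.
move=> cf.
have H i : exists M, forall s, 0 <= s <= length_of i -> modulus (f (path_of i s)) <= M.
  exact: ccont_bounded (length_ge0 i) (cf i).
have [M hM] := choice H.
exists (\sum_i `|M i|); first exact: sumr_ge0.
move=> _ [i [s ->]]; have [s0 /andP[s00 s0L] ->] := path_reduce i s.
have h : modulus (f (path_of i s0)) <= M i by apply: hM; rewrite s00 ltW.
by rewrite (le_trans h)// (le_trans (ler_norm _))// (bigD1 i)//= lerDl sumr_ge0.
Qed.

Lemma curve_cont_cst (c : R[i]) : curve_cont (fun=> c).
Proof. by move=> i; exact: ccont_cst. Qed.

Lemma curve_cont_id : curve_cont id.
Proof. by move=> i; exact: path_cont. Qed.

Lemma curve_contM f g : curve_cont f -> curve_cont g -> curve_cont (fun t => f t * g t).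
Proof. by move=> hf hg i; apply: ccontM; [exact: hf|exact: hg]. Qed.

Lemma curve_contD f g : curve_cont f -> curve_cont g -> curve_cont (fun t => f t + g t).
Proof. by move=> hf hg i; apply: ccontD; [exact: hf|exact: hg]. Qed.

Lemma curve_contB f g : curve_cont f -> curve_cont g -> curve_cont (fun t => f t - g t).
Proof. by move=> hf hg i; apply: ccontB; [exact: hf|exact: hg]. Qed.

Lemma curve_contX f n : curve_cont f -> curve_cont (fun t => f t ^+ n).
Proof. by move=> hf i; apply: ccontX; exact: hf. Qed.

Lemma curve_contV f : curve_cont f -> (forall t, on_curve t -> f t != 0) ->
  curve_cont (fun t => (f t)^-1).
Proof.
move=> hf f0 i; apply: ccontV; first exact: hf.
by move=> s; apply: f0; exists i, s.
Qed.

Lemma integrand_cont f i : curve_cont f ->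
  ccont (fun s => f (path_of i s) * cderive1n 1 (path_of i) s).
Proof. by move=> hf; apply: ccontM; [exact: hf|exact: tangent_cont]. Qed.

Lemma contourD f g : curve_cont f -> curve_cont g ->
  contour_integral G (fun t => f t + g t) = contour_integral G f + contour_integral G g.
Proof.
move=> hf hg; rewrite /contour_integral -big_split; apply: eq_bigr => i _ /=.
rewrite -CintegralD; [|exact: (length_gt0 HG)|exact: integrand_cont..].
by congr (Cintegral _ _ _); apply/funext => s; rewrite mulrDl.
Qed.

Lemma contourZ c f : curve_cont f ->
  contour_integral G (fun t => c * f t) = c * contour_integral G f.
Proof.
move=> hf; rewrite /contour_integral big_distrr; apply: eq_bigr => i _ /=.
rewrite -CintegralZ; [|exact: (length_gt0 HG)|exact: integrand_cont..].
by congr (Cintegral _ _ _); apply/funext => s; rewrite mulrA.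
Qed.

Lemma contourB f g : curve_cont f -> curve_cont g ->
  contour_integral G (fun t => f t - g t) = contour_integral G f - contour_integral G g.
Proof.
move=> hf hg; rewrite -mulN1r -contourZ// -contourD//.
  by congr (contour_integral _ _); apply/funext => t; rewrite mulN1r.
exact: curve_contM (curve_cont_cst _) hg.
Qed.

Lemma eq_contour f g : (forall t, on_curve t -> f t = g t) ->
  contour_integral G f = contour_integral G g.
Proof.
move=> fg; apply: eq_bigr => i _; congr (Cintegral _ _ _); apply/funext => s.
by rewrite fg//; exists i, s.
Qed.

Lemma contour_bound f B : curve_cont f -> (forall t, on_curve t ->
  modulus (f t) <= B) ->
  modulus (contour_integral G f) <= B * total_length.
Proof.
move=> hf hB; rewrite /contour_integral (le_trans (modulus_sum _ _ _))//.
rewrite /total_length mulr_sumr; apply: ler_sum => i _.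
rewrite -[X in B * X]subr0; apply: Cintegral_bound_cst.
- exact: (length_gt0 HG).
- exact: integrand_cont.
by move=> s _; rewrite modulusM tangent1 mulr1; apply: hB; exists i, s.
Qed.

(** The remainder is quadratic uniformly along the curve, so the bound on contour
    integrals applies to it. *)
Lemma uniform_deriv_contour S (P : S -> Prop) (k : S -> R[i] -> R[i] ->
  R[i]) (l : S -> R[i] -> R[i]) q :
  0 < q ->
  (forall s h, P s -> modulus h <= q -> curve_cont (k s ^~ h)) ->
  (forall s, P s -> curve_cont (l s)) ->
  uniform_deriv (fun st => P st.1 /\ on_curve st.2) (fun st =>
    k st.1 st.2) (fun st => l st.1 st.2) ->
  uniform_deriv P (fun s h => contour_integral G (k s ^~ h)) (fun s =>
    contour_integral G (l s)).
Proof.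
move=> q0 ck cl [C [r [C0 r0 hC]]].
have L0 := total_length_ge0.
exists (C * total_length), (Num.min q r); split; first exact: mulr_ge0.
  by rewrite lt_min q0.
move=> s Ps.
have hC' t : on_curve t -> _ := fun ot => hC (s, t) (conj Ps ot).
have m0 : modulus (0 : R[i]) <= q by rewrite modulus0 ltW.
split.
- by apply: contour_bound; [exact: ck|move=> t /hC'[]].
- by apply: contour_bound; [exact: cl|move=> t /hC'[]].
move=> h; rewrite le_min => /andP[hq hr].
rewrite -contourZ; last exact: cl.
have c1 := ck s h Ps hq; have c2 := ck s 0 Ps m0.
have c3 : curve_cont (fun t => h * l s t) := curve_contM (curve_cont_cst h) (cl s Ps).
rewrite -contourB// -contourB//; last exact: curve_contB.
rewrite mulrAC; apply: contour_bound; first by do 2 apply: curve_contB => //.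
by move=> t /hC'[_ _]; exact.
Qed.

(** Distances to the curve are only used through their lower bounds [d].  A bound by
    [B * d `^ a] with [a <= 0] for all such [d] amounts to the same bound for the
    distance itself. *)
Definition off_curve (d : R) (w : R[i]) := forall t, on_curve t -> d <= modulus (t - w).

Lemma off_curve_neq0 d w t : 0 < d -> off_curve d w -> on_curve t -> t - w != 0.
Proof. by move=> d0 h ot; rewrite -modulus_gt0 (lt_le_trans d0)// h. Qed.

Lemma curve_cont_pole d w n : 0 < d -> off_curve d w -> curve_cont (fun t =>
  (t - w) ^- n).
Proof.
move=> d0 hw; apply: curve_contV.
  by apply: curve_contX; apply: curve_contB; [exact: curve_cont_id|exact:
    curve_cont_cst].
by move=> t ot; rewrite expf_neq0// (off_curve_neq0 d0 hw).
Qed.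

Definition cauchy_pole psi n (w : R[i]) := contour_integral G (fun t =>
  psi t / (t - w) ^+ n).

Lemma cauchy_pole_cont psi n d w : curve_cont psi -> 0 < d -> off_curve d w ->
  curve_cont (fun t => psi t / (t - w) ^+ n).
Proof. by move=> hp d0 hw; apply: curve_contM => //; exact: curve_cont_pole d0 hw. Qed.

Lemma cauchy_pole_cdiff psi n d w : curve_cont psi -> 0 < d -> off_curve d w ->
  cdiff (cauchy_pole psi n) w (n%:R * cauchy_pole psi n.+1 w).
Proof.
move=> hp d0 hw.
have [M M0 hM] := curve_cont_bounded hp.
have hw2 h : modulus h <= d / 2 -> off_curve (d / 2) (w + h).
  move=> hd t /hw; have := modulus_sub_ge (t - w) h.
  by rewrite opprD addrA; lra.
pose l t := n%:R * (psi t / (t - w) ^+ n.+1).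
have cl : curve_cont l.
  by apply: curve_contM; [exact: curve_cont_cst|exact: cauchy_pole_cont d0 hw].
rewrite /cauchy_pole -contourZ; last exact: cauchy_pole_cont d0 hw.
apply: (@uniform_deriv_contour unit (fun=> True) (fun _ t h =>
  psi t / (t - (w + h)) ^+ n) (fun=> l) (d / 2)).
- by rewrite divr_gt0.
- move=> _ h _ hd; apply: (@cauchy_pole_cont psi n (d / 2)) => //;
  first by rewrite divr_gt0.
  exact: hw2.
- by [].
have H1 : uniform_deriv (fun st : unit * R[i] => True /\ on_curve st.2)
    (fun st h => (st.2 - w - h * 1)^-1) (fun st => 1 / (st.2 - w) ^+ 2).
  apply: (uniform_derivV (a := fun st => st.2 - w) (b := fun=> 1) d0) =>
    -[? t] [_ /= ot].
  by split; [exact: (hw t ot)|rewrite modulus1].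
have H2 := uniform_derivX n H1.
have H3 : uniform_deriv (fun st : unit * R[i] => True /\ on_curve st.2)
    (fun st h => psi st.2) (fun st => 0).
  by apply: (uniform_deriv_cst (C := M)) => // -[? t] [_ /= ot]; exact: hM.
have := uniform_derivM H3 H2.
move=> [C [r [C0 r0 hC]]]; exists C, r; split => // -[[] t] [_ /= ot].
have [hC1 hC2 hC3] := hC (tt, t) (conj I ot).
have E h : psi t / (t - (w + h)) ^+ n = psi t * (t - w - h * 1)^-1 ^+ n.
  by rewrite exprVn mulr1 opprD addrA.
have lE : l t = 0 * (t - w - 0 * 1)^-1 ^+ n + psi t *
    (n%:R * (t - w - 0 * 1)^-1 ^+ n.-1 * (1 / (t - w) ^+ 2)).
  rewrite /l !mul0r subr0 add0r mul1r.
  case: (n) => [|k]; first by rewrite !mul0r mulr0.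
  by rewrite /= -!exprVn !exprS; ring.
split; [by rewrite E|by rewrite lE|].
by move=> h hr; rewrite !E lE; exact: hC3.
Qed.

End Curves.

(** * Chords and arcs of the boundary *)

Section Compactness.
Context {R : realType}.

Lemma lipschitz_continuous_real (f : R -> R) K :
  (forall x y, `|f x - f y| <= K * `|x - y|) -> continuous f.
Proof.
move=> hf x; apply/cvgrPdist_le => e e0; near=> y.
have K1 : 0 < `|K| + 1 by rewrite ltr_wpDl.
have xy : `|x - y| <= e / (`|K| + 1).
  by near: y; apply: cvgr_dist_le => //; rewrite divr_gt0.
rewrite (le_trans (hf x y))// (le_trans (ler_wpM2r (normr_ge0 _) (ler_norm K)))//.
rewrite (le_trans _ (_ : (`|K| + 1) * (e / (`|K| + 1)) <= e))//; last first.
  by rewrite mulrCA mulfV ?mulr1// gt_eqF.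
by rewrite ler_pM// lerDl.
Unshelve. all: by end_near. Qed.

(** Compactness of the rectangle, one variable at a time: the minimum in [y] is a
    Lipschitz function of [x]. *)
Lemma rectangle_min (g : R -> R -> R) a b c d : 
  (forall x y x' y', `|g x y - g x' y'| <= `|x - x'| + `|y - y'|) ->
  (forall x y, a <= x <= b -> c <= y <= d -> 0 < g x y) ->
  exists2 e, 0 < e & forall x y, a <= x <= b -> c <= y <= d -> e <= g x y.
Proof.
move=> lip pos.
have [ab|ba] := leP a b; last first.
  by exists 1 => // x y /andP[ax xb]; move: (le_trans ax xb); rewrite leNgt ba.
have [cd|dc] := leP c d; last first.
  by exists 1 => // x y _ /andP[cy yd]; move: (le_trans cy yd); rewrite leNgt dc.
have H x : exists y, c <= y <= d /\ forall y', c <= y' <= d -> g x y <= g x y'.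
  have [|y hy hmin] := @EVT_min R (g x) c d cd.
    apply: continuous_subspaceT; apply: (@lipschitz_continuous_real _ 1) => y y'.
    by rewrite mul1r (le_trans (lip x y x y'))// subrr normr0 add0r.
  move: hy; rewrite in_itv/= => hy; by exists y.
have [y hy] := choice H.
have [|x hx hmin] := @EVT_min R (fun x => g x (y x)) a b ab.
  apply: continuous_subspaceT; apply: (@lipschitz_continuous_real _ 1) => x x'.
  have [h1 h2] := hy x; have [h3 h4] := hy x'.
  have := h2 _ h3; have := h4 _ h1.
  have := lip x (y x') x' (y x'); have := lip x (y x) x' (y x).
  rewrite !subrr !normr0 !addr0 !ler_norml mul1r.
  by move=> /andP[A1 A2] /andP[B1 B2] C1 C2; apply/andP; split; lra.
move: hx; rewrite in_itv/= => hx; exists (g x (y x)); first exact: pos (hy x).1.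
move=> x' y' hx' hy'; rewrite (le_trans (hmin x' _)) ?in_itv//.
exact: (hy x').2.
Qed.

Lemma finite_pos_min (I : finType) (e : I -> R) : (forall i, 0 < e i) ->
  exists2 e0, 0 < e0 & forall i, e0 <= e i.
Proof.
move=> e0; pose S := 1 + \sum_i (e i)^-1.
have S0 : 0 < S by rewrite ltr_pwDl// sumr_ge0// => i _; rewrite invr_ge0 ltW.
exists S^-1 => [|i]; first by rewrite invr_gt0.
rewrite -[leRHS]invrK lef_pV2 ?posrE ?invr_gt0//.
rewrite /S (bigD1 i)//= addrCA lerDl addr_ge0// sumr_ge0// => j _.
by rewrite invr_ge0 ltW.
Qed.

Lemma cderiv_periodic (f f' : R -> R[i]) L : cderiv f f' ->
  (forall s, f (s + L) = f s) -> forall s, f' (s + L) = f' s.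
Proof.
move=> hf per s.
have h : cderiv f (fun s => f' (s + L)).
  move=> x; apply: (eq_cderiv_at (f := fun x => f (x + L))); first exact: per.
  exact: cderiv_at_shift (hf _).
have := cderiv_cderive1n h; rewrite (cderiv_cderive1n hf).
by move=> /(congr1 (fun F : R -> R[i] => F s)).
Qed.

Lemma periodic_bounded (f : R -> R[i]) L : 0 < L -> (forall s, f (s + L) = f s) ->
  ccont f -> exists2 M, 0 <= M & forall s, modulus (f s) <= M.
Proof.
move=> L0 per cf; have [M hM] := ccont_bounded (ltW L0) cf.
exists `|M| => // s; have [k hk] := period_reduction s L0.
rewrite -[s](subrK (k%:~R * L)) (periodic_int per) (le_trans (hM _ _)) ?ler_norm//.
by case/andP: hk => -> /ltW ->.
Qed.

Lemma mean_value_abs (f f' : R -> R[i]) B x y : cderiv f f' ->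
  (forall s, `|s - x| <= `|y - x| -> modulus (f' s) <= B) ->
  modulus (f y - f x) <= B * `|y - x|.
Proof.
move=> df le; have [xy|/ltW yx] := leP x y.
  rewrite ger0_norm ?subr_ge0//; apply: (mean_value_cst xy) => s.
    by move=> _; exact: df.
  move=> /andP[xs sy]; apply: le.
  by rewrite !ger0_norm ?subr_ge0 ?lerB.
rewrite modulusC distrC ger0_norm ?subr_ge0//; apply: (mean_value_cst yx) => s.
  by move=> _; exact: df.
move=> /andP[ys sx]; apply: le; rewrite distrC [leRHS]distrC.
by rewrite !ger0_norm ?subr_ge0 ?lerB.
Qed.

End Compactness.

Section Geometry.
Context {R : realType} (m : nat) (U : set (Cplx R)) (G : curves R).
Hypothesis m2 : (2 <= m)%N.
Hypothesis HG : positive_Cm_boundary m U G.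
Implicit Types (i j : 'I_(ncomp G)).
Local Notation path i s := (path_of (c := G) i s).
Local Notation tan i s := (tangent (G := G) i s).

Lemma path_lipschitz i s s' : modulus (path i s - path i s') <= `|s - s'|.
Proof.
rewrite -[leRHS]mul1r; apply: mean_value_abs; first exact: (tangentP m2 HG).
by move=> x _; rewrite (tangent1 HG).
Qed.

Lemma tangent_lipschitz : exists2 K, 0 < K &
  forall i s s', modulus (tan i s - tan i s') <= K * `|s - s'|.
Proof.
have d2 i : cderiv (fun s => tan i s) (cderive1n 2 (path_of i)) :=
  Cm_cderiv (path_Cm HG i) m2.
have H i : exists M, 0 <= M /\ forall s, modulus (cderive1n 2 (path_of i) s) <= M.
  have [M M0 hM] := periodic_bounded (length_gt0 HG i)
    (cderiv_periodic (d2 i) (fun s => tangent_periodic m2 HG i s)) (Cm_ccont (path_Cm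
      HG i) m2).
  by exists M.
have [M hM] := choice H.
have S0 : 0 <= \sum_i M i by apply: sumr_ge0 => i _; case: (hM i).
exists (1 + \sum_i M i) => [|i s s']; first by rewrite ltr_wpDr.
apply: mean_value_abs (d2 i) _ => x _.
rewrite (le_trans (proj2 (hM i) x))// (bigD1 i)//= addrCA lerDl addr_ge0//.
by rewrite sumr_ge0// => j _; case: (hM j).
Qed.

Lemma path_taylor K : (forall i s s', modulus (tan i s - tan i s') <= K * `|s - s'|) ->
  forall i s s', modulus (path i s' - path i s - (s' - s)%:C * tan i s) <= K * `|s' -
    s| ^+ 2.
Proof.
move=> hK i s s'.
pose f x := path i x - x%:C * tan i s.
have -> : path i s' - path i s - (s' - s)%:C * tan i s = f s' - f s.
  by rewrite /f rmorphB /=; ring.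
rewrite expr2 mulrA; apply: (@mean_value_abs R f (fun x => tan i x - tan i s)).
  move=> x; apply: cderiv_atB; first exact: (tangentP m2 HG).
  apply: (cderiv_at_eq (cderiv_atM (cderiv_at_id x) (cderiv_at_cst (tan i s) x))).
  by rewrite mul1r mulr0 addr0.
move=> x hx; have K0 : 0 <= K.
  by have := hK i 1 0; have := modulus_ge0 (tan i 1 - tan i 0);
    rewrite subr0 normr1 mulr1; lra.
by rewrite (le_trans (hK _ _ _))// ler_wpM2l.
Qed.

Lemma path_eq_period i s s' : path i s = path i s' -> exists k : int,
  s' - s = k%:~R * length_of i.
Proof.
move=> E; have L0 := length_gt0 HG i.
have [k hk] := period_reduction s L0; have [k' hk'] := period_reduction s' L0.
have P x (n : int) : path i (x - n%:~R * length_of i) = path i x.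
  rewrite -[RHS](periodic_int (path_periodic HG i) (- n)).
  by rewrite mulrNz mulNr.
have [|_ E2] := @path_simple _ _ _ _ HG i i _ _ hk hk'; first by rewrite !P.
exists (k' - k); rewrite intrB mulrBl; lra.
Qed.

Lemma path_separated i j s s' : path i s = path j s' -> i = j.
Proof.
move=> E; have [s0 h0 E0] := path_reduce HG i s; have [s1 h1 E1] := path_reduce HG j s'.
by have [] := @path_simple _ _ _ _ HG i j _ _ h0 h1; first by rewrite -E0 -E1.
Qed.

(** Chords and arcs are comparable, and distinct components stay apart.  Close
    parameters are controlled by the Lipschitz tangent; for the others the chord is a
    positive function on a compact rectangle, since the curves are simple and disjoint. *)
Lemma chord_arc : exists2 e, 0 < e & forall i j s s',
  modulus (path j s' - path i s) < e ->
  i = j /\ exists k : int, `|s' - s - k%:~R * length_of i| <= 2 * modulus (path j s'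
    - path i s).
Proof.
have [K K0 hK] := tangent_lipschitz.
have near i s h : `|h| <= (2 * K)^-1 -> `|h| <= 2 * modulus (path i (s + h) - path i s).
  move=> hh; have := path_taylor hK i s (s + h); rewrite (addrAC s h) subrr add0r => ht.
  have := modulus_sub_ge (h%:C * tan i s) (path i (s + h) - path i s).
  rewrite modulusM modulus_real (tangent1 HG) mulr1 (modulusC (h%:C * _)) => hs.
  have h2 : K * `|h| ^+ 2 <= `|h| / 2.
    rewrite expr2 mulrA mulrC ler_wpM2l// (le_trans (ler_wpM2l (ltW K0) hh))//.
    by rewrite invfM mulrCA mulfV ?mulr1// gt_eqF.
  lra.
have lip i j s s' x x' :
   `|modulus (path i s - path j s') - modulus (path i x - path j x')| <= `|s - x| +
     `|s' - x'|.
  have A a b c d : `|modulus (a - b) - modulus (c - d)| <= modulus (a - c) + modulus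
    (b - d) :> R.
    rewrite ler_norml; apply/andP; split.
      have := modulus_trans a c d; have := modulus_trans b a d.
      by rewrite (modulusC c a); lra.
    have := modulus_trans c a b; have := modulus_trans d c b.
    by rewrite (modulusC d b); lra.
  by rewrite (le_trans (A _ _ _ _))// lerD// path_lipschitz.
have Hne i j : exists e, 0 < e /\ (i != j -> forall s s',
  e <= modulus (path j s' - path i s)).
  have [<-|ij] := eqVneq i j; first by exists 1.
  have [||e e0 he] := @rectangle_min R (fun s' s => modulus (path j s' - path i s)) 0
    (length_of j) 0 (length_of i).
  - by move=> *; exact: lip.
  - move=> s' s _ _; rewrite modulus_gt0 subr_eq0; apply/eqP => /path_separated ji.
    by move: ij; rewrite ji eqxx.
  exists e; split => // _ s s'.
  have [s0 /andP[h0 h1] ->] := path_reduce HG i s; have [s1 /andP[h2 h3] ->] :=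
    path_reduce HG j s'.
  by apply: he; rewrite ?h0 ?h2 ltW.
pose r := (2 * K)^-1.
have r0 : 0 < r by rewrite invr_gt0 mulr_gt0.
have Heq i : exists e, 0 < e /\ forall s s', modulus (path i s' - path i s) < e ->
    exists k : int, `|s' - s - k%:~R * length_of i| <= 2 * modulus (path i s' - path
      i s).
  have L0 := length_gt0 HG i.
  have [||e e0 he] := @rectangle_min R (fun s h => 2^-1 * modulus (path i (s + h) -
    path i s)) 0 (length_of i) r (length_of i - r).
  - move=> x y x' y'; rewrite -mulrBr normrM ger0_norm ?invr_ge0//.
    have := lip i i (x + y) x (x' + y') x'.
    have -> : x + y - (x' + y') = (x - x') + (y - y') by ring.
    have := ler_normD (x - x') (y - y'); have := normr_ge0 (y - y').
    by lra.
  - move=> s h _ /andP[rh hL]; rewrite mulr_gt0 ?invr_gt0// modulus_gt0 subr_eq0.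
    apply/eqP => /esym/path_eq_period [k]; rewrite (addrAC s h) subrr add0r => E.
    have k0 : (0 < k%:~R :> R) by rewrite -(pmulr_lgt0 _ L0) -E; lra.
    have k1 : (k%:~R < 1 :> R) by rewrite -(ltr_pM2r L0) -E mul1r; lra.
    by move: k0 k1; rewrite ltr0z ltrz1; case: k E => [[|n]|n].
  exists e; split => // s s' hlt.
  have [k hk] := period_reduction (s' - s) L0; set h := s' - s - _ in hk.
  have [k1 hk1] := period_reduction s L0; set s0 := s - _ in hk1.
  have P x (n : int) : path i (x - n%:~R * length_of i) = path i x.
    by rewrite -[RHS](periodic_int (path_periodic HG i) (- n)) mulrNz mulNr.
  have Es : path i s0 = path i s by rewrite P.
  have Es' : path i (s0 + h) = path i s'.
    rewrite -(P s' k) -(P (s' - _) k1); congr (path_of _ _); rewrite /s0 /h; ring.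
  have [hr|hr] := ltP h r.
    exists k; rewrite -/h -Es -Es'; apply: near.
    by case/andP: hk => h0 _; rewrite ger0_norm// ltW.
  have [hL|hL] := leP h (length_of i - r).
    have := he s0 h; rewrite hr hL Es Es' => /(_ _ isT).
    have -> : 0 <= s0 <= length_of i by case/andP: hk1 => -> /ltW ->.
    move=> /(_ isT) hle; have := modulus_ge0 (path i s' - path i s); lra.
  have E3 : path i (s0 + (h - length_of i)) = path i s'.
    rewrite -(path_periodic HG) -Es'; congr (path_of _ _); ring.
  exists (k + 1); rewrite intrD mulrDl mul1r opprD addrA -/h -Es -E3; apply: near.
  case/andP: hk => h0 h1; rewrite -/r ler_norml; apply/andP; split; lra.
have [e1 he1] := choice (fun p : 'I_(ncomp G) * 'I_(ncomp G) => Hne p.1 p.2).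
have [e2 he2] := choice Heq.
have [d1 d10 hd1] := finite_pos_min (fun p => proj1 (he1 p)).
have [d2 d20 hd2] := finite_pos_min (fun i => proj1 (he2 i)).
exists (Num.min d1 d2); first by rewrite lt_min d10.
move=> i j s s'; rewrite lt_min => /andP[l1 l2].
have ij : i = j.
  apply/eqP; apply: contraTT l1 => ij; rewrite -leNgt (le_trans (hd1 (i, j)))//.
  exact: (proj2 (he1 (i, j))).
subst j; split => //; apply: (proj2 (he2 i)).
exact: lt_le_trans l2 (hd2 i).
Qed.

End Geometry.

(** * Cones at the boundary *)

Section Cones.
Context {R : realType} (m : nat) (U : set (Cplx R)) (G : curves R).
Hypothesis m2 : (2 <= m)%N.
Hypothesis domU : bounded_domain U.
Hypothesis HG : positive_Cm_boundary m U G.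
Implicit Types (i j : 'I_(ncomp G)).
Local Notation path i s := (path_of (c := G) i s).
Local Notation tan i s := (tangent (G := G) i s).
Local Notation on_curve := (on_curve G).

Lemma frontierE t : frontier U t <-> on_curve t.
Proof. by rewrite (path_frontier HG). Qed.

Lemma lipschitz_path_continuous (f : R -> Cplx R) L :
  (forall x y, modulus (f x - f y) <= L * `|x - y|) -> continuous f.
Proof.
move=> hf x; apply/cvgrPdist_le => e e0.
have eE : e = (complex.Re e)%:C by rewrite RRe_real// ger0_real// ltW.
have Re0 : 0 < complex.Re e by move: e0; rewrite {1}eE ltcR.
have K1 : 0 < `|L| + 1 by rewrite ltr_wpDl.
near=> y; have xy : `|x - y| <= complex.Re e / (`|L| + 1).
  by near: y; apply: cvgr_dist_le => //; rewrite divr_gt0.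
rewrite eE normcE lecR.
rewrite (le_trans (hf x y))// (le_trans (ler_wpM2r (normr_ge0 _) (ler_norm L)))//.
rewrite (le_trans _ (_ : (`|L| + 1) * (complex.Re e / (`|L| + 1)) <= complex.Re
  e))//; last first.
  by rewrite mulrCA mulfV ?mulr1// gt_eqF.
by rewrite ler_pM// lerDl.
Unshelve. all: by end_near. Qed.

Lemma open_disk (x : R[i]) : U x -> exists2 d, 0 < d & forall y,
  modulus (y - x) < d -> U y.
Proof.
move=> Ux; have [oU _ _ _] := domU.
have /nbhs_ballP[e e0 he] := open_nbhs_nbhs (conj oU Ux).
have eE : e = (complex.Re e)%:C by rewrite RRe_real// ger0_real// ltW.
have Re0 : 0 < complex.Re e by move: e0; rewrite /= {1}eE ltcR.
exists (complex.Re e) => // y hy; apply: he.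
by rewrite -ball_normE /= eE normcE ltcR modulusC.
Qed.

Lemma curve_notin t : on_curve t -> ~ U t.
Proof.
move=> /frontierE[_ h] Ut; apply: h; have [oU _ _ _] := domU.
exact: open_nbhs_nbhs.
Qed.

Lemma off_curve_in x : U x -> exists2 d, 0 < d & off_curve G d x.
Proof.
move=> Ux; have [d d0 hd] := open_disk Ux; exists d => // t ot.
by rewrite leNgt; apply/negP => /hd; exact: curve_notin.
Qed.

(** The segment is connected, and away from the boundary [U] is both relatively open
    and relatively closed in it. *)
Lemma segment_in x v (T : R) : U x -> 0 <= T ->
  (forall u, 0 <= u <= T -> ~ on_curve (x + u%:C * v)) -> U (x + T%:C * v).
Proof.
move=> Ux T0 off; have [oU _ _ _] := domU.
pose p (u : R) : Cplx R := x + u%:C * v.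
have cp : continuous p.
  apply: (@lipschitz_path_continuous p (modulus v)) => a b.
  have -> : p a - p b = (a - b)%:C * v by rewrite /p rmorphB /=; ring.
  by rewrite modulusM modulus_real mulrC.
have cT : connected (`[0, T] : set R) by apply/connected_intervalP;
  exact: interval_is_interval.
have E : `[0, T]%classic `&` p @^-1` U = `[0, T]%classic.
  apply: cT.
  - exists 0; split; first by rewrite /= in_itv/= lexx.
    by rewrite /= /p mul0r addr0.
  - by exists (p @^-1` U) => //; apply: open_comp => // u _; exact: cp.
  - exists (p @^-1` (closure U)).
      by apply: closed_comp => [u _|]; [exact: cp|exact: closed_closure].
    apply/seteqP; split => u /= [hu pu]; split => //; first exact: subset_closure.
    apply: contrapT => nU; apply: (off u); first by move: hu; rewrite in_itv.
    apply/frontierE; split => //= nu; apply: nU; exact: interior_subset nu.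
have : (`[0, T]%classic `&` p @^-1` U) T by rewrite E /= in_itv/= lexx T0.
by case.
Qed.

Lemma domain_bounded : exists2 B, 0 <= B & forall z, U z -> modulus z <= B.
Proof.
have [_ _ _ [M [Mreal hM]]] := domU.
have ME : M = (complex.Re M)%:C by rewrite RRe_real.
have hB z : U z -> modulus z <= complex.Re M + 1.
  move=> Uz; have := hM (complex.Re M + 1)%:C.
  rewrite {1}ME ltcR ltrDl ltr01 => /(_ isT z Uz) /=.
  by rewrite normcE lecR.
exists `|complex.Re M + 1| => // z Uz.
by rewrite (le_trans (hB z Uz))// ler_norm.
Qed.

(** Otherwise the segment from a point of [U] to a point outside would never leave [U]. *)
Lemma curve_nonempty : exists t, on_curve t.
Proof.
have [_ _ [x Ux] _] := domU; have [B B0 hB] := domain_bounded.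
apply: contrapT => nc.
have := hB (B + 1)%:C; rewrite modulus_real ger0_norm ?addr_ge0//.
suff : U (B + 1)%:C by move=> h /(_ h); lra.
have := @segment_in x ((B + 1)%:C - x) 1 Ux ler01.
rewrite mul1r (addrC x) subrK; apply.
by move=> u _ oc; apply: nc; exists (x + u%:C * ((B + 1)%:C - x)).
Qed.

Lemma off_curve_bounded : exists2 D, 0 < D & forall z d, U z -> off_curve G d z ->
  d <= D.
Proof.
have [B B0 hB] := domain_bounded; have [t ot] := curve_nonempty.
exists (modulus t + B + 1) => [|z d Uz /(_ t ot) h].
  by rewrite ltr_wpDl// addr_ge0// modulus_ge0.
by have := modulusB t z; have := hB z Uz; lra.
Qed.

Lemma off_curve_dist d x y : off_curve G d x -> off_curve G (d - modulus (x - y)) y.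
Proof. by move=> h t /h; have := modulus_trans y t x; rewrite (modulusC y); lra. Qed.

Lemma off_curveW d d' x : d' <= d -> off_curve G d x -> off_curve G d' x.
Proof. by move=> dd h t /h; apply: le_trans. Qed.

(** At a small scale the curve is almost straight, so two of its points cannot differ
    by a nearly normal vector. *)
Lemma cone_off_curve : exists r : R, [/\ 0 < r,
  (forall i j s s', modulus (path j s' - path i s) < r ->
    modulus (tan j s' - tan i s) <= 4^-1) &
  (forall i j s s' T e, modulus (path j s' - path i s) < r -> 0 < T < r ->
    modulus e <= T / 2 -> ~ on_curve (path j s' - T%:C * ('i * tan i s) + e))].
Proof.
have [K K0 hK] := tangent_lipschitz m2 HG.
have [e0 e00 he] := chord_arc m2 HG.
(* Projecting on the normal will give T <= T / 2 + 15 * K * r * T, which is excluded by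
   40 * K * r <= 1.  The bound e0 / 2 makes chord_arc apply. *)
pose r := Num.min (e0 / 2) (40 * (K + 1))^-1.
have K1 : 0 < 40 * (K + 1) by rewrite mulr_gt0// addr_gt0.
have r0 : 0 < r by rewrite lt_min divr_gt0//= invr_gt0.
have re : 2 * r <= e0.
  have : r <= e0 / 2 by rewrite ge_min lexx.
  by lra.
have rK : 40 * K * r <= 1.
  have : r <= (40 * (K + 1))^-1 by rewrite ge_min lexx orbT.
  rewrite -[X in _ <= X -> _]mul1r ler_pdivlMr// => h.
  by nra.
have tanP i s (k : int) : tan i (s + k%:~R * length_of i) = tan i s.
  exact: (periodic_int (tangent_periodic m2 HG i)).
have close i j s s' : modulus (path j s' - path i s) < r ->
    modulus (tan j s' - tan i s) <= 2 * K * r.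
  move=> hr; have [|ij [k hk]] := he i j s s'; first by lra.
  subst j; rewrite -(tanP i s k) (le_trans (hK _ _ _))// opprD addrA.
  by nra.
exists r; split => //; first by move=> i j s s' /close; lra.
move=> i j s s' T e hr /andP[T0 Tr] eT [l [x hx]].
set q := path j s' in hr hx; set v := 'i * tan i s in hx.
have v1 : modulus v = 1 by rewrite modulusM modulus_i (tangent1 HG) mulr1.
have xq : path l x - q = - (T%:C * v) + e by rewrite -hx; ring.
have xqT : modulus (path l x - q) <= 3 / 2 * T.
  rewrite xq (le_trans (modulusD _ _))// modulusN modulusM v1 mulr1 modulus_real.
  by rewrite gtr0_norm//; lra.
have [|jl [k hk]] := he j l s' x; first by rewrite -/q; lra.
subst l; set h := x - s' - _ in hk.
have xh : path j x = path j (s' + h).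
  have -> : s' + h = x + (- k)%:~R * length_of j by rewrite /h mulrNz; ring.
  by rewrite (periodic_int (path_periodic HG j)).
have h3 : `|h| <= 3 * T by lra.
have := path_taylor m2 HG hK j s' (s' + h).
rewrite -xh (addrAC s' h) subrr add0r -/q => hE.
set E := _ - _ in hE.
have hE' : modulus E <= 9 * K * r * T.
  rewrite (le_trans hE)//; have : `|h| ^+ 2 <= (3 * T) ^+ 2 by rewrite lerXn2r
    ?nnegrE//; lra.
  move=> h2; have : K * `|h| ^+ 2 <= K * (3 * T) ^+ 2 by rewrite ler_wpM2l// ltW.
  have : K * T * T <= K * T * r by rewrite ler_wpM2l ?mulr_ge0 ?ltW.
  by rewrite expr2; nra.
have EE : - (T%:C * v) + e = E + h%:C * tan j s' by rewrite -xq /E; ring.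
have vv : v * conjc v = 1 by rewrite mulc_conj v1 expr1n.
have tt : tan i s * conjc v = - 'i.
  have ii : 'i * 'i = -1 :> R[i] by rewrite -expr2 sqr_i.
  have -> : tan i s = - 'i * v by rewrite /v mulrA mulNr ii opprK mul1r.
  by rewrite -mulrA vv mulr1.
have := congr1 (fun z => complex.Re (z * conjc v)) EE.
have -> : (- (T%:C * v) + e) * conjc v = (- T)%:C + e * conjc v.
  by rewrite mulrDl mulNr -mulrA vv mulr1 rmorphN.
have -> : (E + h%:C * tan j s') * conjc v =
    E * conjc v + h%:C * ((tan j s' - tan i s) * conjc v) - h%:C * 'i.
  by rewrite [(tan j s' - _) * _]mulrBl tt; ring.
rewrite !cReD cReN !cReZ mulr0 subr0 => EQ.
rewrite [complex.Re (- T)%:C]/= in EQ.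
have c1 : modulus (conjc v) = 1 by rewrite modulus_conj.
have b1 := normr_Re_le (e * conjc v); have b2 := normr_Re_le (E * conjc v).
have b3 := normr_Re_le ((tan j s' - tan i s) * conjc v).
rewrite !modulusM c1 !mulr1 in b1 b2 b3.
have b4 := close i j s s' hr.
have b5 : `|h * complex.Re ((tan j s' - tan i s) * conjc v)| <= 3 * T * (2 * K * r).
  by rewrite normrM ler_pM// (le_trans b3 b4).
move: b1 b2 b5; rewrite !ler_norml => /andP[p1 p2] /andP[p3 p4] /andP[p5 p6].
have : 40 * K * r * T <= T by rewrite ler_piMl// ltW.
by lra.
Qed.

End Cones.

(** * Growth of the derivative and Hoelder continuity *)

Section HardyLittlewood.
Context {R : realType} (m : nat) (U : set (Cplx R)) (G : curves R).
Hypothesis m2 : (2 <= m)%N.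
Hypothesis domU : bounded_domain U.
Hypothesis HG : positive_Cm_boundary m U G.
Implicit Types (i j : 'I_(ncomp G)).
Local Notation path i s := (path_of (c := G) i s).
Local Notation tan i s := (tangent (G := G) i s).
Local Notation on_curve := (on_curve G).
Local Notation off_curve := (off_curve G).

(** The cone misses the curve, hence it lies on one side of it, and it contains the
    points [q - eps * normal] that the orientation puts outside. *)
Lemma exterior_cone : exists2 r, 0 < r & forall i j s s' T e,
  modulus (path j s' - path i s) < r -> 0 < T < r -> modulus e <= T / 2 ->
  ~ U (path j s' - T%:C * ('i * tan i s) + e).
Proof.
have [r [r0 htan hcone]] := cone_off_curve m2 HG.
exists r => // i j s s' T e hr /andP[T0 Tr] eT Ux.
set q := path j s' in hr Ux; set v := 'i * tan i s in Ux.
have [eps [/andP[eps0 epsr] out]] : exists eps : R, 0 < eps < r /\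
    ~ closure U (q - eps%:C * ('i * tan j s')).
  have h := path_positive HG j s'.
  have h2 : \forall eps \near 0^'+, 0 < eps < r :> Prop.
    near=> eps; apply/andP; split; near: eps.
      exact: nbhs_right_gt.
    exact: nbhs_right_lt.
  have [eps [[_ h3] h4]] := filter_ex (filterI h h2).
  by exists eps.
pose w := eps%:C * (v - 'i * tan j s').
have wle : modulus w <= eps / 2.
  have v4 : modulus (v - 'i * tan j s') <= 4^-1.
    by rewrite /v -mulrBr modulusM modulus_i mul1r modulusC; exact: htan.
  rewrite /w modulusM modulus_real gtr0_norm//.
  by rewrite ler_wpM2l ?(ltW eps0)//; lra.
pose x := q - T%:C * v + e.
pose y := q - eps%:C * v + w.
apply: out; apply: subset_closure.
have -> : q - eps%:C * ('i * tan j s') = y by rewrite /y /w; ring.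
have := @segment_in R m U G domU HG x (y - x) 1 Ux ler01.
rewrite mul1r (addrC x) subrK; apply => u /andP[u0 u1].
have -> : x + u%:C * (y - x) = q - ((1 - u) * T + u * eps)%:C * v + ((1 - u)%:C * e +
  u%:C * w).
  by rewrite /x /y !(rmorphD (real_complex R)) !(rmorphM (real_complex R)) rmorphN
    /=; ring.
apply: hcone => //.
  have mx : Num.max T eps < r by rewrite gt_max Tr.
  have mn : 0 < Num.min T eps by rewrite lt_min T0.
  have T1 : T <= Num.max T eps by rewrite le_max lexx.
  have T2 : eps <= Num.max T eps by rewrite le_max lexx orbT.
  have T3 : Num.min T eps <= T by rewrite ge_min lexx.
  have T4 : Num.min T eps <= eps by rewrite ge_min lexx orbT.
  by apply/andP; split; nra.
rewrite (le_trans (modulusD _ _))// (modulusM _ e) (modulusM _ w) !modulus_real.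
rewrite !ger0_norm ?subr_ge0//; nra.
Unshelve. all: by end_near. Qed.

(** A boundary point too close to the pushed point would have the initial point in its
    exterior cone. *)
Lemma interior_cone : exists2 r, 0 < r & forall i s z T,
  U z -> modulus (z - path i s) < r -> 0 <= T < r ->
  U (z + T%:C * ('i * tan i s)) /\ off_curve (T / 2) (z + T%:C * ('i * tan i s)).
Proof.
have [r r0 hr] := exterior_cone.
exists (r / 3); first by rewrite divr_gt0.
move=> i s z T Uz zr /andP[T0 Tr].
set v := 'i * tan i s.
have v1 : modulus v = 1 by rewrite modulusM modulus_i (tangent1 HG) mulr1.
have off u : 0 <= u <= T -> off_curve (u / 2) (z + u%:C * v).
  move=> /andP[u0 uT] t [j [s' ->]].
  have [->|uN0] := eqVneq u 0; first by rewrite mul0r modulus_ge0.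
  have up : 0 < u by rewrite lt0r uN0.
  rewrite leNgt; apply/negP => h.
  have := hr i j s s' u (z + u%:C * v - path j s').
  have -> : path j s' - u%:C * v + (z + u%:C * v - path j s') = z by ring.
  have d1 := modulus_trans (z + u%:C * v) (path j s') (path i s).
  have d2 := modulusD (z - path i s) (u%:C * v).
  rewrite modulusM modulus_real gtr0_norm// v1 mulr1 addrAC in d2.
  move=> hh; apply: (hh _ _ _ Uz); [by lra|by lra|by rewrite modulusC ltW].
split; last by apply: off; rewrite T0 lexx.
apply: (segment_in domU HG) => // u /andP[u0 uT] oc.
have [uE|uN0] := eqVneq u 0.
  by apply: (curve_notin domU HG oc); rewrite uE mul0r addr0.
have up : 0 < u by rewrite lt0r uN0.
have := off u; rewrite u0 uT => /(_ isT _ oc); rewrite subrr modulus0; lra.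
Qed.

Lemma is_derive_powR (a x c : R) : 0 < x + c -> is_derive x 1 (fun y =>
  (y + c) `^ a) (a * (x + c) `^ (a - 1)).
Proof.
move=> xc.
have h1 : is_derive (x + c) 1 (fun y : R => y `^ a) (a * (x + c) `^ (a - 1)).
  split; first by apply: derivable_powR; rewrite in_itv/= andbT.
  by rewrite -derive1E powR_derive1// in_itv/= andbT.
have h : is_derive x 1 (fun y : R => y + c) 1.
  by apply: (is_derive_eqr (rderivD (is_derive_id x 1) (is_derive_cst c x 1)));
    rewrite addr0.
have := @is_derive1_comp R (fun y => y `^ a) (fun y => y + c) x _ _ h1 h.
by rewrite mulr1.
Qed.

Lemma powR_antitone (x y b : R) : b <= 0 -> 0 < x -> x <= y -> y `^ b <= x `^ b.
Proof.
move=> b0 x0 xy; have y0 := lt_le_trans x0 xy.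
rewrite -[b]opprK powRN [leRHS]powRN lef_pV2 ?posrE ?powR_gt0//.
by apply: ge0_ler_powR; rewrite ?oppr_ge0// nnegrE ltW.
Qed.

Lemma powR_scale (c x a : R) : 1 <= c -> 0 <= x -> 0 < a <= 1 ->
  (c * x) `^ a <= c * x `^ a.
Proof.
move=> c1 x0 /andP[a0 a1]; have c0 : 0 <= c by lra.
by rewrite powRM// ler_wpM2r ?powR_ge0// ler1_powR.
Qed.

(** The distance to the curve at height [u] is at least [(u + d) / 6], as it is at least
    [u / 2] and at least [d - u].  So the bound on the derivative has a primitive
    proportional to [(u + d) `^ b]. *)
Lemma normal_leg i s z (T d B b : R) f f' :
  0 <= T -> 0 < d -> off_curve d z -> 0 < b <= 1 -> 0 <= B ->
  (forall u, 0 <= u <= T -> off_curve (u / 2) (z + u%:C * ('i * tan i s))) ->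
  (forall u, 0 <= u <= T -> cdiff f (z + u%:C * ('i * tan i s)) (f' (z + u%:C * ('i *
    tan i s)))) ->
  (forall u e, 0 <= u <= T -> 0 < e -> off_curve e (z + u%:C * ('i * tan i s)) ->
    modulus (f' (z + u%:C * ('i * tan i s))) <= B * e `^ (b - 1)) ->
  modulus (f (z + T%:C * ('i * tan i s)) - f z) <= 6 * B / b * (T + d) `^ b.
Proof.
move=> T0 d0 dz /andP[b0 b1] B0 off df le.
set v := 'i * tan i s in off df le *.
have v1 : modulus v = 1 by rewrite modulusM modulus_i (tangent1 HG) mulr1.
have C0 : 0 <= 6 * B / b by rewrite divr_ge0 ?mulr_ge0// ltW.
have step : modulus (f (z + T%:C * v) - f z) <=
    6 * B / b * (T + d) `^ b - 6 * B / b * (0 + d) `^ b.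
  have h := @mean_value_line R f f' (fun u => 6 * B / b * (u + d) `^ b)
    (fun u => 6 * B * (u + d) `^ (b - 1)) z v T T0 df.
  apply: h => u /andP[u0 uT].
    have ud : 0 < u + d by lra.
    apply: (is_derive_eqr (is_deriveZ _ (is_derive_powR b ud))).
    by rewrite /GRing.scale /= mulrA divfK// gt_eqF.
  have ud : 0 < u + d by lra.
  have hu : 0 <= u <= T by rewrite u0 uT.
  rewrite v1 mulr1.
  have off6 : off_curve (6^-1 * (u + d)) (z + u%:C * v).
    have [ud2|du2] := leP u (d / 2).
      apply: (@off_curveW R G (d - modulus (z - (z + u%:C * v))));
        last exact: off_curve_dist.
      rewrite modulusC addrAC subrr add0r modulusM v1 modulus_real ger0_norm//; lra.
    apply: off_curveW (off u hu); lra.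
  have := le u _ hu _ off6; rewrite mulr_gt0 ?invr_gt0// => /(_ isT) h.
  rewrite (le_trans h)// -mulrA mulrCA ler_wpM2l//.
  rewrite powRM ?invr_ge0// ?(ltW ud)// ler_wpM2r ?powR_ge0//.
  rewrite -powR_inv1// -powRrM mulN1r opprB -[leRHS]powRr1//.
  by apply: ler_powR; lra.
by rewrite (le_trans step)// gerBl mulr_ge0// powR_ge0.
Qed.

(** The segment has length at most [q] and stays at distance [q] from the curve. *)
Lemma segment_leg z w (q B b : R) f f' : U z -> 0 < q -> off_curve (2 * q) z ->
  modulus (z - w) <= q -> b <= 1 -> 0 <= B ->
  (forall u, 0 <= u <= 1 -> U (z + u%:C * (w - z)) ->
    cdiff f (z + u%:C * (w - z)) (f' (z + u%:C * (w - z)))) ->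
  (forall u e, 0 <= u <= 1 -> U (z + u%:C * (w - z)) -> 0 < e ->
    off_curve e (z + u%:C * (w - z)) ->
    modulus (f' (z + u%:C * (w - z))) <= B * e `^ (b - 1)) ->
  U w /\ modulus (f w - f z) <= B * q `^ b.
Proof.
move=> Uz q0 oz zw b1 B0 df le.
have off u : 0 <= u <= 1 -> off_curve q (z + u%:C * (w - z)).
  move=> /andP[u0 u1].
  apply: (@off_curveW R G (2 * q - modulus (z - (z + u%:C * (w - z)))));
    last exact: off_curve_dist.
  rewrite modulusC addrAC subrr add0r modulusM modulus_real ger0_norm// (modulusC w).
  have := modulus_ge0 (z - w); nra.
have inU u : 0 <= u <= 1 -> U (z + u%:C * (w - z)).
  move=> /andP[u0 u1]; apply: (segment_in domU HG) => // x /andP[x0 xu] oc.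
  have := off x; rewrite x0 (le_trans xu) // => /(_ isT _ oc).
  by rewrite subrr modulus0 leNgt q0.
split.
  by have := inU 1; rewrite mul1r (addrC z) subrK ler01 lexx; apply.
have qE : q `^ b = q `^ (b - 1) * q.
  by rewrite -{3}[q]powRr1 ?(ltW q0)// -powRD ?subrK// (gt_eqF q0) implybT.
rewrite qE mulrA (le_trans (@mean_value_segment R f f' (B * q `^ (b - 1)) z w _ _))//.
- by move=> u hu; apply: df => //; exact: inU.
- by move=> u hu; apply: le => //; [exact: inU|exact: off].
by rewrite modulusC ler_wpM2l// mulr_ge0// powR_ge0.
Qed.

(** A local form of the theorem of Hardy and Littlewood.  Away from the curve, the two
    points are joined by a segment.  Close to the curve, the path leaves one of them
    along the normal, up to a height comparable to the distance of the points, and comes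
    back to the other one in the same way. *)
Lemma hardy_littlewood (b : R) : 0 < b <= 1 -> exists C r : R, [/\ 0 <= C, 0 < r &
  forall z w B f f', U z -> U w -> modulus (z - w) <= r -> 0 <= B ->
  (forall x, U x -> modulus (x - z) <= 5 * modulus (z - w) -> cdiff f x (f' x)) ->
  (forall x e, U x -> modulus (x - z) <= 5 * modulus (z - w) -> 0 < e ->
    off_curve e x ->
    modulus (f' x) <= B * e `^ (b - 1)) ->
  modulus (f z - f w) <= C * B * modulus (z - w) `^ b].
Proof.
move=> /andP[b0 b1].
have [r r0 hcone] := interior_cone.
have b84 : 0 <= 84 / b by rewrite divr_ge0// ltW.
(* Each of the two legs along the normal contributes at most 6 * 7 / b, and the whole path
   stays within 5 * modulus (z - w) of z. *)
exists (1 + 84 / b), (r / 5); split; [by lra|by lra|].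
move=> z w B f f' Uz Uw zwr B0 df le.
have [->|zw] := eqVneq z w.
  by rewrite !subrr modulus0 powR0 ?gt_eqF// mulr0.
set q := modulus (z - w) in zwr df le *.
have q0 : 0 < q by rewrite modulus_gt0 subr_eq0.
have qb : 0 <= B * q `^ b by rewrite mulr_ge0// powR_ge0.
have line_le (u : R) x y : 0 <= u <= 1 -> modulus (x + u%:C * (y - x) - x) <= modulus
  (y - x).
  move=> /andP[u0 u1]; rewrite addrAC subrr add0r modulusM modulus_real ger0_norm//.
  by rewrite ler_piMl// modulus_ge0.
have [oz|noz] := pselect (off_curve (2 * q) z).
  have [||_ h] := @segment_leg z w q B b f f' Uz q0 oz (lexx _) b1 B0.
  - move=> u hu Ux; apply: df => //; have := line_le u z w hu.
    by rewrite (modulusC w) -/q; lra.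
  - move=> u e hu Ux; apply: le => //; have := line_le u z w hu.
    by rewrite (modulusC w) -/q; lra.
  rewrite modulusC (le_trans h)// -mulrA mulrDl mul1r lerDl.
  by rewrite mulr_ge0.
have {noz} [i [s ps]] : exists i s, modulus (path i s - z) < 2 * q.
  apply: contrapT => nex; apply: noz => t [i [s ->]].
  by rewrite leNgt; apply/negP => h; apply: nex; exists i, s.
have pw : modulus (path i s - w) < 3 * q.
  by have := modulus_trans z (path i s) w; rewrite -/q; lra.
set v := 'i * tan i s.
have v1 : modulus v = 1 by rewrite modulusM modulus_i (tangent1 HG) mulr1.
(* At this height the distance to the curve is at least 2 * q, and the segment of length q
   that joins the two raised points stays at distance q. *)
pose T := 4 * q.
have oc : on_curve (path i s) by exists i, s.
have cone x u : U x -> modulus (path i s - x) < 3 * q -> 0 <= u <= T ->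
    U (x + u%:C * v) /\ off_curve (u / 2) (x + u%:C * v).
  move=> Ux px /andP[u0 uT]; apply: hcone => //; first by rewrite modulusC; lra.
  by rewrite u0 /=; rewrite /T in uT; lra.
have leg x : U x -> modulus (path i s - x) < 3 * q -> modulus (x - z) <= q ->
    modulus (f (x + T%:C * v) - f x) <= 42 / b * (B * q `^ b).
  move=> Ux px xz; have [d d0 dx] := off_curve_in domU HG Ux.
  have near u : 0 <= u <= T -> modulus (x + u%:C * v - z) <= 5 * q.
    move=> /andP[u0 uT]; rewrite addrAC (le_trans (modulusD _ _))// modulusM v1 mulr1.
    by rewrite modulus_real ger0_norm//; rewrite /T in uT; lra.
  have := @normal_leg i s x T d B b f f'; rewrite -/v => h.
  rewrite (le_trans (h _ d0 dx _ B0 _ _ _))//.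
  - by rewrite mulr_ge0// ltW.
  - by rewrite b0.
  - by move=> u hu; have [] := cone x u Ux px hu.
  - by move=> u hu; apply: df; [have [] := cone x u Ux px hu|exact: near].
  - by move=> u e hu; apply: le; [have [] := cone x u Ux px hu|exact: near].
  have d3 : d <= 3 * q by have := dx _ oc; lra.
  have h7 : (T + d) `^ b <= 7 * q `^ b.
    have h7q : (7 * q) `^ b <= 7 * q `^ b by apply: powR_scale;
      [lra|exact: ltW|rewrite b0].
    rewrite (le_trans _ h7q)// ge0_ler_powR ?(ltW b0)// ?nnegrE /T; lra.
  have C0 : 0 <= 6 * B / b by rewrite divr_ge0 ?mulr_ge0// ltW.
  rewrite (le_trans (ler_wpM2l C0 h7))// le_eqVlt; apply/orP; left; apply/eqP.
  by ring.
have T2 : off_curve (2 * q) (z + T%:C * v).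
  have T0 : 0 <= T <= T by rewrite lexx mulr_ge0// ltW.
  have pz : modulus (path i s - z) < 3 * q by lra.
  by have [_] := cone z T Uz pz T0; rewrite /T (_ : 4 * q / 2 = 2 * q)//; lra.
have T0 : 0 <= T <= T by rewrite lexx mulr_ge0// ltW.
have pz : modulus (path i s - z) < 3 * q by lra.
have UT := proj1 (cone z T Uz pz T0).
have zwT : (z + T%:C * v) - (w + T%:C * v) = z - w by ring.
have mid : modulus (f (w + T%:C * v) - f (z + T%:C * v)) <= B * q `^ b.
  have near u : 0 <= u <= 1 ->
      modulus (z + T%:C * v + u%:C * (w + T%:C * v - (z + T%:C * v)) - z) <= 5 * q.
    move=> hu; have h1 := line_le u (z + T%:C * v) (w + T%:C * v) hu.
    have := modulus_trans (z + T%:C * v) (z + T%:C * v + u%:C * (w + T%:C * v - (z +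
      T%:C * v))) z.
    rewrite [X in _ <= _ + modulus X]addrAC subrr add0r modulusM v1 mulr1 modulus_real.
    rewrite [modulus (w + _ - _)]modulusC zwT -/q in h1.
    rewrite ger0_norm /T; lra.
  have [|||_ //] := @segment_leg (z + T%:C * v) (w + T%:C * v) q B b f f' UT q0 T2 _
    b1 B0.
  - by rewrite zwT.
  - by move=> u hu Ux; apply: df => //; exact: near.
  - by move=> u e hu Ux; apply: le => //; exact: near.
have lz := leg z Uz pz; rewrite subrr modulus0 (ltW q0) in lz; have {}lz := lz isT.
have wz : modulus (w - z) <= q by rewrite modulusC.
have lw := leg w Uw pw wz.
have -> : f z - f w = - (f (z + T%:C * v) - f z) - (f (w + T%:C * v) - f (z + T%:C *
  v)) +
    (f (w + T%:C * v) - f w) by ring.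
rewrite (le_trans (modulusD _ _))// (le_trans (lerD (modulusB _ _) (lexx _)))//
  modulusN.
rewrite (_ : (1 + 84 / b) * B * q `^ b = B * q `^ b + 84 / b * (B * q `^ b));
  last by ring.
rewrite (_ : 84 / b = 42 / b + 42 / b); last by rewrite -mulrDl -natrD.
by lra.
Qed.
End HardyLittlewood.

(** * Hoelder classes on the line *)

Section HolderBounded.
Context {R : realType} (alpha : R).
Hypothesis alpha01 : 0 < alpha < 1.
Implicit Types (u v f : R -> R[i]).

(** Hoelder continuity is asked for at every order, not only at the last one: products
    are then estimated by a plain induction. *)
Fixpoint holder_bounded (m : nat) u (M : R) : Prop :=
  [/\ ccont u, forall s, modulus (u s) <= M,
     forall s s', modulus (u s - u s') <= M * `|s - s'| `^ alpha &
     if m is m'.+1 then exists2 u', cderiv u u' & holder_bounded m' u' M else True].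

Lemma holder_bounded0 m u M : holder_bounded m u M ->
  [/\ ccont u, forall s, modulus (u s) <= M &
     forall s s', modulus (u s - u s') <= M * `|s - s'| `^ alpha].
Proof. by case: m => [|m] []. Qed.

Lemma holder_bounded_ge0 m u M : holder_bounded m u M -> 0 <= M.
Proof. by move=> /holder_bounded0[_ h _]; rewrite (le_trans _ (h 0))// modulus_ge0. Qed.

Lemma holder_boundedW m u M : holder_bounded m.+1 u M -> holder_bounded m u M.
Proof.
elim: m u => [|m IH] u; first by case.
by move=> [h1 h2 h3 [u' du hu]]; split => //; exists u' => //; exact: IH.
Qed.

Lemma holder_boundedD m u v A B : holder_bounded m u A -> holder_bounded m v B ->
  holder_bounded m (fun s => u s + v s) (A + B).
Proof.
have key u1 v1 (h1 : holder_bounded 0 u1 A) (h2 : holder_bounded 0 v1 B) :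
    holder_bounded 0 (fun s => u1 s + v1 s) (A + B).
  case: h1 => a1 a2 a3 _; case: h2 => b1 b2 b3 _; split => //.
  - exact: ccontD.
  - by move=> s; rewrite (le_trans (modulusD _ _))// lerD.
  - by move=> s s'; rewrite opprD addrACA (le_trans (modulusD _ _))// mulrDl lerD.
elim: m u v => [|m IH] u v hu hv; first exact: key.
have [] := holder_bounded0 hu; have [] := holder_bounded0 hv => b1 b2 b3 a1 a2 a3.
have [c1 c2 c3 _] := key u v (And4 a1 a2 a3 I) (And4 b1 b2 b3 I).
split => //; case: hu => _ _ _ [u' du hu]; case: hv => _ _ _ [v' dv hv].
exists (fun s => u' s + v' s); last exact: IH.
by move=> s; apply: cderiv_atD.
Qed.

Lemma holder_boundedM m u v A B : holder_bounded m u A -> holder_bounded m v B ->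
  holder_bounded m (fun s => u s * v s) (2 ^+ m.+1 * (A * B)).
Proof.
elim: m u v => [|m IH] u v hu hv;
  have A0 := holder_bounded_ge0 hu; have B0 := holder_bounded_ge0 hv;
  have [a1 a2 a3] := holder_bounded0 hu; have [b1 b2 b3] := holder_bounded0 hv.
  split => //; rewrite ?expr1.
  - exact: ccontM.
  - move=> s; rewrite modulusM (le_trans (_ : _ <= A * B))//.
      by rewrite ler_pM// modulus_ge0.
    by rewrite ler_peMl ?mulr_ge0// ler1n.
  - move=> s s'.
    have -> : u s * v s - u s' * v s' = (u s - u s') * v s + u s' * (v s - v s') by
      ring.
    rewrite (le_trans (modulusD _ _))// !modulusM.
    have c1 : modulus (u s - u s') * modulus (v s) <= (A * `|s - s'| `^ alpha) * B.
      by rewrite ler_pM// modulus_ge0.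
    have c2 : modulus (u s') * modulus (v s - v s') <= A * (B * `|s - s'| `^ alpha).
      by rewrite ler_pM// modulus_ge0.
    lra.
have hm := IH _ _ (holder_boundedW hu) (holder_boundedW hv).
have [c1 c2 c3] := holder_bounded0 hm.
have AB : 0 <= 2 ^+ m.+1 * (A * B) by rewrite mulr_ge0 ?exprn_ge0 ?mulr_ge0.
have le2 : 2 ^+ m.+1 * (A * B) <= 2 ^+ m.+2 * (A * B) by rewrite (exprS _ m.+1)
  -mulrA; lra.
split => //.
- by move=> s; rewrite (le_trans (c2 s)).
- by move=> s s'; rewrite (le_trans (c3 s s'))// ler_wpM2r// powR_ge0.
case: (hu) => _ _ _ [u' du hu']; case: (hv) => _ _ _ [v' dv hv'].
exists (fun s => u' s * v s + u s * v' s).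
  by move=> s; apply: cderiv_atM.
have -> : 2 ^+ m.+2 * (A * B) = 2 ^+ m.+1 * (A * B) + 2 ^+ m.+1 * (A * B).
  by rewrite (exprS _ m.+1); ring.
by apply: holder_boundedD; apply: IH => //; exact: holder_boundedW.
Qed.

Lemma holder_bounded_conj m u A : holder_bounded m u A ->
  holder_bounded m (fun s => conjc (u s)) A.
Proof.
elim: m u => [|m IH] u hu; have [a1 a2 a3] := holder_bounded0 hu.
  split => //.
  - case: a1 => a11 a12; split.
      by rewrite (_ : _ \o _ = complex.Re (R:=R) \o u)//; apply/funext => s /=;
        rewrite cRe_conj.
    rewrite (_ : _ \o _ = fun s => - (complex.Im (R:=R) \o u) s).
      by move=> s; exact: (cvgN (a12 s)).
    by apply/funext => s /=; rewrite cIm_conj.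
  - by move=> s; rewrite modulus_conj.
  - by move=> s s'; rewrite -rmorphB modulus_conj.
have [c1 c2 c3] := holder_bounded0 (IH _ (holder_boundedW hu)).
split => //; case: hu => _ _ _ [u' du hu]; exists (fun s => conjc (u' s));
  last exact: IH.
by move=> s; apply: cderiv_at_conj.
Qed.

Lemma lipschitz_holder u u' B : cderiv u u' -> (forall s, modulus (u s) <= B) ->
  (forall s, modulus (u' s) <= B) ->
  forall s s', modulus (u s - u s') <= 2 * B * `|s - s'| `^ alpha.
Proof.
move=> du uB u'B s s'; have B0 : 0 <= B by rewrite (le_trans _ (uB 0))// modulus_ge0.
have [a0 a1] := andP alpha01.
have [h1|h1] := leP `|s - s'| 1.
  have [->|ss'] := eqVneq s s'; first by rewrite !subrr modulus0 mulr_ge0 ?powR_ge0//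
    mulr_ge0.
  rewrite (le_trans (mean_value_abs du (fun x _ => u'B x)))// -mulrA [leRHS]mulrCA
    ler_wpM2l//.
  have : `|s - s'| <= `|s - s'| `^ alpha.
    by rewrite ger1_powR ?(ltW a1)// normr_gt0 subr_eq0 ss'.
  by have := powR_ge0 `|s - s'| alpha; lra.
have p1 : 1 <= `|s - s'| `^ alpha.
  by rewrite -(powRr0 `|s - s'|) ler_powR// ltW.
rewrite (le_trans (modulusB _ _))// (le_trans (lerD (uB s) (uB s')))//.
have : 0 <= B * (`|s - s'| `^ alpha - 1) by rewrite mulr_ge0// subr_ge0.
lra.
Qed.

(** Below the last order, Hoelder continuity comes from the bound on the next
    derivative, at the cost of a factor 2. *)
Lemma holder_bounded_chain m (D : nat -> R -> R[i]) M :
  (forall j, (j < m)%N -> cderiv (D j) (D j.+1)) -> ccont (D m) ->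
  (forall j s, (j <= m)%N -> modulus (D j s) <= M) ->
  (forall s s', modulus (D m s - D m s') <= M * `|s - s'| `^ alpha) ->
  holder_bounded m (D 0%N) (2 * M).
Proof.
elim: m D => [|m IH] D dD cD bD hD; have M0 : 0 <= M by rewrite (le_trans _ (bD 0%N 0
  isT))// modulus_ge0.
  split => // [s|s s'].
    by have := bD 0%N s isT; lra.
  by rewrite (le_trans (hD s s'))// ler_wpM2r ?powR_ge0//; lra.
split.
- exact: cderiv_cont (dD 0%N isT).
- by move=> s; have := bD 0%N s isT; lra.
- apply: lipschitz_holder (dD 0%N isT) _ _ => s; exact: bD.
exists (D 1%N); first exact: dD.
by apply: (IH (fun j => D j.+1)) => // [j jm|j s jm];
  [exact: (dD j.+1)|exact: (bD j.+1)].
Qed.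

Lemma periodic_holder_bounded m (D : nat -> R -> R[i]) L : 0 < L ->
  (forall s, D 0%N (s + L) = D 0%N s) ->
  (forall j, (j < m.+1)%N -> cderiv (D j) (D j.+1)) -> ccont (D m.+1) ->
  exists M, holder_bounded m (D 0%N) M.
Proof.
move=> L0 per dD cD.
have perD j : (j <= m.+1)%N -> forall s, D j (s + L) = D j s.
  elim: j => [//|j IH jm].
  exact: cderiv_periodic (dD j jm) (IH (ltnW jm)).
have contD j : (j <= m.+1)%N -> ccont (D j).
  by rewrite leq_eqVlt => /predU1P[->//|jm]; exact: cderiv_cont (dD j jm).
have bD (j : 'I_m.+2) : exists M, 0 <= M /\ forall s, modulus (D j s) <= M.
  have jm : (j <= m.+1)%N by rewrite -ltnS.
  by have [M M0 hM] := periodic_bounded L0 (perD j jm) (contD j jm); exists M.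
have [M hM] := choice bD.
have B0 : 0 <= \sum_j M j by apply: sumr_ge0 => j _; case: (hM j).
have bB j s : (j <= m.+1)%N -> modulus (D j s) <= \sum_j M j.
  move=> jm; have jm2 : (j < m.+2)%N by [].
  rewrite (le_trans (proj2 (hM (Ordinal jm2)) s))// (bigD1 (Ordinal jm2))//= lerDl.
  by apply: sumr_ge0 => k _; case: (hM k).
exists (2 * (2 * \sum_j M j)); apply: holder_bounded_chain.
- by move=> j jm; apply: dD; exact: ltnW.
- exact: contD.
- by move=> j s jm; have := bB j s (leqW jm); lra.
- by apply: (lipschitz_holder (dD m (ltnSn m))) => s; apply: bB.
Qed.

End HolderBounded.

(** * Cauchy integrals with a single multiple pole *)

Section BaseEstimate.
Context {R : realType} (m : nat) (U : set (Cplx R)) (G : curves R) (alpha : R).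
Hypothesis m2 : (2 <= m)%N.
Hypothesis HG : positive_Cm_boundary m U G.
Hypothesis alpha01 : 0 < alpha < 1.
Implicit Types (i j : 'I_(ncomp G)).
Local Notation path i s := (path_of (c := G) i s).
Local Notation tan i s := (tangent (G := G) i s).

(** Within half a period the chord determines the arc, because the other lifts of the
    parameter are further away. *)
Lemma chord_arc_half_period i : exists2 c : R, 0 < c <= 1 &
  forall s h, `|h| <= length_of i / 2 -> c * `|h| <= modulus (path i (s + h) - path i
    s).
Proof.
have L0 := length_gt0 HG i.
have [e e0 he] := chord_arc m2 HG.
have cL : 0 < e / (length_of i + e) by rewrite divr_gt0// addr_gt0.
exists (Num.min (2^-1) (e / (length_of i + e))).
  apply/andP; split; first by rewrite lt_min invr_gt0// ltr0n cL.
  have : Num.min 2^-1 (e / (length_of i + e)) <= 2^-1 by rewrite ge_min lexx.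
  lra.
move=> s h hL; have [hl|hl] := ltP (modulus (path i (s + h) - path i s)) e; last first.
  rewrite (le_trans _ hl)//.
  rewrite (le_trans (_ : _ <= e / (length_of i + e) * `|h|))//.
    by rewrite ler_wpM2r// ge_min lexx orbT.
  rewrite mulrAC ler_pdivrMr ?addr_gt0// ler_wpM2l ?(ltW e0)//; lra.
have [_ [k hk]] := he i i s (s + h) hl.
rewrite (addrAC s h) subrr add0r in hk.
have : `|h| <= `|h - k%:~R * length_of i|.
  have [->|k0] := eqVneq k 0; first by rewrite mul0r subr0.
  have k1 : 1 <= `|k%:~R : R|.
    by rewrite -intr_norm ler1z -gtz0_ge1 normr_gt0.
  have : length_of i <= `|k%:~R * length_of i|.
    by rewrite normrM (gtr0_norm L0) ler_peMl// ltW.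
  have := lerB_normD (k%:~R * length_of i) (- h).
  by rewrite normrN distrC; lra.
have c2 : Num.min 2^-1 (e / (length_of i + e)) * `|h| <= 2^-1 * `|h|.
  by rewrite ler_wpM2r// ge_min lexx.
lra.
Qed.

Lemma is_derive_powRN (a x c : R) : 0 < c - x ->
  is_derive x 1 (fun y => (c - y) `^ a) (- (a * (c - x) `^ (a - 1))).
Proof.
move=> xc.
have h1 := @is_derive_powR R a (- x) c; rewrite addrC in h1; have {}h1 := h1 xc.
have h : is_derive x 1 (fun y : R => - y) (-1) by exact: is_deriveN.
have := @is_derive1_comp R (fun y => (y + c) `^ a) -%R x _ _ h1 h.
rewrite mulrN1 (_ : _ \o _ = fun y => (c - y) `^ a)//.
by apply/funext => y /=; rewrite addrC.
Qed.

Lemma pole_neq0 i d w s : 0 < d -> off_curve G d w -> path i s - w != 0.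
Proof. by move=> d0 h; apply: (off_curve_neq0 d0 h); exists i, s. Qed.

Lemma pole_cont i d w n : 0 < d -> off_curve G d w -> ccont (fun s =>
  (path i s - w) ^- n).
Proof.
move=> d0 h; apply: ccontV.
  by apply: ccontX; apply: ccontB; [exact: (path_cont m2 HG)|exact: ccont_cst].
by move=> s; rewrite expf_neq0// (pole_neq0 i s d0 h).
Qed.

Lemma pole_cderiv i d w n : 0 < d -> off_curve G d w ->
  cderiv (fun s => (path i s - w) ^- n) (fun s => - n%:R * (path i s - w) ^- n.+1 *
    tan i s).
Proof.
move=> d0 h s; have p0 := pole_neq0 i s d0 h.
have h1 := cderiv_atB (tangentP m2 HG i s) (cderiv_at_cst w s).
have h2 := cderiv_atV (f := fun s => (path i s - w) ^+ n) (expf_neq0 n p0)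
  (cderiv_atXn n h1).
apply: (cderiv_at_eq h2); rewrite subr0.
case: n {h2} => [|n]; first by rewrite !mul0r oppr0 !mul0r.
by rewrite /= !exprS; field; rewrite p0 expf_neq0.
Qed.

(** A double pole integrates to zero over a closed curve, so the value of the density at
    the nearest point may be subtracted; Hoelder continuity then gains the factor
    [`|s - s0| `^ alpha]. *)
Lemma double_pole_bound i : exists2 C, 0 <= C & forall u M w d,
  (forall s, u (s + length_of i) = u s) -> holder_bounded alpha 0 u M ->
  0 < d -> off_curve G d w ->
  modulus (Cintegral 0 (length_of i) (fun s => u s / (path i s - w) ^+ 2 * tan i s)) <=
    C * M * d `^ (alpha - 1).
Proof.
have [a0 a1] := andP alpha01; have a1' : 0 < 1 - alpha by lra.
have [c /andP[c0 c1] hc] := chord_arc_half_period i.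
have L0 := length_gt0 HG i; set L := length_of i in L0 hc *.
pose C := (c / 4) ^- 2 / (1 - alpha).
have C0 : 0 <= C by rewrite divr_ge0 ?invr_ge0 ?exprn_ge0 ?divr_ge0 ?ltW.
exists (2 * C) => [|u M w d per hu d0 hw]; first by rewrite mulr_ge0.
have M0 := holder_bounded_ge0 hu; have [u1 u2 u3 _] := hu.
pose J s := path i s - w.
have cJ : ccont J by apply: ccontB; [exact: (path_cont m2 HG)|exact: ccont_cst].
have [|s0 _ hs0] := @EVT_min R (fun s => modulus (J s)) 0 L (ltW L0).
  by apply: continuous_subspaceT; exact: continuous_modulus.
have {}hs0 s : modulus (J s0) <= modulus (J s).
  have [s1 /andP[h1 h2] E] := path_reduce HG i s.
  by rewrite {2}/J E; apply: hs0; rewrite in_itv/= h1 ltW.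
have Jlow s : `|s - s0| <= L / 2 -> c / 4 * (`|s - s0| + d) <= modulus (J s).
  move=> hs; have := hc s0 (s - s0) hs; rewrite (addrC s0) subrK => h1.
  have h2 : d <= modulus (J s) by apply: hw; exists i, s.
  have h3 := modulus_trans w (path i s) (path i s0).
  have := hs0 s; rewrite {1}/J modulusC => h4.
  have cd : c * d <= d by rewrite ler_piMl// ltW.
  rewrite -/(J s) in h3; have := modulus_ge0 (J s); lra.
(* The nearest point is also comparable to the pole: |J s| >= c / 4 * (|s - s0| + d). *)
pose f1 s := (u s - u s0) / J s ^+ 2 * tan i s.
pose f0 s := J s ^- 2 * tan i s.
have cJ2 : ccont (fun s => J s ^- 2) by exact: (pole_cont i 2 d0 hw).
have ct := tangent_cont m2 HG i.
have cf0 : ccont f0 by apply: ccontM.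
have cf1 : ccont f1.
  by apply: ccontM => //; apply: ccontM => //; apply: ccontB => //; exact: ccont_cst.
have JL : J (s0 + L) = J s0 by rewrite /J (path_periodic HG).
have f00 : Cintegral 0 L f0 = 0.
  rewrite (@Cintegral_FTC R f0 (fun s => - J s ^- 1) 0 L L0 cf0) /J.
    by rewrite -[L]add0r (path_periodic HG) subrr.
  move=> s _; apply: (cderiv_at_eq (cderiv_atN (pole_cderiv i 1 d0 hw s))).
  by rewrite mulN1r mulNr opprK.
have -> : Cintegral 0 L (fun s => u s / (path i s - w) ^+ 2 * tan i s) = Cintegral 0
  L f1.
  have -> : (fun s => u s / (path i s - w) ^+ 2 * tan i s) = fun s =>
    f1 s + u s0 * f0 s.
    by apply/funext => s; rewrite /f1 /f0 -/(J s); ring.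
  by rewrite CintegralD ?CintegralZ// ?f00 ?mulr0 ?addr0//; apply: ccontM => //;
    exact: ccont_cst.
have f1per s : f1 (s + L) = f1 s.
  by rewrite /f1 /J per (path_periodic HG) (tangent_periodic m2 HG).
rewrite (Cintegral_period (s0 - L / 2) L0 f1per cf1).
have -> : s0 - L / 2 + L = s0 + L / 2 by lra.
have f1le s : `|s - s0| <= L / 2 -> modulus (f1 s) <=
    M * (c / 4) ^- 2 * (`|s - s0| + d) `^ (alpha - 2).
  move=> hs; have J1 := Jlow s hs.
  have x0 : 0 < `|s - s0| + d by rewrite ltr_wpDl.
  have cx0 : 0 < c / 4 * (`|s - s0| + d) by rewrite mulr_gt0// divr_gt0.
  rewrite /f1 modulusM (tangent1 HG) mulr1 modulusM modulusV modulusX.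
  have -> : M * (c / 4) ^- 2 * (`|s - s0| + d) `^ (alpha - 2) =
     (M * (`|s - s0| + d) `^ alpha) * (c / 4 * (`|s - s0| + d)) ^- 2.
    rewrite powRD; last by rewrite (gt_eqF x0) implybT.
    rewrite powR_invn ?(ltW x0)//.
    have -> : (c / 4 * (`|s - s0| + d)) ^- 2 = (c / 4) ^- 2 * (`|s - s0| + d) ^- 2.
      by rewrite (exprMn 2 (c / 4)) invfM.
    by move: ((c / 4) ^- 2) ((_ + d) ^- 2) => A B; ring.
  apply: ler_pM; rewrite ?modulus_ge0 ?invr_ge0 ?exprn_ge0 ?modulus_ge0//.
    rewrite (le_trans (u3 s s0))// ler_wpM2l// ge0_ler_powR ?(ltW a0)// ?nnegrE ?(ltW
      x0)//.
    by rewrite lerDl ltW.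
  by rewrite lef_pV2 ?posrE ?exprn_gt0// ?(lt_le_trans cx0)// lerXn2r ?nnegrE
    ?modulus_ge0 ?(ltW cx0).
have [F dF] := antiderivative (s0 - L / 2 - 1) cf1.
have dF' s : s0 - L / 2 <= s -> cderiv_at F s (f1 s) by move=> h; apply: dF; lra.
rewrite (@Cintegral_FTC R f1 F (s0 - L / 2) (s0 + L / 2) _ cf1); [|lra|].
  2: by move=> s /andP[h _]; exact: dF'.
have K0 : 0 <= M * C by rewrite mulr_ge0.
have right : modulus (F (s0 + L / 2) - F s0) <= M * C * d `^ (alpha - 1).
  have := @mean_value R F f1 (fun s => - (M * C) * (s + (d - s0)) `^ (alpha - 1))
    (fun s => M * (c / 4) ^- 2 * (s + (d - s0)) `^ (alpha - 2)) s0 (s0 + L / 2).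
  have -> : s0 <= s0 + L / 2 by lra.
  rewrite [s0 + (d - s0)]addrC subrK => h.
  apply: (le_trans (h isT _ _ _)).
  - by move=> s hs; apply: dF'; lra.
  - move=> s hs; have s1 : 0 < s + (d - s0) by lra.
    apply: (is_derive_eqr (is_deriveZ _ (is_derive_powR (alpha - 1) s1))).
    rewrite /GRing.scale /= (_ : alpha - 1 - 1 = alpha - 2); last by lra.
    by rewrite /C; field; rewrite ?gt_eqF//; apply/andP; split; lra.
  - move=> s hs; have := f1le s; rewrite ger0_norm; last by lra.
    rewrite (_ : s - s0 + d = s + (d - s0)); last by ring.
    by apply; lra.
  by rewrite !mulNr opprK addrC gerBl mulr_ge0// powR_ge0.
have left : modulus (F s0 - F (s0 - L / 2)) <= M * C * d `^ (alpha - 1).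
  have := @mean_value R F f1 (fun s => (M * C) * (s0 + d - s) `^ (alpha - 1))
    (fun s => M * (c / 4) ^- 2 * (s0 + d - s) `^ (alpha - 2)) (s0 - L / 2) s0.
  have -> : s0 - L / 2 <= s0 by lra.
  rewrite [s0 + d - s0](_ : _ = d); last by lra.
  move=> h; apply: (le_trans (h isT _ _ _)).
  - by move=> s hs; apply: dF'; lra.
  - move=> s hs; have s1 : 0 < s0 + d - s by lra.
    apply: (is_derive_eqr (is_deriveZ _ (is_derive_powRN (alpha - 1) s1))).
    rewrite /GRing.scale /= (_ : alpha - 1 - 1 = alpha - 2); last by lra.
    by rewrite /C; field; rewrite ?gt_eqF//; apply/andP; split; lra.
  - move=> s hs; have := f1le s; rewrite ler0_norm; last by lra.
    rewrite (_ : - (s - s0) + d = s0 + d - s); last by ring.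
    by apply; lra.
  by rewrite gerBl mulr_ge0// powR_ge0.
have -> : F (s0 + L / 2) - F (s0 - L / 2) = (F (s0 + L / 2) - F s0) + (F s0 - F (s0 -
  L / 2)) by ring.
by rewrite (le_trans (modulusD _ _))//; lra.
Qed.

End BaseEstimate.

Section CauchyBaseEstimate.
Context {R : realType} (m : nat) (U : set (Cplx R)) (G : curves R) (alpha : R).
Hypothesis m2 : (2 <= m)%N.
Hypothesis HG : positive_Cm_boundary m U G.
Hypothesis alpha01 : 0 < alpha < 1.
Implicit Types (i : 'I_(ncomp G)).
Local Notation path i s := (path_of (c := G) i s).
Local Notation tan i s := (tangent (G := G) i s).

Lemma tangent_holder_bounded i k : (k.+2 <= m)%N ->
  exists M, holder_bounded alpha k (fun s => conjc (tan i s)) M.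
Proof.
move=> km.
have [||||M hM] := @periodic_holder_bounded R alpha alpha01 k (fun j : nat =>
  cderive1n j.+1 (path_of i)) (length_of i).
- exact: (length_gt0 HG).
- exact: (tangent_periodic m2 HG).
- by move=> j jk; apply: (Cm_cderiv (path_Cm HG i)); exact: leq_trans km.
- exact: (Cm_ccont (path_Cm HG i) km).
by exists M; exact: holder_bounded_conj hM.
Qed.

(** Since the tangent has modulus one, [u' * conjc tan] is the derivative of [u] with
    respect to the complex variable of the curve. *)
Lemma integration_by_parts i u u' w d k : 0 < d -> off_curve G d w ->
  (forall s, u (s + length_of i) = u s) -> cderiv u u' -> ccont u' ->
  k.+1%:R * Cintegral 0 (length_of i) (fun s => u s / (path i s - w) ^+ k.+2 * tan i
    s) =
  Cintegral 0 (length_of i) (fun s => u' s * conjc (tan i s) / (path i s - w) ^+ k.+1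
    * tan i s).
Proof.
move=> d0 hw per du cu'.
have cu := cderiv_cont du; have ct := tangent_cont m2 HG i.
have cp n := pole_cont m2 HG i n d0 hw.
have L0 := length_gt0 HG i.
pose f s := u s / (path i s - w) ^+ k.+2 * tan i s.
pose g s := u' s * conjc (tan i s) / (path i s - w) ^+ k.+1 * tan i s.
pose h s := u' s * (path i s - w) ^- k.+1 + - k.+1%:R * f s.
have cf : ccont f by apply: ccontM => //; apply: ccontM.
have gE : g = fun s => u' s * (path i s - w) ^- k.+1.
  apply/funext => s; rewrite /g mulrAC -[_ * tan i s]mulrA [conjc _ * _]mulrC.
  by rewrite mulc_conj (tangent1 HG) expr1n mulr1.
have cg : ccont g by rewrite gE; apply: ccontM.
have hE : Cintegral 0 (length_of i) h = 0.
  have ch : ccont h.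
    by apply: ccontD; apply: ccontM => //; exact: ccont_cst.
  rewrite (@Cintegral_FTC R h (fun s => u s * (path i s - w) ^- k.+1) 0 _ L0 ch).
    by rewrite -[length_of i]add0r per (path_periodic HG) subrr.
  move=> s _; apply: (cderiv_at_eq (cderiv_atM (du s) (pole_cderiv m2 HG i k.+1 d0 hw
    s))).
  by rewrite /h /f; ring.
have hgf : h = fun s => g s + - k.+1%:R * f s by rewrite gE.
move: hE; rewrite hgf CintegralD ?CintegralZ//; last by apply: ccontM => //;
  exact: ccont_cst.
by move=> /eqP; rewrite mulNr subr_eq0 => /eqP.
Qed.

Lemma higher_pole_bound i k : (k < m)%N -> exists2 C, 0 <= C & forall u M w d,
  (forall s, u (s + length_of i) = u s) -> holder_bounded alpha k u M ->
  0 < d -> off_curve G d w ->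
  modulus (Cintegral 0 (length_of i) (fun s => u s / (path i s - w) ^+ k.+2 * tan i
    s)) <=
    C * M * d `^ (alpha - 1).
Proof.
elim: k => [_|k IH km]; first exact: (double_pole_bound m2 HG alpha01).
have [C C0 hC] := IH (ltnW km).
have [A hA] := tangent_holder_bounded i km.
have A0 := holder_bounded_ge0 hA.
exists (C * (2 ^+ k.+1 * A)) => [|u M w d per hu d0 hw].
  by rewrite !mulr_ge0// exprn_ge0.
have M0 := holder_bounded_ge0 hu.
case: (hu) => _ _ _ [u' du hu'].
have [cu' _ _] := holder_bounded0 hu'.
pose v s := u' s * conjc (tan i s).
have hv : holder_bounded alpha k v (2 ^+ k.+1 * (M * A)) by exact: holder_boundedM.
have perv s : v (s + length_of i) = v s.
  by rewrite /v (tangent_periodic m2 HG) (cderiv_periodic du per).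
have := hC v _ w d perv hv d0 hw.
rewrite -(integration_by_parts k.+1 d0 hw per du cu') modulusM modulus_nat => h.
rewrite (_ : C * (2 ^+ k.+1 * A) * M = C * (2 ^+ k.+1 * (M * A))); last by ring.
by rewrite (le_trans _ h)// ler_peMl ?modulus_ge0// ler1n.
Qed.

(** Integration by parts lowers the order of the pole to two, at the cost of one
    derivative of the density for each order. *)
Lemma cauchy_pole_bound k : (k < m)%N -> exists2 C, 0 <= C & forall phi M w d,
  (forall i, holder_bounded alpha k (fun s => phi (path i s)) M) -> 0 <= M ->
  0 < d -> off_curve G d w ->
  modulus (cauchy_pole G phi k.+2 w) <= C * M * d `^ (alpha - 1).
Proof.
move=> km; have H i : exists C, 0 <= C /\ forall u M w d,
  (forall s, u (s + length_of i) = u s) -> holder_bounded alpha k u M ->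
  0 < d -> off_curve G d w ->
  modulus (Cintegral 0 (length_of i) (fun s => u s / (path i s - w) ^+ k.+2 * tan i
    s)) <=
    C * M * d `^ (alpha - 1).
  by have [C C0 hC] := higher_pole_bound i km; exists C.
have [C hC] := choice H.
exists (\sum_i C i) => [|phi M w d hphi M0 d0 hw].
  by apply: sumr_ge0 => i _; case: (hC i).
rewrite /cauchy_pole /contour_integral (le_trans (modulus_sum _ _ _))//.
rewrite !mulr_suml; apply: ler_sum => i _.
have [_ h] := hC i.
apply: (h (fun s => phi (path i s)) M w d) => // s.
by rewrite (path_periodic HG).
Qed.

End CauchyBaseEstimate.

(** * Separating the poles *)

Section SeparatePoles.
Context {R : realType} (m : nat) (U : set (Cplx R)) (G : curves R).
Hypothesis m2 : (2 <= m)%N.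
Hypothesis domU : bounded_domain U.
Hypothesis HG : positive_Cm_boundary m U G.
Local Notation path i s := (path_of (c := G) i s).
Local Notation tan i s := (tangent (G := G) i s).
Local Notation off_curve := (off_curve G).
Local Notation on_curve := (on_curve G).
Local Notation cauchy_pole := (cauchy_pole G).

Definition with_poles (A : seq R[i]) (phi : R[i] -> R[i]) (t : R[i]) :=
  phi t / \prod_(a <- A) (t - a).

Lemma with_poles_cons a A phi : with_poles (a :: A) phi = fun t =>
  with_poles A phi t / (t - a).
Proof.
apply/funext => t; by rewrite /with_poles big_cons invfM mulrCA mulrC.
Qed.

Lemma with_poles_cont A phi : (forall a, a \in A -> U a) -> curve_cont G phi ->
  curve_cont G (with_poles A phi).
Proof.
move=> AU cphi; elim: A AU => [|a A IH] AU.
  have -> : with_poles [::] phi = phi; last by [].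
  by apply/funext => t; rewrite /with_poles big_nil divr1.
have Ua : U a by apply: AU; rewrite mem_head.
have [d d0 da] := off_curve_in domU HG Ua.
rewrite with_poles_cons; apply: (cauchy_pole_cont m2 HG 1 _ d0 da).
by apply: IH => x xA; apply: AU; rewrite inE xA orbT.
Qed.

Lemma cauchy_pole_trivial psi M l d w : curve_cont G psi ->
  (forall t, on_curve t -> modulus (psi t) <= M) -> 0 < d -> off_curve d w ->
  modulus (cauchy_pole psi l w) <= M * d^-1 ^+ l * total_length G.
Proof.
move=> cpsi hM d0 hw; apply: (contour_bound m2 HG).
  exact: (cauchy_pole_cont m2 HG l cpsi d0 hw).
move=> t ot; rewrite modulusM -exprVn modulusX modulusV.
have h := hw t ot; have p0 : 0 < modulus (t - w) by exact: lt_le_trans h.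
apply: ler_pM; rewrite ?modulus_ge0 ?exprn_ge0 ?invr_ge0 ?modulus_ge0//;
  first exact: hM.
by rewrite lerXn2r ?nnegrE ?invr_ge0 ?modulus_ge0 ?(ltW d0)// lef_pV2.
Qed.

(** The integral is trivially bounded away from the curve, and its derivative is
    integrable along the normals. *)
Lemma cauchy_pole_bounded (b : R) l : 0 < b <= 1 -> exists2 C, 0 <= C & forall psi M B,
  curve_cont G psi -> (forall t, on_curve t -> modulus (psi t) <= M) -> 0 <= M ->
    0 <= B ->
  (forall x d, U x -> 0 < d -> off_curve d x -> modulus (cauchy_pole psi l.+1 x) <= B
    * d `^ (b - 1)) ->
  forall w, U w -> modulus (cauchy_pole psi l w) <= C * (B + M).
Proof.
move=> /andP[b0 b1]; have [r r0 hcone] := interior_cone m2 domU HG.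
pose C1 := (r / 4)^-1 ^+ l * total_length G.
have C10 : 0 <= C1.
  by rewrite mulr_ge0 ?(total_length_ge0 HG)// exprn_ge0// invr_ge0 divr_ge0// ltW.
pose C2 := 6 * l%:R / b * r `^ b.
have C20 : 0 <= C2 by rewrite mulr_ge0 ?powR_ge0// divr_ge0 ?mulr_ge0// ltW.
have r4 : 0 < r / 4 by rewrite divr_gt0.
exists (C1 + C2) => [|psi M B cpsi hM M0 B0 hB w Uw]; first exact: addr_ge0.
have triv x : off_curve (r / 4) x -> modulus (cauchy_pole psi l x) <= C1 * M.
  by move=> hx; rewrite mulrC /C1 mulrA; exact: cauchy_pole_trivial.
have C1B : 0 <= C1 * B by exact: mulr_ge0.
have C2B : 0 <= C2 * B by exact: mulr_ge0.
have C2M : 0 <= C2 * M by exact: mulr_ge0.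
have [hw|hw] := pselect (off_curve (r / 4) w); first by have := triv w hw; lra.
have {hw} [i [s ps]] : exists i s, modulus (path i s - w) < r / 4.
  apply: contrapT => nex; apply: hw => t [i [s ->]].
  by rewrite leNgt; apply/negP => h; apply: nex; exists i, s.
pose T := r / 2.
have cone u : 0 <= u <= T -> U (w + u%:C * ('i * tan i s)) /\ off_curve (u / 2) (w +
  u%:C * ('i * tan i s)).
  by rewrite /T => hu; apply: hcone => //; [rewrite modulusC; lra|lra].
have T0 : 0 <= T by rewrite /T; lra.
have TT : 0 <= T <= T by rewrite T0 lexx.
have [d d0 dw] := off_curve_in domU HG Uw.
have dr : d <= r / 4.
  by rewrite (le_trans _ (ltW ps))//; apply: dw; exists i, s.
have end_off : off_curve (r / 4) (w + T%:C * ('i * tan i s)).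
  by have [_] := cone T TT; apply: off_curveW; rewrite /T; lra.
have hleg : modulus (cauchy_pole psi l (w + T%:C * ('i * tan i s)) - cauchy_pole psi
  l w) <=
    6 * (l%:R * B) / b * (T + d) `^ b.
  apply: (normal_leg HG (f' := fun x => l%:R * cauchy_pole psi l.+1 x)) => //.
  - by rewrite b0.
  - by rewrite mulr_ge0.
  - by move=> u hu; have [] := cone u hu.
  - move=> u hu; have [Ux _] := cone u hu; have [e e0 he] := off_curve_in domU HG Ux.
    exact: (cauchy_pole_cdiff m2 HG _ cpsi e0 he).
  - move=> u e hu e0 he; have [Ux _] := cone u hu.
    by rewrite modulusM modulus_nat -mulrA ler_wpM2l//; exact: hB.
have hr : (T + d) `^ b <= r `^ b.
  by rewrite ge0_ler_powR ?(ltW b0)// ?nnegrE /T; lra.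
have hleg2 : 6 * (l%:R * B) / b * (T + d) `^ b <= C2 * B.
  rewrite (_ : C2 * B = 6 * (l%:R * B) / b * r `^ b); last by rewrite /C2; ring.
  by rewrite ler_wpM2l// divr_ge0 ?mulr_ge0// ltW.
have h1 := triv _ end_off; have h2 := le_trans hleg hleg2.
rewrite modulusC in h2; have h3 := le_trans (modulus_sub_ge _ _) h2.
rewrite lerBlDr in h3; rewrite (le_trans h3)// (le_trans (lerD (lexx _) h1))//.
by move: C1B C2M; clear; rewrite mulrDr !mulrDl => C1B C2M; lra.
Qed.

(** Splitting off one pole [z] of order one, and multiplying by the factor
    [(z - x) ^ l] that vanishes at [z], leaves a function of [x] whose
    derivative no longer has the pole [z]. *)
Lemma shifted_pole_cdiff psi l z x e d : curve_cont G psi ->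
  0 < e -> off_curve e z -> 0 < d -> off_curve d x ->
  cdiff (fun y => (z - y) ^+ l.+1 * cauchy_pole (fun t => psi t / (t - z)) l.+1 y) x
    (- l.+1%:R * (z - x) ^+ l * cauchy_pole psi l.+2 x).
Proof.
move=> cpsi e0 ez d0 dx.
have cz : curve_cont G (fun t => psi t / (t - z)).
  exact: (cauchy_pole_cont m2 HG 1 cpsi e0 ez).
have cp n f : curve_cont G f -> curve_cont G (fun t => f t / (t - x) ^+ n).
  by move=> cf; exact: (cauchy_pole_cont m2 HG n cf d0 dx).
apply: (cdiff_eq (cdiffM (cdiffX l.+1 (cdiff_cstB z x)) (cauchy_pole_cdiff m2 HG l.+1
  cz d0 dx))).
rewrite [l.+1.-1]/=.
have -> : cauchy_pole psi l.+2 x = cauchy_pole (fun t => psi t / (t - z)) l.+1 x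
    - (z - x) * cauchy_pole (fun t => psi t / (t - z)) l.+2 x.
  rewrite /cauchy_pole -(contourZ m2 HG)//; last exact: cp.
  rewrite -(contourB m2 HG); first last.
  - by apply: curve_contM; [exact: curve_cont_cst|exact: cp].
  - exact: cp.
  apply: eq_contour => t ot.
  have tz := off_curve_neq0 e0 ez ot; have tx := off_curve_neq0 d0 dx ot.
  by rewrite !exprS; field; rewrite tz tx expf_neq0.
by rewrite exprS; ring.
Qed.

(** The function of shifted_pole_cdiff vanishes at [z], and the Hardy-Littlewood
    inequality bounds its value at [w]. *)
Lemma near_pole_bound (b : R) l : 0 < b <= 1 -> exists C r : R, [/\ 0 <= C, 0 < r &
  forall psi z w B, curve_cont G psi -> U z -> U w -> modulus (z - w) <= r -> 0 <= B ->
  (forall x d, U x -> 0 < d -> off_curve d x -> modulus (cauchy_pole psi l.+2 x) <= B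
    * d `^ (b - 1)) ->
  modulus (z - w) ^+ l.+1 * modulus (cauchy_pole (fun t => psi t / (t - z)) l.+1 w) <=
    C * B * modulus (z - w) ^+ l * modulus (z - w) `^ b].
Proof.
move=> b01; have [C [r [C0 r0 hl]]] := hardy_littlewood m2 domU HG b01.
exists (C * (l.+1%:R * 5 ^+ l)), r; split => //.
  by rewrite !mulr_ge0// exprn_ge0.
move=> psi z w B cpsi Uz Uw zw B0 hB.
have [e e0 ez] := off_curve_in domU HG Uz.
pose H y := (z - y) ^+ l.+1 * cauchy_pole (fun t => psi t / (t - z)) l.+1 y.
have := hl z w (l.+1%:R * (5 * modulus (z - w)) ^+ l * B) H
  (fun x => - l.+1%:R * (z - x) ^+ l * cauchy_pole psi l.+2 x) Uz Uw zw.
have q0 := modulus_ge0 (z - w).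
have B'0 : 0 <= l.+1%:R * (5 * modulus (z - w)) ^+ l * B.
  by rewrite !mulr_ge0// exprn_ge0// mulr_ge0.
move=> /(_ B'0) h.
have Hzw : modulus (H z - H w) = modulus (z - w) ^+ l.+1 *
    modulus (cauchy_pole (fun t => psi t / (t - z)) l.+1 w).
  have Hz : H z = 0 by rewrite /H (subrr z) expr0n mul0r.
  by rewrite Hz sub0r modulusN modulusM modulusX.
rewrite -Hzw.
rewrite (_ : C * _ * B * _ * _ = C * (l.+1%:R * (5 * modulus (z - w)) ^+ l * B) *
  modulus (z - w) `^ b); last first.
  by rewrite (exprMn l); move: (modulus (z - w)) (l.+1%:R : R) (5 ^+ l : R) => q L F;
    ring.
apply: h => [x Ux _|x d Ux xz d0 dx].
  have [d d0 dx] := off_curve_in domU HG Ux.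
  exact: (shifted_pole_cdiff l cpsi e0 ez d0 dx).
rewrite !modulusM modulusN modulus_nat modulusX.
have hx := hB x d Ux d0 dx; rewrite -[leRHS]mulrA.
apply: ler_pM => //; rewrite ?modulus_ge0//.
  by rewrite mulr_ge0// exprn_ge0// modulus_ge0.
rewrite ler_wpM2l// lerXn2r ?nnegrE ?modulus_ge0 ?mulr_ge0//.
by rewrite modulusC.
Qed.

(** Partial fractions, for poles that are not close to each other. *)
Lemma pole_split psi l z w d e : curve_cont G psi -> 0 < e -> off_curve e z ->
  0 < d -> off_curve d w -> z != w ->
  cauchy_pole (fun t => psi t / (t - z)) l.+1 w =
  (z - w)^-1 * (cauchy_pole (fun t => psi t / (t - z)) l w - cauchy_pole psi l.+1 w).
Proof.
move=> cpsi e0 ez d0 dw zw.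
have cz : curve_cont G (fun t => psi t / (t - z)).
  exact: (cauchy_pole_cont m2 HG 1 cpsi e0 ez).
have cp n f : curve_cont G f -> curve_cont G (fun t => f t / (t - w) ^+ n).
  by move=> cf; exact: (cauchy_pole_cont m2 HG n cf d0 dw).
have zw0 : z - w != 0 by rewrite subr_eq0.
apply: (mulfI zw0); rewrite mulrA mulfV// mul1r /cauchy_pole -(contourZ m2 HG);
  last exact: cp.
rewrite -(contourB m2 HG); [|exact: cp|exact: cp].
apply: eq_contour => t ot.
have tz := off_curve_neq0 e0 ez ot; have tw := off_curve_neq0 d0 dw ot.
by rewrite !exprS; field; rewrite tz tw expf_neq0.
Qed.

End SeparatePoles.

(** * Estimates with several poles *)

Section PoleInduction.
Context {R : realType} (N : nat) (U : set (Cplx R)) (G : curves R) (alpha : R).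
Hypothesis N0 : (0 < N)%N.
Hypothesis domU : bounded_domain U.
Hypothesis HG : positive_Cm_boundary N.+1 U G.
Hypothesis alpha01 : 0 < alpha < 1.
Local Notation path i s := (path_of (c := G) i s).
Local Notation off_curve := (off_curve G).
Local Notation on_curve := (on_curve G).
Local Notation cauchy_pole := (cauchy_pole G).
Let m2 : (2 <= N.+1)%N. Proof. by []. Qed.

(** The regularity of the density that Cauchy integrals with [N] poles require. *)
Definition density_bounded (phi : R[i] -> R[i]) (M : R) :=
  (forall i, holder_bounded alpha N.-1 (fun s => phi (path i s)) M) /\ 0 <= M.

Lemma density_cont phi M : density_bounded phi M -> curve_cont G phi.
Proof. by move=> [h _] i; have [] := holder_bounded0 (h i). Qed.

Lemma density_le phi M t : density_bounded phi M -> on_curve t -> modulus (phi t) <= M.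
Proof. by move=> [h _] [i [s ->]]; have [_ + _] := holder_bounded0 (h i); exact. Qed.

(** Bounds for the Cauchy integrals with [q] simple poles in [U] and a pole of
    order [l]: uniform in the poles when [q + l <= N], and with a singularity
    at the boundary in the pole of order [l] when [q + l = N + 1]. *)
Definition pole_bound (q l : nat) := exists2 C, 0 <= C &
  forall phi M A w, density_bounded phi M -> size A = q -> (forall a, a \in A ->
    U a) -> U w ->
  modulus (cauchy_pole (with_poles A phi) l w) <= C * M.

Definition pole_growth (q l : nat) (b : R) := exists2 C, 0 <= C &
  forall phi M A w d, density_bounded phi M -> size A = q -> (forall a, a \in A ->
    U a) -> U w ->
  0 < d -> off_curve d w ->
  modulus (cauchy_pole (with_poles A phi) l w) <= C * M * d `^ (b - 1).

Lemma pole_bound_growth q l : pole_bound q l -> pole_growth q l 1.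
Proof.
move=> [C C0 h]; exists C => // phi M A w d hphi sA AU Uw d0 dw.
by rewrite subrr powRr0 mulr1; exact: h.
Qed.

Lemma with_poles_nil (phi : R[i] -> R[i]) : with_poles [::] phi = phi.
Proof. by apply/funext => t; rewrite /with_poles big_nil divr1. Qed.

(** Without simple poles this is the bound for one multiple pole. *)
Lemma pole_growth0 : pole_growth 0 N.+1 alpha.
Proof.
have [|C C0 h] := @cauchy_pole_bound R N.+1 U G alpha m2 HG alpha01 N.-1.
  by rewrite ltnS leq_pred.
exists C => // phi M A w d [hphi M0] /size0nil -> _ _ d0 dw.
by rewrite with_poles_nil; have := h phi M w d hphi M0 d0 dw; rewrite prednK.
Qed.

Lemma pole_bound0 l : (l <= N)%N -> pole_bound 0 l.
Proof.
have key b k : 0 < b <= 1 -> pole_growth 0 k.+1 b -> pole_bound 0 k.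
  move=> b01 [C C0 h]; have [D D0 hD] := cauchy_pole_bounded m2 domU HG k b01.
  exists (D * (C + 1)) => [|phi M A w hphi sA AU Uw];
    first by rewrite mulr_ge0// addr_ge0.
  have M0 := proj2 hphi.
  rewrite -mulrA mulrDl mul1r; apply: hD => //.
  - by apply: (with_poles_cont m2 domU HG) => //; exact: density_cont hphi.
  - move=> t; rewrite (size0nil sA) with_poles_nil; exact: density_le.
  - exact: mulr_ge0.
  - by move=> x d Ux d0 dx; exact: h.
move=> lN; rewrite -(subKn lN); move: (N - l)%N => p.
elim: p => [|p IH].
  by rewrite subn0; apply: (key alpha); [case/andP: alpha01 =>
    -> /ltW ->|exact: pole_growth0].
have [pN|Np] := ltnP p N; last first.
  by move: IH; rewrite subnS (_ : (N - p)%N = 0%N)//; apply/eqP; rewrite subn_eq0.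
apply: (key 1); first by rewrite ltr01 lexx.
by apply: pole_bound_growth; rewrite subnSK.
Qed.

Lemma growth_const : exists2 D, 0 <= D & forall w d, U w -> 0 < d -> off_curve d w ->
  1 <= D * d `^ (alpha - 1).
Proof.
have [a0 a1] := andP alpha01; have [D D0 hD] := off_curve_bounded domU HG.
exists (D `^ (1 - alpha)) => [|w d Uw d0 dw]; first exact: powR_ge0.
have dD := hD w d Uw dw.
have X0 : d `^ (1 - alpha) != 0 by rewrite gt_eqF// powR_gt0.
rewrite -(opprB 1 alpha) powRN -[leLHS](mulfV X0).
rewrite ler_wpM2r ?invr_ge0 ?powR_ge0//.
by apply: ge0_ler_powR => //; rewrite ?nnegrE; lra.
Qed.

Section Step.
Variable q : nat.
Hypothesis qN : (q < N)%N.
Hypothesis IHb : forall l, (0 < l)%N -> (q + l <= N)%N -> pole_bound q l.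
Hypothesis IHg : forall l, (1 < l)%N -> (q + l = N.+1)%N -> pole_growth q l alpha.

Lemma far_pole_bound r l : 0 < r -> (q + l <= N)%N -> exists2 C, 0 <= C &
  forall phi M A z w, density_bounded phi M -> size A = q -> (forall a, a \in A ->
    U a) ->
  U z -> U w -> r <= modulus (z - w) ->
  modulus (cauchy_pole (with_poles (z :: A) phi) l w) <= C * M.
Proof.
move=> r0; elim: l => [_|l IH lN].
  have [|C C0 h] := IHb (ltn0Sn 0); first by rewrite addn1.
  exists C => // phi M A z w hphi sA AU Uz _ _; rewrite with_poles_cons.
  have -> : cauchy_pole (fun t => with_poles A phi t / (t - z)) 0 w = cauchy_pole
    (with_poles A phi) 1 z.
    by apply: eq_contour => t _; rewrite expr0 expr1 divr1.
  exact: h.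
have [|C C0 hC] := IH; first by apply: leq_trans lN; rewrite leq_add2l.
have [D D0 hD] := IHb (ltn0Sn l) lN.
exists (r^-1 * (C + D)) => [|phi M A z w hphi sA AU Uz Uw zw].
  by rewrite mulr_ge0 ?addr_ge0// invr_ge0 ltW.
have [e e0 ez] := off_curve_in domU HG Uz.
have [d d0 dw] := off_curve_in domU HG Uw.
have zw0 : z != w by rewrite -subr_eq0 -modulus_gt0 (lt_le_trans r0).
have cA : curve_cont G (with_poles A phi).
  by apply: (with_poles_cont m2 domU HG) => //; exact: density_cont hphi.
rewrite with_poles_cons (pole_split m2 HG l cA e0 ez d0 dw zw0) modulusM modulusV.
have h1 := hC phi M A z w hphi sA AU Uz Uw zw; rewrite with_poles_cons in h1.
have h2 := hD phi M A w hphi sA AU Uw.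
rewrite -mulrA; apply: ler_pM; rewrite ?invr_ge0 ?modulus_ge0//.
  by rewrite lef_pV2 ?posrE// (lt_le_trans r0).
by rewrite (le_trans (modulusB _ _))// mulrDl lerD.
Qed.

(** A further simple pole [z] is split off by partial fractions if it is far from [w], and
    by the Hardy-Littlewood inequality if it is close to [w]. *)
Lemma pole_bound_step l : (0 < l)%N -> (q.+1 + l <= N)%N -> pole_bound q.+1 l.
Proof.
case: l => // l _ lN.
have qlN : (q + l.+2 <= N)%N by rewrite addnS -addSn.
have [C C0 hC] := IHb (ltn0Sn l.+1) qlN.
have [|K [r [K0 r0 hK]]] := near_pole_bound m2 domU HG (b := 1) l.
  by rewrite ltr01 lexx.
have qlN1 : (q + l.+1 <= N)%N by apply: leq_trans qlN; rewrite leq_add2l.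
have [D D0 hD] := far_pole_bound r0 qlN1.
exists (K * C + D + C) => [|phi M [|z A] w hphi //= [sA] AU Uw].
  by rewrite !addr_ge0// mulr_ge0.
have M0 := proj2 hphi.
have Uz : U z by apply: AU; rewrite mem_head.
have {}AU a : a \in A -> U a by move=> aA; apply: AU; rewrite inE aA orbT.
have KCM : 0 <= K * C * M by rewrite !mulr_ge0.
have DM : 0 <= D * M by rewrite mulr_ge0.
have CM : 0 <= C * M by rewrite mulr_ge0.
have [zr|rz] := leP (modulus (z - w)) r; last first.
  by have := hD phi M A z w hphi sA AU Uz Uw (ltW rz); lra.
have cA : curve_cont G (with_poles A phi).
  by apply: (with_poles_cont m2 domU HG) => //; exact: density_cont hphi.
rewrite with_poles_cons; have [zw|zw] := eqVneq z w.
  have := hC phi M A w hphi sA AU Uw; rewrite zw.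
  have -> : cauchy_pole (fun t => with_poles A phi t / (t - w)) l.+1 w = cauchy_pole
    (with_poles A phi) l.+2 w.
    by apply: eq_contour => t _; rewrite (exprS _ l.+1) invfM mulrA.
  by lra.
have p0 : 0 < modulus (z - w) by rewrite modulus_gt0 subr_eq0.
have := hK (with_poles A phi) z w (C * M) cA Uz Uw zr CM.
rewrite powRr1 ?modulus_ge0// -mulrA -exprSr => h.
have : modulus (z - w) ^+ l.+1 * modulus (cauchy_pole (fun t =>
  with_poles A phi t / (t - z)) l.+1 w)
    <= K * (C * M) * modulus (z - w) ^+ l.+1.
  apply: h => x d Ux d0 dx; rewrite subrr powRr0 mulr1; exact: hC.
by rewrite mulrC ler_pM2r ?exprn_gt0//; lra.
Qed.

(** For [z] close to [w], the Hardy-Littlewood inequality gives a bound by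
    [modulus (z - w) `^ (alpha - 1)], which suffices unless [z] is much closer to [w] than
    the curve is; in that case the mean value inequality on the segment does. *)
Lemma pole_growth_step l : (1 < l)%N -> (q.+1 + l = N.+1)%N -> pole_growth q.+1 l alpha.
Proof.
have [a0 a1] := andP alpha01.
case: l => // l l0 lN.
have qlN : (q + l.+2 = N.+1)%N by rewrite addnS -addSn.
have qlN1 : (q + l.+1 <= N)%N by rewrite -ltnS -addnS qlN.
have [C C0 hC] := IHg (isT : (1 < l.+2)%N) qlN.
have [|K [r [K0 r0 hK]]] := near_pole_bound m2 domU HG (b := alpha) l.
  by rewrite a0 ltW.
have [D D0 hD] := far_pole_bound r0 qlN1.
have [E E0 hE] := growth_const.
pose F := (2^-1 : R) `^ (alpha - 1).
have F0 : 0 <= F by exact: powR_ge0.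
exists (K * C * F + D * E + C + l.+1%:R * C * F) => [|phi M [|z A] w d hphi //= [sA]
  AU Uw d0 dw].
  by rewrite !addr_ge0// !mulr_ge0.
have M0 := proj2 hphi.
have Uz : U z by apply: AU; rewrite mem_head.
have {}AU a : a \in A -> U a by move=> aA; apply: AU; rewrite inE aA orbT.
pose X := d `^ (alpha - 1).
have X0 : 0 <= X by exact: powR_ge0.
have t1 : 0 <= K * C * F * M * X by rewrite !mulr_ge0.
have t2 : 0 <= D * E * M * X by rewrite !mulr_ge0.
have t3 : 0 <= C * M * X by rewrite !mulr_ge0.
have t4 : 0 <= l.+1%:R * C * F * M * X by rewrite !mulr_ge0.
rewrite -/X.
suff : modulus (cauchy_pole (with_poles (z :: A) phi) l.+1 w) <=
    Num.max (K * C * F * M * X) (Num.max (D * E * M * X) (Num.max (C * M * X)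
      (l.+1%:R * C * F * M * X))).
  by rewrite !le_max => /or4P[] h; lra.
rewrite !le_max; apply/or4P.
have [zr|rz] := leP (modulus (z - w)) r; last first.
  have h := hD phi M A z w hphi sA AU Uz Uw (ltW rz).
  constructor 2; rewrite (le_trans h)// -mulrA (mulrC M) mulrA -mulrA.
  have := hE w d Uw d0 dw; rewrite -/X => h1.
  have : 0 <= D * M * (E * X - 1) by rewrite !mulr_ge0// subr_ge0.
  by lra.
have cA : curve_cont G (with_poles A phi).
  by apply: (with_poles_cont m2 domU HG) => //; exact: density_cont hphi.
have fd : (d / 2) `^ (alpha - 1) = F * X by rewrite mulrC powRM ?invr_ge0// ltW.
have CM : 0 <= C * M by rewrite mulr_ge0.
rewrite with_poles_cons; have [zw|zw] := eqVneq z w.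
  constructor 3; have := hC phi M A w d hphi sA AU Uw d0 dw; rewrite zw.
  have -> // : cauchy_pole (fun t => with_poles A phi t / (t - w)) l.+1 w =
    cauchy_pole (with_poles A phi) l.+2 w.
  by apply: eq_contour => t _; rewrite (exprS _ l.+1) invfM mulrA.
have p0 : 0 < modulus (z - w) by rewrite modulus_gt0 subr_eq0.
have [dle|ltd] := leP (d / 2) (modulus (z - w)).
  constructor 1.
  have h : modulus (z - w) ^+ l.+1 * modulus (cauchy_pole (fun t =>
    with_poles A phi t / (t - z)) l.+1 w)
    <= K * (C * M) * modulus (z - w) ^+ l * modulus (z - w) `^ alpha.
    by apply: hK => // x e Ux e0 ex; exact: hC.
  have pE : modulus (z - w) `^ alpha = modulus (z - w) * modulus (z - w) `^ (alpha - 1).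
    by rewrite mulr_powRB1// ?modulus_ge0.
  rewrite pE mulrA -(mulrA (K * _)) -exprSr mulrAC mulrC ler_pM2r ?exprn_gt0// in h.
  rewrite (le_trans h)// (_ : K * C * F * M * X = K * (C * M) * (F * X)); last by ring.
  rewrite -fd ler_wpM2l ?mulr_ge0//; apply: powR_antitone => //; first by lra.
  by rewrite divr_gt0.
constructor 4.
have [e e0 ez] := off_curve_in domU HG Uz.
pose H y := (z - y) ^+ l.+1 * cauchy_pole (fun t => with_poles A phi t / (t - z))
  l.+1 y.
have d20 : 0 < d / 2 by rewrite divr_gt0.
have dw2 u : 0 <= u <= 1 -> off_curve (d / 2) (w + u%:C * (z - w)).
  move=> /andP[u0 u1]; apply: (@off_curveW R G (d - modulus (w - (w + u%:C * (z -
    w))))); last exact: off_curve_dist.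
  rewrite modulusC addrAC subrr add0r modulusM modulus_real ger0_norm//; nra.
have inU u : 0 <= u <= 1 -> U (w + u%:C * (z - w)).
  move=> /andP[u0 u1]; apply: (segment_in domU HG) => // x /andP[x0 xu] oc.
  have := dw2 x; rewrite x0 (le_trans xu) // => /(_ isT _ oc).
  by rewrite subrr modulus0 leNgt d20.
have := @mean_value_segment R H (fun x => - l.+1%:R * (z - x) ^+ l * cauchy_pole
  (with_poles A phi) l.+2 x)
  (l.+1%:R * modulus (z - w) ^+ l * (C * M * (F * X))) w z.
have Hzw : modulus (H z - H w) = modulus (z - w) ^+ l.+1 *
    modulus (cauchy_pole (fun t => with_poles A phi t / (t - z)) l.+1 w).
  have Hz : H z = 0 by rewrite /H (subrr z) expr0n mul0r.
  by rewrite Hz sub0r modulusN modulusM modulusX.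
rewrite Hzw => h.
have {}h := h (fun u hu => shifted_pole_cdiff m2 HG l cA e0 ez d20 (dw2 u hu)).
have : modulus (z - w) ^+ l.+1 * modulus (cauchy_pole (fun t =>
  with_poles A phi t / (t - z)) l.+1 w)
  <= l.+1%:R * modulus (z - w) ^+ l * (C * M * (F * X)) * modulus (z - w).
  apply: h => u hu; rewrite !modulusM modulusN modulus_nat modulusX.
  apply: ler_pM; rewrite ?modulus_ge0//.
  - by rewrite mulr_ge0// exprn_ge0// modulus_ge0.
  - rewrite ler_wpM2l// lerXn2r ?nnegrE ?modulus_ge0//.
    rewrite (_ : z - (w + u%:C * (z - w)) = (1 - u)%:C * (z - w)); last first.
      by rewrite rmorphB rmorph1; ring.
    case/andP: hu => u0 u1; rewrite modulusM modulus_real ger0_norm ?subr_ge0//.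
    by rewrite ler_piMl ?modulus_ge0//; lra.
  - by rewrite -fd; apply: hC => //; [exact: inU|exact: dw2].
rewrite (_ : l.+1%:R * _ * _ * _ = modulus (z - w) ^+ l.+1 * (l.+1%:R * C * F * M * X)).
  by rewrite ler_pM2l ?exprn_gt0.
by rewrite (exprS _ l); ring.
Qed.

End Step.

Lemma pole_bounds q : (q < N)%N ->
  (forall l, (0 < l)%N -> (q + l <= N)%N -> pole_bound q l) /\
  (forall l, (1 < l)%N -> (q + l = N.+1)%N -> pole_growth q l alpha).
Proof.
elim: q => [_|q IH qN].
  split=> [l _|l _]; rewrite add0n; first exact: pole_bound0.
  by move=> ->; exact: pole_growth0.
have [IHb IHg] := IH (ltnW qN).
split; [exact: pole_bound_step (ltnW qN) IHb|exact: pole_growth_step (ltnW qN) IHb IHg].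
Qed.

End PoleInduction.

(** * Partial derivatives of the transform *)

Section PartialDerivatives.
Context {R : realType} (m n : nat) (U : set (Cplx R)) (G : curves R).
Hypothesis m2 : (2 <= m)%N.
Hypothesis domU : bounded_domain U.
Hypothesis HG : positive_Cm_boundary m U G.
Local Notation C := (Cplx R).
Local Notation Un := (@power_domain R n U).
Implicit Types (z : 'rV[C]_n) (e : 'I_n -> nat) (phi : R[i] -> R[i]).

Definition multi_pole phi e z : R[i] :=
  contour_integral G (fun t => phi t / \prod_(j < n) (t - z 0 j) ^+ (e j).+1).

Lemma poles_seq (s : seq 'I_n) z e : Un z -> exists A : seq R[i],
  [/\ size A = (\sum_(j <- s) (e j).+1)%N, forall a, a \in A -> U a &
  forall t : R[i], \prod_(a <- A) (t - a) = \prod_(j <- s) (t - z 0 j) ^+ (e j).+1].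
Proof.
move=> Uz; elim: s => [|j s [A [sA AU AE]]].
  by exists [::]; split => //; [rewrite big_nil|move=> t; rewrite !big_nil].
exists (nseq (e j).+1 (z 0 j) ++ A); split.
- by rewrite size_cat size_nseq sA big_cons.
- by move=> a; rewrite mem_cat => /orP[|/AU//]; rewrite mem_nseq => /andP[_ /eqP ->];
  exact: Uz.
- by move=> t; rewrite big_cat big_cons AE big_nseq -Monoid.iteropE.
Qed.

(** Isolating one variable turns the kernel into a Cauchy integral with simple
    poles, repeated according to the other exponents, and one multiple pole. *)
Lemma multi_pole_split j z e : Un z -> exists A : seq R[i],
  [/\ size A = (\sum_(i | i != j) (e i).+1)%N, forall a, a \in A -> U a &
  forall phi e' z', (forall i, i != j -> e' i = e i /\ z' 0 i = z 0 i) ->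
    multi_pole phi e' z' = cauchy_pole G (with_poles A phi) (e' j).+1 (z' 0 j)].
Proof.
move=> Uz; have [A [sA AU AE]] := poles_seq [seq i <- index_enum 'I_n | i != j] e Uz.
exists A; split => //; first by rewrite sA big_filter.
move=> phi e' z' same; apply: eq_contour => t _.
rewrite /with_poles AE big_filter (bigD1 j)//= invfM -mulrA; congr (_ * _).
rewrite [RHS]mulrC; congr (_ * _^-1).
by apply: eq_bigr => i ij; have [-> ->] := same i ij.
Qed.

Lemma power_domain_move j z (h d : R[i]) : Un z -> (forall y,
  modulus (y - z 0 j) < modulus d -> U y) ->
  modulus h < modulus d -> Un (z + h *: delta_mx 0 j).
Proof.
move=> Uz hd hh i; rewrite !mxE eqxx /=; have [->|ij] := eqVneq i j.
  by rewrite mulr1; apply: hd; rewrite addrAC subrr add0r.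
by rewrite mulr0 addr0; exact: Uz.
Qed.

Lemma cdiff_derive (F : 'rV[C]_n -> C) (f : R[i] -> R[i]) z (v : 'rV[C]_n) x l r :
  0 < r ->
  cdiff f x l -> (forall h, modulus h < r -> F (z + h *: v) = f (x + h)) ->
  'D_v F z = l.
Proof.
move=> r0 [D [q [D0 q0 /(_ tt I) [_ _ hf]]]] Ff.
apply: cvg_lim => //; apply/cvgrPdist_le => e e0.
have eE : e = (complex.Re e)%:C by rewrite RRe_real// ger0_real// ltW.
have Re0 : 0 < complex.Re e by move: e0; rewrite {1}eE ltcR.
have D1 : 0 < D + 1 by rewrite ltr_wpDl.
pose d := Num.min (r / 2) (Num.min q (complex.Re e / (D + 1))).
have d0 : 0 < d by rewrite !lt_min q0 !divr_gt0.
have dC : 0 < d%:C :> R[i] by rewrite ltcR.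
near=> h.
have h0 : h != 0 by near: h; exact: nbhs_dnbhs_neq.
have : `|h| <= d%:C by near: h; exact: dnbhs0_le.
rewrite normcE lecR !le_min => /and3P[hr hq he].
have hr' : modulus h < r by lra.
rewrite /= [h *: v + z]addrC Ff// eE normcE lecR.
have -> : F z = f (x + 0).
  by rewrite -Ff ?modulus0// scale0r addr0.
have {}hf := hf h hq.
have -> : l - h^-1 *: (f (x + h) - f (x + 0)) = - (h^-1 * (f (x + h) - f (x + 0) - h
  * l)).
  by rewrite /GRing.scale /=; field.
rewrite modulusN modulusM modulusV ler_pdivrMl ?modulus_gt0// (le_trans hf)//.
rewrite expr2 mulrA mulrC ler_wpM2l ?modulus_ge0//.
rewrite (le_trans (ler_wpM2l D0 he))// mulrCA ler_piMr ?(ltW Re0)//.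
by rewrite ler_pdivrMr// mul1r lerDl.
Unshelve. all: by end_near. Qed.

Lemma partial_multi_pole phi e j (F : 'rV[C]_n -> C) (c : R[i]) : curve_cont G phi ->
  (forall z, Un z -> F z = c * multi_pole phi e z) ->
  forall z, Un z -> partial j F z =
    c * (e j).+1%:R * multi_pole phi (fun i => e i + (i == j))%N z.
Proof.
move=> cphi hF z Uz.
have [A [_ AU AE]] := multi_pole_split j e Uz.
have cA : curve_cont G (with_poles A phi) by exact: (with_poles_cont m2 domU HG).
have [d d0 dz] := off_curve_in domU HG (Uz j).
have [r r0 hr] := open_disk domU (Uz j).
rewrite (AE phi _ z) => [|i ij]; last by rewrite (negbTE ij) addn0.
rewrite eqxx addn1 -mulrA.
have h1 := cauchy_pole_cdiff m2 HG (e j).+1 cA d0 dz.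
have hc : cdiff (fun x => c * cauchy_pole G (with_poles A phi) (e j).+1 x) (z 0 j)
   (c * ((e j).+1%:R * cauchy_pole G (with_poles A phi) (e j).+2 (z 0 j))).
  have hcst : cdiff (fun=> c) (z 0 j) 0.
    exact: (uniform_deriv_cst (c := fun=> c) (modulus_ge0 c)).
  by apply: (cdiff_eq (cdiffM hcst h1)); rewrite mul0r add0r.
apply: (cdiff_derive r0 hc) => h hh.
have Uh : Un (z + h *: delta_mx 0 j).
  by apply: (@power_domain_move j z h r%:C) => //; rewrite modulus_real gtr0_norm.
rewrite hF// (AE phi e) => [|i ij].
  by rewrite !mxE eqxx /= eqxx mulr1.
by rewrite !mxE eqxx /= (negbTE ij) mulr0 addr0.
Qed.

Lemma eq_multi_pole phi e e' z : e =1 e' -> multi_pole phi e z = multi_pole phi e' z.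
Proof.
move=> ee; apply: eq_contour => t _; congr (_ / _).
by apply: eq_bigr => j _; rewrite ee.
Qed.

Lemma iter_partial_multi_pole phi j p e (F : 'rV[C]_n ->
  C) (c : R[i]) : curve_cont G phi ->
  e j = 0%N -> (forall z, Un z -> F z = c * multi_pole phi e z) ->
  forall z, Un z -> iter p (partial j) F z =
    c * p`!%:R * multi_pole phi (fun i => if i == j then p else e i) z.
Proof.
move=> cphi ej hF; elim: p => [|p IH] z Uz.
  rewrite /= hF// fact0 mulr1; congr (_ * _); apply: eq_multi_pole => i.
  by case: eqVneq => [->|].
rewrite iterS (partial_multi_pole j cphi IH)// eqxx factS mulnC natrM -!mulrA.
congr (_ * (_ * (_ * _))); apply: eq_multi_pole => i.
by case: eqVneq => _; rewrite ?addn1 ?addn0.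
Qed.

Lemma mpartial_multi_pole phi (g : 'I_n -> nat) (F : 'rV[C]_n ->
  C) (c : R[i]) : curve_cont G phi ->
  (forall z, Un z -> F z = c * multi_pole phi (fun=> 0%N) z) ->
  forall z, Un z -> mpartial g F z = c * (\prod_(j < n) (g j)`!)%:R * multi_pole phi
    g z.
Proof.
move=> cphi hF.
have key (s : seq 'I_n) : uniq s -> forall z, Un z ->
   foldr (fun j => iter (g j) (partial j)) F s z =
   c * (\prod_(j <- s) (g j)`!)%:R * multi_pole phi (fun i =>
     if i \in s then g i else 0%N) z.
  elim: s => [_|j s IH /= /andP[js us]] z Uz; first by rewrite /= big_nil mulr1 hF.
  have ej : (if j \in s then g j else 0%N) = 0%N by rewrite (negbTE js).
  rewrite (iter_partial_multi_pole (g j) cphi ej (IH us))// big_cons mulnC natrM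
    -!mulrA.
  congr (_ * (_ * (_ * _))); apply: eq_multi_pole => i.
  by rewrite inE; case: eqVneq => [->|].
move=> z Uz; rewrite /mpartial key ?enum_uniq// big_enum; congr (_ * _).
by apply: eq_multi_pole => i; rewrite mem_enum.
Qed.

End PartialDerivatives.

(** * Holomorphy of the transform *)

Lemma differentiable_quadratic (K : numFieldType) (V W : normedModType K) (F : V -> W)
    (L : {linear V -> W}) (z : V) (r D : K) : 0 < r -> 0 <= D -> continuous L ->
  (forall h, `|h| <= r -> `|F (z + h) - F z - L h| <= D * `|h| ^+ 2) ->
    differentiable F z.
Proof.
move=> r0 D0 cL hF.
have expand : F \o shift z = cst (F z) + L +o_ 0 id.
  apply/eqaddoP => e e0.
  have D1 : 0 < D + 1 by rewrite ltr_wpDl.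
  have eD : 0 < e / (D + 1) by rewrite divr_gt0.
  near=> h.
  have hr : `|h| <= r by near: h; exact: nbhs0_le.
  have he : `|h| <= e / (D + 1) by near: h; exact: nbhs0_le.
  rewrite !fctE /= [h + z]addrC opprD addrA (le_trans (hF h hr))// expr2 mulrA.
  rewrite ler_wpM2r// (le_trans (ler_wpM2l D0 he))// mulrCA ler_piMr ?(ltW e0)//.
  by rewrite ler_pdivrMr// mul1r lerDl.
by apply/diff_locallyP; rewrite (diff_unique cL expand).
Unshelve. all: by end_near. Qed.

Section Holomorphy.
Context {R : realType} (m n : nat) (U : set (Cplx R)) (G : curves R).
Hypothesis m2 : (2 <= m)%N.
Hypothesis domU : bounded_domain U.
Hypothesis HG : positive_Cm_boundary m U G.
Local Notation C := (Cplx R).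
Local Notation Un := (@power_domain R n U).
Implicit Types (z v : 'rV[C]_n) (phi : R[i] -> R[i]).

Lemma normr_coord z j : `|z 0 j| <= `|z|.
Proof.
rewrite [leRHS]/Num.Def.normr /= mx_normE.
exact: (le_bigmax _ (fun i : 'I_1 * 'I_n => `|z i.1 i.2|%:nng) (0, j)).
Qed.

Definition unit_direction v := forall j, modulus (v 0 j) <= 1.

(** Taking the direction as a parameter turns differentiability in several variables into
    a uniform statement about one complex variable. *)
Lemma kernel_uniform_deriv z d (s : seq 'I_n) : 0 < d ->
  (forall j, off_curve G d (z 0 j)) ->
  uniform_deriv (fun p => unit_direction p.1 /\ on_curve G p.2)
    (fun p h => \prod_(j <- s) (p.2 - z 0 j - h * p.1 0 j)^-1)
    (fun p => \prod_(j <- s) (p.2 - z 0 j)^-1 * \sum_(j <- s) (p.1 0 j / (p.2 - z 0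
      j))).
Proof.
move=> d0 dz; elim: s => [|j s IH].
  have [C1 [r [C0 r0 h]]] : uniform_deriv (fun p => unit_direction p.1 /\ on_curve G
    p.2)
      (fun (p : 'rV[C]_n * R[i]) (h : R[i]) => 1) (fun p => 0).
    apply: (uniform_deriv_cst (c := fun=> 1) (ler01)) => p _.
    by rewrite modulus1.
  exists C1, r; split => // p hp; have [h1 h2 h3] := h p hp.
  rewrite !big_nil mulr0; split => // x hx; rewrite !big_nil; exact: h3.
have hj : uniform_deriv (fun p : 'rV[C]_n * R[i] => unit_direction p.1 /\ on_curve G
  p.2)
    (fun p h => (p.2 - z 0 j - h * p.1 0 j)^-1) (fun p => p.1 0 j / (p.2 - z 0 j) ^+ 2).
  apply: (uniform_derivV (a := fun p => p.2 - z 0 j) (b := fun p : 'rV[C]_n * R[i] =>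
    p.1 0 j) d0).
  by move=> p [hv op]; split; [exact: (dz j)|exact: hv].
have [C1 [r [C0 r0 h]]] := uniform_derivM hj IH.
exists C1, r; split => // p hp; have [h1 h2 h3] := h p hp.
rewrite !big_cons.
have E : \prod_(i <- s) (p.2 - z 0 i - 0 * p.1 0 i)^-1 = \prod_(i <- s) (p.2 - z 0
  i)^-1.
  by apply: eq_bigr => i _; rewrite mul0r subr0.
have pj : p.2 - z 0 j != 0 := off_curve_neq0 d0 (dz j) (proj2 hp).
have lE : p.1 0 j / (p.2 - z 0 j) ^+ 2 * \prod_(i <- s) (p.2 - z 0 i - 0 * p.1 0 i)^-1 +
   (p.2 - z 0 j - 0 * p.1 0 j)^-1 * (\prod_(i <- s) (p.2 - z 0 i)^-1 * \sum_(i <- s)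
     (p.1 0 i / (p.2 - z 0 i))) =
   (p.2 - z 0 j)^-1 * \prod_(i <- s) (p.2 - z 0 i)^-1 *
   (p.1 0 j / (p.2 - z 0 j) + \sum_(i <- s) (p.1 0 i / (p.2 - z 0 i))).
  rewrite E mul0r subr0 !expr2 invfM.
  by move: (\prod_(i <- s) _) (\sum_(i <- s) _) (p.2 - z 0 j)^-1 => P S q; ring.
rewrite -lE; split => // x hx; rewrite !big_cons; exact: h3.
Qed.

Lemma holomorphic_cauchy_norlund phi z : curve_cont G phi -> Un z ->
  differentiable (cauchy_norlund G phi : 'rV[C]_n -> C) z.
Proof.
move=> cphi Uz.
have H j : exists d, 0 < d /\ off_curve G d (z 0 j).
  by have [d d0 hd] := off_curve_in domU HG (Uz j); exists d.
have [dj hdj] := choice H.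
have [d d0 hd] := finite_pos_min (fun j => proj1 (hdj j)).
have dz j : off_curve G d (z 0 j) := off_curveW (hd j) (proj2 (hdj j)).
have [M M0 hM] := curve_cont_bounded HG cphi.
pose P (t : R[i]) := \prod_(j < n) (t - z 0 j)^-1.
have cP (s : seq 'I_n) : curve_cont G (fun t => \prod_(j <- s) (t - z 0 j)^-1).
  elim: s => [|j s IH].
    rewrite (_ : (fun t => _) = fun=> 1); first exact: curve_cont_cst.
    by apply/funext => t; rewrite big_nil.
  rewrite (_ : (fun t => _) = fun t => (t - z 0 j)^-1 * \prod_(j <- s) (t - z 0
    j)^-1); last first.
    by apply/funext => t; rewrite big_cons.
  by apply: curve_contM => //; exact: (curve_cont_pole m2 HG 1 d0 (dz j)).
pose K j : C := (2 * (pi : R)%:C * 'i%C)^-1 * contour_integral G (fun t =>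
  phi t * (P t / (t - z 0 j))).
pose L v : C := \sum_j v 0 j * K j.
have Lin : linear L.
  move=> a u v; rewrite /L scaler_sumr -big_split /=; apply: eq_bigr => j _.
  by rewrite !mxE mulrDl -mulrA.
pose Lc : {linear 'rV[C]_n -> C} := HB.pack L (GRing.isLinear.Build _ _ _ _ L Lin).
have Lb v : modulus (L v) <= (\sum_j modulus (K j)) * complex.Re `|v|.
  rewrite /L (le_trans (modulus_sum _ _ _))// mulr_suml; apply: ler_sum => j _.
  rewrite modulusM mulrC ler_wpM2l ?modulus_ge0//.
  have := normr_coord v j; rewrite normcE.
  by rewrite -[`|v|]RRe_real ?normr_real// lecR.
have nE v : `|v| = (complex.Re `|v|)%:C by rewrite RRe_real ?normr_real.
have n0 v : 0 <= complex.Re `|v| by rewrite -lecR -nE normr_ge0.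
have cL : continuous Lc.
  apply/linear_bounded_continuous/bounded_funP => r.
  exists ((\sum_j modulus (K j))%:C * r) => v vr; rewrite normcE.
  rewrite (le_trans (_ : _ <= (\sum_j modulus (K j))%:C * `|v|))//.
    by rewrite nE -rmorphM lecR; exact: Lb.
  by rewrite ler_wpM2l// lecR sumr_ge0// => j _; exact: modulus_ge0.
(* The expansion along the directions of the unit polydisk. *)
pose k v t h := phi t * \prod_(j <- index_enum 'I_n) (t - z 0 j - h * v 0 j)^-1.
pose l v t := phi t * (P t * \sum_(j <- index_enum 'I_n) (v 0 j / (t - z 0 j))).
have ck v h : unit_direction v -> modulus h <= d / 2 -> curve_cont G (k v ^~ h).
  move=> hv hh; apply: curve_contM => //.
  elim: (index_enum 'I_n) => [|j s IH].
    rewrite (_ : (fun t => _) = fun=> 1); first exact: curve_cont_cst.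
    by apply/funext => t; rewrite big_nil.
  rewrite (_ : (fun t => _) = fun t => (t - (z 0 j + h * v 0 j))^-1 *
      \prod_(j <- s) (t - z 0 j - h * v 0 j)^-1); last first.
    by apply/funext => t; rewrite big_cons opprD addrA.
  apply: curve_contM => //.
  have d20 : 0 < d / 2 by rewrite divr_gt0.
  apply: (curve_cont_pole m2 HG 1 d20).
  apply: (@off_curveW R G (d - modulus (z 0 j - (z 0 j + h * v 0 j))));
    last exact: off_curve_dist.
  rewrite opprD addrA subrr sub0r modulusN modulusM.
  have := ler_pM (modulus_ge0 _) (modulus_ge0 _) hh (hv j); lra.
have cterm v (j : 'I_n) : curve_cont G (fun t => v 0 j / (t - z 0 j)).
  by apply: curve_contM; [exact: curve_cont_cst|exact: (curve_cont_pole m2 HG 1 d0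
    (dz j))].
have csum v (s : seq 'I_n) : curve_cont G (fun t => \sum_(j <- s) (v 0 j / (t - z 0
  j))).
  elim: s => [|j s IH].
    rewrite (_ : (fun t => _) = fun=> 0); first exact: curve_cont_cst.
    by apply/funext => t; rewrite big_nil.
  rewrite (_ : (fun t => _) = fun t => (v 0 j / (t - z 0 j)) + \sum_(j <- s) (v 0 j /
    (t - z 0 j))); last first.
    by apply/funext => t; rewrite big_cons.
  exact: curve_contD.
have cl v : curve_cont G (l v).
  by apply: curve_contM => //; apply: curve_contM; [exact: cP|exact: csum].
have ud : uniform_deriv (fun p => unit_direction p.1 /\ on_curve G p.2)
    (fun p => k p.1 p.2) (fun p => l p.1 p.2).
  have h1 : uniform_deriv (fun p => unit_direction p.1 /\ on_curve G p.2)
      (fun (p : 'rV[C]_n * R[i]) (h : R[i]) => phi p.2) (fun p => 0).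
    by apply: (uniform_deriv_cst (c := fun p => phi p.2) M0) => p [_ op]; exact: hM.
  have [D [r [D0 r0 h]]] := uniform_derivM h1 (kernel_uniform_deriv (index_enum 'I_n)
    d0 dz).
  exists D, r; split => // p hp; have [g1 g2 g3] := h p hp.
  have lE : l p.1 p.2 = 0 * \prod_(j <- index_enum 'I_n) (p.2 - z 0 j - 0 * p.1 0
    j)^-1 +
    phi p.2 * (P p.2 * \sum_(j <- index_enum 'I_n) (p.1 0 j / (p.2 - z 0 j))).
    by rewrite mul0r add0r.
  by rewrite lE; split.
have d20 : 0 < d / 2 by rewrite divr_gt0.
have [D [r [D0 r0 hD]]] := uniform_deriv_contour m2 HG d20
  (fun v h hv hh => ck v h hv hh) (fun v _ => cl v) ud.
pose c0 : R[i] := (2 * (pi : R)%:C * 'i%C)^-1.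
have FE v h : cauchy_norlund G phi (z + h *: v : 'rV[C]_n) = c0 * contour_integral G
  (k v ^~ h).
  congr (_ * _); apply: eq_contour => t _; rewrite /k -prodfV; congr (_ * _).
  by apply: eq_bigr => j _; rewrite !mxE opprD addrA.
have LE v : L v = c0 * contour_integral G (l v).
  have -> : contour_integral G (l v) = \sum_j v 0 j * contour_integral G (fun t =>
    phi t * (P t / (t - z 0 j))).
    have cj j : curve_cont G (fun t => phi t * (P t / (t - z 0 j))).
      apply: curve_contM => //; apply: curve_contM; first exact: cP.
      exact: (curve_cont_pole m2 HG 1 d0 (dz j)).
    rewrite /l; elim: (index_enum 'I_n) => [|j s IH].
      rewrite big_nil -[RHS](mul0r (contour_integral G (fun=> 1))) -(contourZ m2 HG);
        last exact: curve_cont_cst.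
      by apply: eq_contour => t _; rewrite big_nil mulr0 mulr0 mul0r.
    rewrite big_cons -IH -(contourZ m2 HG)// -(contourD m2 HG); first last.
    - by apply: curve_contM => //; apply: curve_contM; [exact: cP|exact: csum].
    - by apply: curve_contM; [exact: curve_cont_cst|exact: cj].
    apply: eq_contour => t _; rewrite big_cons.
    by move: (\sum_(i <- s) _) (P t) (phi t) (v 0 j) (t - z 0 j)^-1 => *; ring.
  rewrite mulr_sumr; apply: eq_bigr => j _; rewrite /K -/c0.
  by rewrite mulrCA.
have c00 : 0 <= modulus c0 * D by rewrite mulr_ge0// modulus_ge0.
apply: (@differentiable_quadratic C 'rV[C]_n C _ Lc z r%:C (modulus c0 * D)%:C) => //.
- by rewrite ltcR.
- by rewrite lecR.
move=> h; rewrite nE; set a := complex.Re `|h| => ar; rewrite lecR in ar.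
have a0 : 0 <= a by exact: n0.
change (`|cauchy_norlund G phi (z + h) - cauchy_norlund G phi z - L h| <= (modulus c0
  * D)%:C * a%:C ^+ 2 :> R[i]).
rewrite normcE -rmorphXn -rmorphM lecR.
have [aE|aN0] := eqVneq a 0.
  have -> : h = 0 by apply/eqP; rewrite -normr_eq0 nE -/a aE.
  have -> : L 0 = 0 by rewrite /L big1// => j _; rewrite mxE mul0r.
  by rewrite addr0 subrr subr0 modulus0 mulr_ge0// sqr_ge0.
have aC : a%:C * (a^-1)%:C = 1 :> R[i] by rewrite -rmorphM /= mulfV.
have LZ (x : C) (w : 'rV[C]_n) : L (x *: w) = x * L w.
  by rewrite /L mulr_sumr; apply: eq_bigr => j _; rewrite mxE mulrA.
pose v : 'rV[C]_n := (a^-1)%:C *: h.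
have hv : h = a%:C *: v by rewrite scalerA aC scale1r.
have uv : unit_direction v.
  move=> j; rewrite mxE modulusM modulus_real ger0_norm ?invr_ge0//.
  rewrite ler_pdivrMl ?lt0r ?aN0// mulr1; have := normr_coord h j.
  by rewrite normcE nE lecR.
have [_ _ hq] := hD v uv.
have := hq a%:C; rewrite modulus_real ger0_norm// => /(_ ar) hqa.
have -> : cauchy_norlund G phi (z + h) - cauchy_norlund G phi z - L h =
  c0 * (contour_integral G (k v ^~ a%:C) - contour_integral G (k v ^~ 0) - a%:C *
    contour_integral G (l v)).
  have := FE v 0; rewrite scale0r addr0 => ->.
  have -> : L h = a%:C * L v.
    by rewrite -LZ -hv.
  have -> : z + h = z + a%:C *: v by rewrite -hv.
  by rewrite FE LE (mulrCA a%:C) -!mulrBr.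
by rewrite modulusM -mulrA ler_wpM2l ?modulus_ge0.
Qed.

End Holomorphy.

(** * Norms of the transform *)

Section HolderNorm.
Context {R : realType} (k n : nat) (U : set (Cplx R)) (G : curves R) (alpha : R).
Local Notation N := (k + n)%N.
Hypothesis n0 : (0 < n)%N.
Hypothesis domU : bounded_domain U.
Hypothesis HG : positive_Cm_boundary N.+1 U G.
Hypothesis alpha01 : 0 < alpha < 1.
Local Notation C := (Cplx R).
Local Notation Un := (@power_domain R n U).
Implicit Types (z w : 'rV[C]_n) (phi : R[i] -> R[i]).
Let N0 : (0 < N)%N. Proof. by rewrite addn_gt0 n0 orbT. Qed.
Let m2 : (2 <= N.+1)%N. Proof. by rewrite ltnS N0. Qed.

(** The norm is a sum of suprema, each of them nonnegative because the curve is not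
    empty, so it bounds each of them. *)
Lemma curve_norm_density phi M : (forall i, Cm N.-1 (phi \o path_of (c := G) i)) ->
  (curve_norm N.-1 alpha G phi <= M%:E)%E -> density_bounded N G alpha phi (2 * M).
Proof.
move=> Cphi hM; have [_ [i0 _]] := curve_nonempty domU HG.
have ge0 (psi : 'I_(ncomp G) -> R -> R[i]) : (0 <= curve_sup_norm psi)%E.
  apply: (@le_trans _ _ (modulus (psi i0 0))%:E); first by rewrite lee_fin modulus_ge0.
  by apply: ereal_sup_ubound; exists i0, 0.
have ge0h (psi : 'I_(ncomp G) -> R -> R[i]) : (0 <= curve_holder_seminorm alpha psi)%E.
  apply: (@le_trans _ _ (modulus (psi i0 0 - psi i0 1) / `|0 - 1| `^ alpha)%:E).
    by rewrite lee_fin divr_ge0 ?modulus_ge0 ?powR_ge0.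
  by apply: ereal_sup_ubound; exists i0, 0, 1; split => //; rewrite eq_sym oner_eq0.
have hsup j i s : (j <= N.-1)%N -> modulus (curve_deriv (G := G) j phi i s) <= M.
  move=> jN; rewrite -lee_fin (le_trans _ hM)// /curve_norm.
  have jN' : (j < N.-1.+1)%N by [].
  rewrite (bigD1 (Ordinal jN'))//= -addeA (le_trans (_ :
    _ <= curve_sup_norm (curve_deriv (G := G) j phi))%E)//.
    by apply: ereal_sup_ubound; exists i, s.
  by rewrite leeDl// adde_ge0// sume_ge0.
have hhol i s s' : modulus (curve_deriv (G := G) N.-1 phi i s - curve_deriv (G :=
  G) N.-1 phi i s') <= M * `|s - s'| `^ alpha.
  have [->|ss] := eqVneq s s'.
    rewrite !subrr modulus0 mulr_ge0 ?powR_ge0//.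
    by rewrite (le_trans _ (hsup 0%N i0 0 isT))// modulus_ge0.
  have p0 : 0 < `|s - s'| `^ alpha by rewrite powR_gt0// normr_gt0 subr_eq0.
  rewrite -ler_pdivrMr// -lee_fin (le_trans _ hM)// /curve_norm.
  rewrite (le_trans (_ : _ <= curve_holder_seminorm alpha (curve_deriv (G :=
    G) N.-1 phi))%E)//.
    by apply: ereal_sup_ubound; exists i, s, s'.
  by rewrite leeDr// sume_ge0.
split; last first.
  by rewrite mulr_ge0// (le_trans _ (hsup 0%N i0 0 isT))// modulus_ge0.
move=> i.
have -> : (fun s => phi (path_of (c := G) i s)) = curve_deriv (G := G) 0 phi i.
  by rewrite /curve_deriv cderive1n0.
apply: (@holder_bounded_chain _ _ alpha01 N.-1 (fun j => curve_deriv (G := G) j phi i)).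
- by move=> j jN; exact: Cm_cderiv (Cphi i) jN.
- exact: Cm_ccont (Cphi i) (leqnn _).
- by move=> j s; exact: hsup.
- by move=> s s'; exact: hhol.
Qed.

(** The derivative of the integral has one more pole, hence at most the critical growth
    at the boundary. *)
Lemma pole_holder q l : (q < N)%N -> (0 < l)%N -> (q + l = N)%N -> exists2 D, 0 <= D &
  forall phi M A (x y : R[i]), density_bounded N G alpha phi M -> size A = q ->
  (forall a, a \in A -> U a) -> U x -> U y ->
  modulus (cauchy_pole G (with_poles A phi) l x - cauchy_pole G (with_poles A phi) l
    y) <=
    D * M * modulus (x - y) `^ alpha.
Proof.
move=> qN l0 qlN; have [a0 a1] := andP alpha01.
have [hb hg] := pole_bounds N0 domU HG alpha01 qN.
have [|D1 D10 h1] := hb l l0; first by rewrite qlN.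
have [||D2 D20 h2] := hg l.+1; [by rewrite ltnS|by rewrite addnS qlN|].
have [|D3 [r [D30 r0 h3]]] := hardy_littlewood m2 domU HG (b := alpha);
  first by rewrite a0 ltW.
exists (D3 * (l%:R * D2) + 2 * D1 / r `^ alpha).
  by rewrite addr_ge0// ?mulr_ge0 ?invr_ge0 ?powR_ge0// mulr_ge0.
move=> phi M A x y hphi sA AU Ux Uy; have M0 := proj2 hphi.
have cA : curve_cont G (with_poles A phi).
  by apply: (with_poles_cont m2 domU HG) => //; exact: density_cont hphi.
have [xyr|rxy] := leP (modulus (x - y)) r.
  have D2M : 0 <= l%:R * (D2 * M) by rewrite !mulr_ge0.
  rewrite (le_trans (h3 x y _ (cauchy_pole G (with_poles A phi) l)
    (fun t => l%:R * cauchy_pole G (with_poles A phi) l.+1 t) Ux Uy xyr D2M _ _))//.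
  - by move=> t Ut _; have [d d0 dt] := off_curve_in domU HG Ut;
    exact: (cauchy_pole_cdiff m2 HG l cA d0 dt).
  - move=> t d Ut _ d0 dt; rewrite modulusM modulus_nat -mulrA ler_wpM2l//.
    exact: h2.
  rewrite ler_wpM2r ?powR_ge0// mulrDl -!mulrA lerDl !mulr_ge0//.
  by rewrite invr_ge0 powR_ge0.
have b1 := h1 phi M A x hphi sA AU Ux; have b2 := h1 phi M A y hphi sA AU Uy.
rewrite (le_trans (modulusB _ _))// (le_trans (lerD b1 b2))//.
have ra : 0 < r `^ alpha by rewrite powR_gt0.
have rxa : r `^ alpha <= modulus (x - y) `^ alpha.
  by apply: ge0_ler_powR; rewrite ?nnegrE ?modulus_ge0// ltW.
have D1M : 0 <= D1 * M by rewrite mulr_ge0.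
rewrite (le_trans (_ : _ <= 2 * D1 / r `^ alpha * M * modulus (x - y) `^ alpha))//.
  rewrite (_ : 2 * D1 / _ * M * _ = (D1 * M + D1 * M) * (modulus (x - y) `^ alpha / r
    `^ alpha)); last by ring.
  by rewrite ler_peMr ?addr_ge0// ler_pdivlMr// mul1r.
by rewrite ler_wpM2r ?powR_ge0// ler_wpM2r// lerDr !mulr_ge0.
Qed.

Lemma coord_le_euclidean z j : modulus (z 0 j) <= euclidean_norm z.
Proof.
rewrite /euclidean_norm -[leLHS]ger0_norm ?modulus_ge0// -sqrtr_sqr ler_wsqrtr//.
by rewrite (bigD1 j)//= lerDl sumr_ge0// => i _; exact: sqr_ge0.
Qed.

Lemma sum_succ (g : 'I_n -> nat) j : (\sum_(i | i != j) (g i).+1 + (g j).+1 = n +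
  \sum_i g i)%N.
Proof.
have -> : (n + \sum_i g i = \sum_i (g i).+1)%N.
  rewrite -[X in (X + _)%N](card_ord n) -sum1_card -big_split /=.
  by apply: eq_bigr => i _; rewrite add1n.
by rewrite [RHS](bigD1 j)//= addnC.
Qed.

Let c0 : R[i] := (2 * (pi : R)%:C * 'i%C)^-1.

Definition is_transform phi (F : 'rV[C]_n -> C) :=
  forall z, Un z -> F z = cauchy_norlund G phi z.

Lemma is_transformE phi F : is_transform phi F ->
  forall z, Un z -> F z = c0 * multi_pole G phi (fun=> 0%N) z.
Proof. by move=> h z /h ->. Qed.

Lemma sup_norm_mpartial (g : 'I_n -> nat) : (\sum_i g i <= k)%N -> exists2 D, 0 <= D &
  forall phi M F, density_bounded N G alpha phi M -> is_transform phi F ->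
  (sup_norm Un (mpartial g F) <= (D * M)%:E)%E.
Proof.
move=> gk; pose j : 'I_n := Ordinal n0.
pose q := (\sum_(i | i != j) (g i).+1)%N.
have qlN : (q + (g j).+1 <= N)%N by rewrite sum_succ addnC leq_add2r.
have qN : (q < N)%N by apply: leq_trans qlN; rewrite addnS ltnS leq_addr.
have [hb _] := pole_bounds N0 domU HG alpha01 qN.
have [D D0 hD] := hb _ (ltn0Sn (g j)) qlN.
pose c : R[i] := c0 * (\prod_(j < n) (g j)`!)%:R.
exists (modulus c * D); first by rewrite mulr_ge0// modulus_ge0.
move=> phi M F hphi hF; apply: ge_ereal_sup => _ [z Uz ->].
rewrite lee_fin (mpartial_multi_pole m2 domU HG g (density_cont hphi) (is_transformE
  hF))//.
have [A [sA AU AE]] := multi_pole_split G j g Uz.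
by rewrite modulusM -mulrA ler_wpM2l ?modulus_ge0// (AE phi g z)//; exact: hD.
Qed.

(** The variables are moved one at a time, the other ones being held in [U]. *)
Lemma holder_seminorm_mpartial (g : 'I_n -> nat) : (\sum_i g i == k)%N ->
  exists2 D, 0 <= D &
  forall phi M F, density_bounded N G alpha phi M -> is_transform phi F ->
  (holder_seminorm alpha Un (mpartial g F) <= (D * M)%:E)%E.
Proof.
move=> /eqP gk; have [a0 a1] := andP alpha01.
have H (j : 'I_n) : exists D, 0 <= D /\ forall phi M z w,
  density_bounded N G alpha phi M ->
    Un z -> Un w -> (forall i, i != j -> w 0 i = z 0 i) ->
    modulus (multi_pole G phi g z - multi_pole G phi g w) <= D * M * modulus (z 0 j -
      w 0 j) `^ alpha.
  pose q := (\sum_(i | i != j) (g i).+1)%N.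
  have qlN : (q + (g j).+1 = N)%N by rewrite sum_succ gk addnC.
  have qN : (q < N)%N by rewrite -qlN addnS ltnS leq_addr.
  have [D D0 hD] := pole_holder qN (ltn0Sn (g j)) qlN.
  exists D; split => // phi M z w hphi Uz Uw zw.
  have [A [sA AU AE]] := multi_pole_split G j g Uz.
  rewrite (AE phi g z)// (AE phi g w) => [|i ij]; last by rewrite zw.
  exact: hD.
have [D hD] := choice H.
pose c : R[i] := c0 * (\prod_(j < n) (g j)`!)%:R.
exists (modulus c * \sum_j D j).
  by rewrite mulr_ge0 ?modulus_ge0// sumr_ge0// => j _; case: (hD j).
move=> phi M F hphi hF; have M0 := proj2 hphi.
apply: ge_ereal_sup => _ [z [w [Uz Uw zw ->]]].
have E0 : 0 < euclidean_norm (z - w).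
  have [j zwj] : exists j, z 0 j != w 0 j.
    apply: contrapT => nex; move/eqP: zw; apply; apply/rowP => j.
    by apply/eqP; apply: contrapT => h; apply: nex; exists j; exact/negP.
  by rewrite (lt_le_trans _ (coord_le_euclidean _ j))// modulus_gt0 !mxE subr_eq0.
rewrite lee_fin ler_pdivrMr ?powR_gt0//.
have mE := mpartial_multi_pole m2 domU HG g (density_cont hphi) (is_transformE hF).
rewrite !mE// -/c -mulrBr modulusM -!mulrA ler_wpM2l ?modulus_ge0//.
(* The first p coordinates are those of w, the other ones those of z. *)
pose hyb p : 'rV[C]_n := \row_(j < n) (if (j < p)%N then w 0 j else z 0 j).
have h0 : hyb 0%N = z by apply/rowP => j; rewrite mxE.
have hn : hyb n = w by apply/rowP => j; rewrite mxE ltn_ord.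
have Uh p : Un (hyb p) by move=> j; rewrite mxE; case: ifP => _; [exact: Uw|exact: Uz].
rewrite -h0 -{1}hn.
have tel (f : nat -> R[i]) p : f 0%N - f p = \sum_(i < p) (f i - f i.+1).
  elim: p => [|p IH]; first by rewrite big_ord0 subrr.
  by rewrite big_ord_recr /= -IH addrA subrK.
rewrite (tel (fun p => multi_pole G phi g (hyb p)) n) h0.
rewrite (le_trans (modulus_sum _ _ _))// mulr_suml; apply: ler_sum => p _.
have [Dp0 hp] := hD p.
rewrite (le_trans (hp phi M (hyb p) (hyb p.+1) hphi (Uh _) (Uh _) _))//.
  by move=> i ip; rewrite !mxE ltnS leq_eqVlt (negbTE (ip : (i != p :> nat))).
rewrite -mulrA ler_wpM2l// ler_wpM2l//.
rewrite ge0_ler_powR ?(ltW a0)// ?nnegrE ?modulus_ge0 ?sqrtr_ge0//.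
rewrite !mxE ltnn ltnSn; have := coord_le_euclidean (z - w) p.
by rewrite !mxE.
Qed.

Lemma holder_norm_transform : exists2 D, 0 <= D &
  forall phi M F, density_bounded N G alpha phi M -> is_transform phi F ->
  (holder_norm k alpha Un F <= (D * M)%:E)%E.
Proof.
have H1 (g : {ffun 'I_n -> 'I_k.+1}) : exists D, 0 <= D /\ ((\sum_(j < n) g j <= k)%N ->
  forall phi M F, density_bounded N G alpha phi M -> is_transform phi F ->
  (sup_norm Un (mpartial (fun j => g j : nat) F) <= (D * M)%:E)%E).
  have [gk|gk] := boolP (\sum_(j < n) g j <= k)%N; last by exists 0.
  by have [D D0 h] := sup_norm_mpartial gk; exists D.
have H2 (g : {ffun 'I_n -> 'I_k.+1}) : exists D, 0 <= D /\ ((\sum_(j < n) g j == k)%N ->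
  forall phi M F, density_bounded N G alpha phi M -> is_transform phi F ->
  (holder_seminorm alpha Un (mpartial (fun j => g j : nat) F) <= (D * M)%:E)%E).
  have [gk|gk] := boolP (\sum_(j < n) g j == k)%N; last by exists 0.
  by have [D D0 h] := holder_seminorm_mpartial gk; exists D.
have [D1 h1] := choice H1; have [D2 h2] := choice H2.
exists (\sum_(g : {ffun 'I_n -> 'I_k.+1} | (\sum_(j < n) g j <= k)%N) D1 g +
  \sum_(g : {ffun 'I_n -> 'I_k.+1} | (\sum_(j < n) g j == k)%N) D2 g).
  by rewrite addr_ge0// sumr_ge0// => g _; [case: (h1 g)|case: (h2 g)].
move=> phi M F hphi hF; rewrite mulrDl !mulr_suml EFinD -!sumEFin /holder_norm.
apply: leeD; apply: lee_sum => g gk.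
  exact: (proj2 (h1 g) gk phi M F hphi hF).
exact: (proj2 (h2 g) gk phi M F hphi hF).
Qed.

End HolderNorm.

(** * The theorem *)

Section Difference.
Context {R : realType}.

Lemma Cm_realB m (f g : R -> R) : Cm_real m f -> Cm_real m g ->
  Cm_real m (fun s => f s - g s).
Proof.
move=> [df cf] [dg cg].
have E j : (j <= m)%N -> derive1n j (fun s => f s - g s) = fun s => derive1n j f s - derive1n j g s.
  elim: j => [//|j IH jm]; apply/funext => s.
  rewrite derive1nS IH ?(ltnW jm)// derive1E.
  by have [_ ->] := rderivB (derivable_is_derive (df j s jm)) (derivable_is_derive (dg j s jm)).
split=> [j s jm|]; last by rewrite E// => s; exact: (cvgB (cf s) (cg s)).
rewrite E ?(ltnW jm)//.
by have [] := rderivB (derivable_is_derive (df j s jm)) (derivable_is_derive (dg j s jm)).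
Qed.

Lemma CmB m (f g : R -> R[i]) : Cm m f -> Cm m g -> Cm m (fun s => f s - g s).
Proof.
move=> [f1 f2] [g1 g2]; split.
  rewrite (_ : _ \o _ = fun s => (complex.Re (R:=R) \o f) s - (complex.Re (R:=R) \o g) s).
    exact: Cm_realB.
  by apply/funext => s /=; rewrite cReD cReN.
rewrite (_ : _ \o _ = fun s => (complex.Im (R:=R) \o f) s - (complex.Im (R:=R) \o g) s).
  exact: Cm_realB.
by apply/funext => s /=; rewrite cImD cImN.
Qed.

End Difference.

Theorem theorem1p3 (R : realType) (k n : nat) (U : set (Cplx R))
    (G : curves R) (alpha : R) :
  (1 <= n)%N ->
  bounded_domain U ->
  positive_Cm_boundary (k + n + 1) U G ->
  0 < alpha < 1 ->
  [/\ (forall phi, curve_space (k + n - 1) alpha G phi ->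
         sym_holder_space k alpha U (cauchy_norlund G (n := n) phi)),
      (forall (a : R[i]%C) (phi psi : R[i]%C -> R[i]%C),
         curve_space (k + n - 1) alpha G phi ->
         curve_space (k + n - 1) alpha G psi ->
         forall z : 'rV[Cplx R]_n, power_domain U z ->
           cauchy_norlund G (fun t => a * phi t + psi t) z
           = a * cauchy_norlund G phi z + cauchy_norlund G psi z) &
      (forall phi0, curve_space (k + n - 1) alpha G phi0 ->
         forall eps : R, 0 < eps ->
         exists2 delta : R, 0 < delta &
         forall phi, curve_space (k + n - 1) alpha G phi ->
           (curve_norm (k + n - 1) alpha G (fun t => phi t - phi0 t)%R
              < delta%:E)%E ->
           (holder_norm k alpha (power_domain U)
              (fun z : 'rV[Cplx R]_n =>
                 cauchy_norlund G phi z - cauchy_norlund G phi0 z)%R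
              < eps%:E)%E)].
Proof.
move=> n0 domU HG alpha01.
rewrite addn1 in HG; rewrite subn1.
have m2 : (2 <= (k + n).+1)%N by rewrite ltnS addn_gt0 n0 orbT.
have cont phi : curve_space (k + n).-1 alpha G phi -> curve_cont G phi.
  by move=> [Cphi _] i; have := Cm_ccont (Cphi i) (leq0n _); rewrite cderive1n0.
have contz phi (z : 'rV[Cplx R]_n) : curve_cont G phi -> power_domain U z ->
    curve_cont G (fun t => phi t / \prod_(j < n) (t - z 0 j)).
  move=> cphi Uz; pose A : seq R[i] := [seq z 0 j | j <- index_enum 'I_n].
  have -> : (fun t => phi t / \prod_(j < n) (t - z 0 j)) = with_poles A phi.
    by apply/funext => t; rewrite /with_poles big_map.
  apply: (with_poles_cont m2 domU HG) => // a /mapP[j _ ->]; exact: Uz.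
have lin (a : R[i]) phi psi (z : 'rV[Cplx R]_n) : curve_cont G phi -> curve_cont G psi -> power_domain U z ->
    cauchy_norlund G (fun t => a * phi t + psi t) z =
    a * cauchy_norlund G phi z + cauchy_norlund G psi z.
  move=> cphi cpsi Uz; have c1 := contz _ _ cphi Uz; have c2 := contz _ _ cpsi Uz.
  rewrite /cauchy_norlund mulrCA -mulrDr; congr (_ * _).
  rewrite -(contourZ m2 HG)// -(contourD m2 HG)//; last first.
    by apply: curve_contM => //; exact: curve_cont_cst.
  by apply: eq_contour => t _; rewrite mulrDl mulrA.
have [D D0 hD] := holder_norm_transform n0 domU HG alpha01.
split.
- move=> phi phiS; have cphi := cont _ phiS; split.
  + by move=> z Uz; exact: (holomorphic_cauchy_norlund m2 domU HG cphi Uz).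
  + move=> z sigma _; congr (_ * _); apply: eq_contour => t _; congr (_ / _).
    rewrite (reindex_inj (@perm_inj _ sigma)) /=; apply: eq_bigr => j _.
    by rewrite mxE.
  + have [Cphi finM] := phiS.
    have [M hM] : exists M : R, (curve_norm (k + n).-1 alpha G phi <= M%:E)%E.
      move: finM; case: curve_norm => [M _|h|_]; [by exists M|by rewrite ltxx in h|].
      by exists 0; rewrite leNye.
    have dphi := curve_norm_density domU HG alpha01 Cphi hM.
    by rewrite (le_lt_trans (hD phi _ _ dphi _))// ltry.
- by move=> a phi psi hphi hpsi z Uz; apply: lin => //; exact: cont.
move=> phi0 phi0S eps eps0.
have D2 : 0 < 2 * D + 1 by rewrite ltr_wpDl// mulr_ge0.
exists (eps / (2 * D + 1)) => [|phi phiS hlt]; first by rewrite divr_gt0.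
pose psi t := phi t - phi0 t.
have Cpsi i : Cm (k + n).-1 (psi \o path_of (c := G) i).
  by have [C1 _] := phiS; have [C0 _] := phi0S; exact: CmB (C1 i) (C0 i).
have dpsi := curve_norm_density domU HG alpha01 Cpsi (ltW hlt).
have trpsi : is_transform U G psi
    (fun z : 'rV[Cplx R]_n => cauchy_norlund G phi z - cauchy_norlund G phi0 z).
  move=> z Uz; rewrite addrC -mulN1r -(lin _ _ _ z (cont _ phi0S) (cont _ phiS) Uz).
  by congr (_ * _); apply: eq_contour => t _; rewrite mulN1r addrC.
rewrite (le_lt_trans (hD psi _ _ dpsi trpsi))// lte_fin.
rewrite (_ : D * _ = eps * (2 * D / (2 * D + 1))); last by ring.
rewrite gtr_pMr//.
by rewrite ltr_pdivrMr// mul1r ltrDl.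
Qed.
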